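(* Let $(l_j)_{j=1}^\infty$ be a summable sequence of positive numbers and $(\phi_j)_{j=1}^\infty$ a sequence of real numbers. Let $H$ be the Hamburger Hamiltonian with these lengths and angles, $W_H$ its monodromy matrix, and $\rho_H$ the order of $W_H$. Let $\psi\in\mathbb R$ and let $d_l,d_\phi,c_l,c_\phi:[1,\infty)\to(0,\infty)$ be regularly varying functions each of which is $\approx$ to some nonincreasing function, such that $d_l\asymp1\asymp d_\phi$ locally, $c_\phi(t)\lesssim c_l(t)$ for sufficiently large $t$, $\operatorname{ind}d_l+\operatorname{ind}d_\phi<0$, and $\lim_{t\to\infty}c_l(t)c_\phi(t)=0$. Assume that $$l_j\lesssim d_l(j),\quad |\sin(\phi_{j+1}-\phi_j)|\lesssim d_\phi(j)\qquad\text{for sufficiently large }j,$$ $$\sum_{j=N+1}^\infty l_j\lesssim c_l(N),\quad \sum_{j=N+1}^\infty l_j\sin^2(\phi_j-\psi)\lesssim c_\phi(N)\qquad\text{for sufficiently large }N.$$ Denote $\delta_l:=-\operatorname{ind}d_l$, $\delta_\phi:=-\operatorname{ind}d_\phi$, $D(t):=\frac1{d_l(t)d_\phi(t)}$, $\delta:=\operatorname{ind}D$, $C(t):=\frac1{(c_l(t)c_\phi(t))^{1/2}}$, $\gamma:=\operatorname{ind}C$, and let $k(R),h(R)$ be as in the context. Then the following hold, where each bound $\lesssim$ is for sufficiently large $R$. (1) If $D(t)\lesssim tC(t)$ on $[1,\infty)$, then with $\alpha:=4\sup_{t\ge1}\frac{D(t)}{tC(t)}$ and $f(t):=tC(t)\log\big[\alpha\frac{tC(t)}{D(t)}\big]$,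 $$\log\Big(\max_{|z|=R}\|W_H(z)\|\Big)\lesssim\frac{R}{C(f^-(R))},\qquad \rho_H\le\frac1{1+\gamma}.$$ (2) If $tC(t)\lesssim D(t)$, $\int_1^\infty D(s)^{-1/2}ds<\infty$, and ($\gamma>0$ or $\frac{d_\phi}{d_l}$ is $\approx$ to a nondecreasing function), then $$\log\Big(\max_{|z|=R}\|W_H(z)\|\Big)\lesssim R^{\frac12}\int_{k(R)}^\infty D(s)^{-\frac12}ds,\qquad\rho_H\le\frac1\delta.$$ (3) If $tC(t)\lesssim D(t)$, $\int_1^\infty D(s)^{-1/2}ds=\infty$, $\frac1{d_l(t)}\lesssim tC(t)$, and $(\delta,\gamma)\ne(2,0)$, then with $f_1(t):=\big[C(t)\int_1^tD(s)^{-1/2}ds\big]^2$, $$\log\Big(\max_{|z|=R}\|W_H(z)\|\Big)\lesssim\frac{R}{C(f_1^-(R))},\qquad\rho_H\le\frac{2-\delta+\gamma}{2-\delta+2\gamma}.$$ (4) If $tC(t)\lesssim D(t)$, $\int_1^\infty D(s)^{-1/2}ds=\infty$, $tC(t)\lesssim\frac1{d_l(t)}$, $\int_1^\infty d_l(s)ds<\infty$, and $\delta_l>\delta_\phi$, then $$\log\Big(\max_{|z|=R}\|W_H(z)\|\Big)\lesssim R^{\frac12}\int_1^{h(R)}D(s)^{-\frac12}ds+R\int_{h(R)}^\infty d_l(s)ds,\qquad\rho_H\le\frac{1-\delta_\phi}{\delta_l-\delta_\phi}.$$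
   Context: Hamburger Hamiltonian: for $\phi\in\mathbb R$ let $\xi_\phi:=(\cos\phi,\sin\phi)^T$. Put $x_0:=0$, $x_j:=\sum_{i=1}^jl_i$, $\mathcal L:=\sum_{j=1}^\infty l_j<\infty$. The Hamburger Hamiltonian with lengths $l_j$ and angles $\phi_j$ is $H:(0,\mathcal L)\to\mathbb R^{2\times2}$, $H(t):=\xi_{\phi_j}\xi_{\phi_j}^T$ for $x_{j-1}\le t<x_j$, $j\in\mathbb N=\{1,2,\dots\}$. Monodromy matrix: let $J:=\begin{pmatrix}0&-1\\1&0\end{pmatrix}$. The fundamental solution $W(t;z)$, $t\in[0,\mathcal L]$, $z\in\mathbb C$, is the unique (absolutely continuous in $t$) $2\times2$-matrix solution of $\frac{\partial}{\partial t}W(t;z)J=zW(t;z)H(t)$ for a.e. $t\in(0,\mathcal L)$, $W(0;z)=I$; the monodromy matrix is $W_H(z):=W(\mathcal L;z)$. $\|\cdot\|$ is the operator norm. The order is $\rho_H:=\limsup_{R\to\infty}\frac{\log\log\max_{|z|=R}\|W_H(z)\|}{\log R}$. Comparison notation: $f\lesssim g$ means $f\le c\,g$ on the whole common domain for some constant $c>0$ (''for sufficiently large $x$'': on some $[x_0,\infty)$); $f\asymp g$ means $f\lesssim g$ and $g\lesssim f$; ''locally'' means on every compact subset; $f\approx g$ means $\lim_{t\to\infty}f(t)/g(t)$ exists in $(0,\infty)$; $f\sim g$ means this limit is $1$. Regular variation: a measurable $a:[1,\infty)\to(0,\infty)$ is regularly varying with index $\operatorname{ind}a=\alpha\in\mathbb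 R$ if $\lim_{r\to\infty}a(\lambda r)/a(r)=\lambda^\alpha$ for all $\lambda>0$. If $a$ is regularly varying with positive index, $a^-$ denotes an asymptotic inverse, i.e. a regularly varying function with $a(a^-(x))\sim a^-(a(x))\sim x$ (unique up to $\sim$), e.g. $a^-(x)=\sup\{t\in[1,\infty):a(t)<x\}$. (Only the behaviour of the functions for large arguments matters here.) For $R$ sufficiently large, $$k(R):=\sup\Big\{t\in[1,\infty):\sup_{1\le s\le t}\frac{2}{R\,d_l(s)d_\phi(s)}\le1\Big\},\qquad h(R):=\sup\Big\{t\in[1,\infty):\sup_{1\le s\le t}\frac{d_\phi(s)}{R\,d_l(s)}\le1\Big\}.$$ *)

(* Defs.v *)
From mathcomp Require Export all_boot all_order all_algebra.
From mathcomp Require Export complex.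
From mathcomp Require Export all_classical all_reals all_analysis.
Export Order.TTheory GRing.Theory Num.Theory.
Export numFieldNormedType.Exports.

Set Implicit Arguments.
Unset Strict Implicit.
Unset Printing Implicit Defensive.

Local Open Scope classical_set_scope.
Local Open Scope ring_scope.

Definition lesssim_on (R : realType) (T : Type) (A : set T) (f g : T -> R) :=
  exists2 c : R, 0 < c & forall x, A x -> f x <= c * g x.

(* With F := \oo or +oo: the bound holds for sufficiently large arguments. *)
Definition lesssim_near (R : realType) (T : Type) (F : set_system T)
    (f g : T -> R) :=
  exists2 c : R, 0 < c & \forall x \near F, f x <= c * g x.

Definition asymp_on (R : realType) (T : Type) (A : set T) (f g : T -> R) :=
  lesssim_on A f g /\ lesssim_on A g f.

Section RegularVariation.
Variable R : realType.
Implicit Types a b f g : R -> R.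

(* Functions on [1, oo) are represented by total functions, whose values
   below 1 are irrelevant. *)
Definition asymp_locally f g :=
  forall K : set R, compact K -> K `<=` `[1, +oo[ -> asymp_on K f g.

Definition approx f g :=
  exists2 c : R, 0 < c & f t / g t @[t --> +oo] --> c.

Definition sim f g := f t / g t @[t --> +oo] --> (1 : R).

Definition approx_nonincreasing f :=
  exists2 g, {in `[1, +oo[ &, nonincreasing_fun g} & approx f g.

Definition approx_nondecreasing f :=
  exists2 g, {in `[1, +oo[ &, nondecreasing_fun g} & approx f g.

Definition regularly_varying_index a (alpha : R) :=
  [/\ measurable_fun (`[1, +oo[ : set R) a,
      forall t, 1 <= t -> 0 < a t &
      forall lambda : R, 0 < lambda ->
        a (lambda * r) / a r @[r --> +oo] --> lambda `^ alpha].

Definition regularly_varying a := exists alpha, regularly_varying_index a alpha.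

Definition ind a : R := xget 0 [set alpha | regularly_varying_index a alpha].

(* b need only coincide with a regularly varying function for large arguments:
   for instance b x = sup [set t | 1 <= t /\ a t < x] is 0 for small x. *)
Definition asymptotic_inverse a b :=
  [/\ exists2 b0, regularly_varying b0 & \forall x \near +oo, b x = b0 x,
      sim (a \o b) id & sim (b \o a) id].

End RegularVariation.

Section HamburgerHamiltonian.
Variable R : realType.
Implicit Types (l phi : nat -> R).

(* The sequences l and phi are indexed from 1; their values at 0 are unused. *)
Definition summable_seq l := cvgn (fun n => \sum_(1 <= j < n) l j).

(* The sum of u j over j > N. *)
Definition tail_sum (u : nat -> R) (N : nat) : R :=
  limn (fun n => \sum_(N.+1 <= j < n) u j).

Definition total_length l : R := tail_sum l 0.

Definition node l (j : nat) : R := \sum_(1 <= i < j.+1) l i.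

Definition xi (p : R) : 'cV[R]_2 :=
  \col_(i < 2) (if i == 0 then cos p else sin p).

(* For 0 <= t < total_length l, exactly one j belongs to the set below. *)
Definition hamburger l phi (t : R) : 'M[R]_2 :=
  let j := xget 1%N [set j | (0 < j)%N /\ node l j.-1 <= t < node l j] in
  xi (phi j) *m (xi (phi j))^T.

Definition Jmx : 'M[R[i]]_2 :=
  \matrix_(i < 2, j < 2)
    (if (i == 0) && (j == 1) then -1
     else if (i == 1) && (j == 0) then 1 else 0).

Definition cabs (z : R[i]) : R := Normc.normc z.

Definition abs_continuous (a b : R) (f : R -> R[i]) :=
  forall eps : R, 0 < eps -> exists2 del : R, 0 < del &
    forall (n : nat) (u v : 'I_n -> R),
      (forall i, [/\ a <= u i, u i < v i & v i <= b]) ->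
      (forall i j, i != j -> v i <= u j \/ v j <= u i) ->
      \sum_(i < n) (v i - u i) < del ->
      \sum_(i < n) cabs (f (v i) - f (u i)) < eps.

Definition is_derive_mx (W : R -> 'M[R[i]]_2) (t : R) (dW : 'M[R[i]]_2) :=
  forall i j,
    is_derive t 1 (fun s => complex.Re (W s i j)) (complex.Re (dW i j)) /\
    is_derive t 1 (fun s => complex.Im (W s i j)) (complex.Im (dW i j)).

Definition fundamental_solution (H : R -> 'M[R]_2) (L : R)
    (W : R -> R[i] -> 'M[R[i]]_2) :=
  forall z : R[i],
    [/\ forall i j, abs_continuous 0 L (fun t => W t z i j),
        W 0 z = 1%:M &
        {ae (@lebesgue_measure R), forall t : R, 0 < t < L ->
          exists2 dW : 'M[R[i]]_2, is_derive_mx (fun s => W s z) t dW &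
            dW *m Jmx = z *: (W t z *m map_mx (real_complex R) (H t))}].

Definition vnorm (v : 'cV[R[i]]_2) : R :=
  Num.sqrt (\sum_(i < 2) cabs (v i 0) ^+ 2).

Definition opnorm (A : 'M[R[i]]_2) : R :=
  sup [set vnorm (A *m v) | v in [set v | vnorm v <= 1]].

Definition max_norm (M : R[i] -> 'M[R[i]]_2) (r : R) : R :=
  sup [set opnorm (M z) | z in [set z | cabs z = r]].

Definition order (M : R[i] -> 'M[R[i]]_2) : \bar R :=
  limf_esup (fun r : R => (ln (ln (max_norm M r)) / ln r)%:E) (pinfty_nbhs R).

End HamburgerHamiltonian.

Section Cutoffs.
Variables (R : realType) (d_l d_phi : R -> R).

Definition kfun (r : R) : R :=
  sup [set t | 1 <= t /\
    sup [set 2 / (r * d_l s * d_phi s) | s in `[1, t]] <= 1].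

Definition hfun (r : R) : R :=
  sup [set t | 1 <= t /\
    sup [set d_phi s / (r * d_l s) | s in `[1, t]] <= 1].

End Cutoffs.

(* Main.v *)
Require Import Defs.
From mathcomp Require Import measurable_realfun ring lra.

(** Let (w0, w1) be a row of W. Where H is the constant projection onto xi, the
    equation moves the row along the direction orthogonal to xi, with velocity z
    times its component along xi, and that component is constant. So an interval
    of length l acts by w |-> w + z l <w, xi> xi_perp ([canonical_interval],
    [fundamental_solution_step]); the only facts needed about the differential
    equation are this formula, uniqueness for absolutely continuous functions
    with null derivative ([ac_derive0_const]) and continuity at the right end
    point.

    The growth of these products is measured by the energy
    |<w, xi>|^2 + b^2 |<w, xi_perp>|^2 with a weight b in (0, 1] ([energy]).
    With r = |z|, in the frame of the current angle an interval multiplies its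
    square root by at most 1 + r l b, and passing to the frame of the next angle
    costs 1 + |sin| / b. The choice b = min(1, sqrt(d_phi / (r d_l))) balances
    both costs, so that one step costs 1 + K sqrt(r / D) ([weight_costs],
    [sqrt_cost]); when b = 1 the energy is the Euclidean norm and changing the
    frame is free. Decreasing b is free and increasing it is paid by a
    telescoping product ([row_energy_head]). Beyond an index n one may stop
    following the angles: with a fixed frame psi and a fixed weight b' the
    remaining intervals cost exp(2 r sum_(j > n) l_j (b' + sin^2(phi_j - psi) /
    b')) in energy ([row_energy_tail]). For b' = sqrt(c_phi / c_l), up to a
    constant, this is governed by r / C(n), and for b' = 1 by the remaining
    length. The result is

      log max |W| <= K (1 + log r + log n)
        + 2 sum_(j <= n) log(1 + K sqrt(r / D(j))) + K r tail(n)

    for all large n, with tail(n) = 1 / C(n) ([head_anisotropic_tail_bound]) or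
    the sum of the l_j beyond n ([head_isotropic_tail_bound]). If C grows like a
    positive power, or if d_phi / d_l is comparable to a nondecreasing function,
    one may let n tend to infinity and drop the last term ([full_bound_of_cut],
    [nondecreasing_ratio_bound]).

    The four bounds come from different choices of n. In the first, put
    y = alpha t C / D and n = f^-(r); then r / D(n) is comparable with y log y,
    the Potter bound for D gives a head of size n log y, and n log y is r / C(n)
    ([head_sum_log], [log_cut_bound]). In the third, log(1 + x) <= x bounds the
    head by sqrt r times the integral of D^(-1/2) up to n, which for n =
    f_1^-(r) is r / C(n) ([primitive_cut_bound]). In the fourth the head is
    bounded in the same way up to h(r) and the rest is the sum of the lengths
    ([head_ray_integral_bound]). In the second there is no cut, and the terms up
    to k(r) cost O(k(r)) together, and this is at most sqrt r times the integral
    of D^(-1/2) over [k(r), 2 k(r)], where that integrand is comparable with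
    r^(-1/2) ([ray_integral_bound]).

    For the orders coarser choices suffice: cutting at n = r^kappa for the right
    kappa, and bounding log(1 + x) by a small or a full power of x, gives each
    exponent up to an arbitrary epsilon ([cut_growth], [head_growth]). About
    regularly varying functions only the two-sided Potter bound is used, which
    is elementary for almost monotone functions ([rv_potter]). The exception is
    an asymptotic inverse, which may oscillate: that it tends to infinity rests
    on a measure argument ([rv_lower_uniform], [asymptotic_inverse_large]). *)

Set Implicit Arguments.
Unset Strict Implicit.
Unset Printing Implicit Defensive.

Local Open Scope classical_set_scope.
Local Open Scope ring_scope.

(** * Elementary inequalities *)

(** The linear arithmetic tactics read every order fact of the context, which is
    slow in long proofs. These two tactics restrict them to the facts in the
    goal, respectively to the facts listed. *)
Ltac drop_facts := repeat match goal with H : is_true _ |- _ => clear H end.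

Tactic Notation "lra_from" ne_hyp_list(hs) := revert hs; drop_facts; intros; lra.

Section preliminaries.
Context {R : realType}.

Lemma near_pinftyE (P : R -> Prop) :
  (\forall x \near +oo, P x) <-> exists2 T, 1 <= T & forall x, T <= x -> P x.
Proof.
split=> [[M [_ hM]]|[T T1 hT]].
  exists (Num.max 1 (M + 1)); first by rewrite le_max lexx.
  by move=> x; rewrite ge_max => /andP[_ Mx]; apply: hM; lra.
by exists T; split; [exact: num_real|move=> x /ltW/hT].
Qed.

Lemma near_inftyE (P : nat -> Prop) :
  (\forall n \near \oo, P n) <-> exists N, forall n, (N <= n)%N -> P n.
Proof. by split=> [[N _ hN]|[N hN]]; exists N. Qed.

Lemma natr_ge_truncn (T : R) (n : nat) : ((Num.truncn T).+1 <= n)%N -> T <= n%:R.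
Proof. by move=> h; apply: (le_trans (ltW (truncnS_gt _))); rewrite ler_nat. Qed.

Lemma truncn_half (N : R) : 2 <= N -> N / 2 <= (Num.truncn N)%:R /\ (Num.truncn N)%:R <= N.
Proof.
move=> N2; have N0 : 0 <= N by lra.
have /andP[h1 h2] := truncn_itv N0; split => //.
by move: h2; rewrite -natr1; lra.
Qed.

Lemma ln_sqrt (x : R) : 0 < x -> ln (Num.sqrt x) = ln x / 2.
Proof. by move=> x0; rewrite -powR12_sqrt ?(ltW x0)// ln_powR mulrC. Qed.

Lemma ln_le_self (x : R) : 0 < x -> ln x <= x.
Proof.
move=> x0; have : ln (1 + (x - 1)) <= x - 1 by apply: le_ln1Dx; lra.
by rewrite (_ : 1 + (x - 1) = x); [lra|ring].
Qed.

Lemma ln2_le1 : ln 2 <= 1 :> R.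
Proof. by have := @le_ln1Dx R 1; rewrite -[1 + 1]/2; apply; lra. Qed.

Lemma ln1p_le (x y : R) : 0 <= x -> x <= y -> ln (1 + x) <= ln (1 + y).
Proof. by move=> x0 xy; rewrite ler_ln ?posrE; lra. Qed.

Lemma ln1p_le_max (x B : R) : 0 < x -> 0 <= B -> ln x <= B -> ln (1 + x) <= 1 + B.
Proof.
move=> x0 B0 xB; have xe : x <= expR B by rewrite -[leLHS]lnK ?posrE// ler_expR.
have e1 : 1 <= expR B by rewrite -[leLHS]expR0 ler_expR.
have : ln (1 + x) <= ln (2 * expR B) by rewrite ler_ln ?posrE; lra.
rewrite lnM ?posrE ?expR_gt0// expRK => h; apply: (le_trans h).
by rewrite lerD2r ln2_le1.
Qed.

Lemma sqrtr_ge1 (r : R) : 1 <= r -> 1 <= Num.sqrt r.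
Proof. by move=> r1; rewrite -sqrtr1 ler_wsqrtr. Qed.

Lemma sqrtr_le_self (r : R) : 1 <= r -> Num.sqrt r <= r.
Proof.
move=> r1; have s1 := sqrtr_ge1 r1; rewrite -[leRHS]sqr_sqrtr ?(le_trans ler01)//.
by rewrite expr2 ler_peMl// (le_trans ler01).
Qed.

Lemma ln_le_sqrt (r : R) : 1 <= r -> ln r <= 2 * Num.sqrt r.
Proof.
move=> r1; have s0 : 0 < Num.sqrt r by apply: lt_le_trans (sqrtr_ge1 r1).
have r0 : 0 < r by lra.
by have := ln_le_self s0; rewrite (ln_sqrt r0) ler_pdivrMr// mulrC.
Qed.

Lemma ler_sum_widen (F : nat -> R) m m' n n' : (m' <= m)%N -> (n <= n')%N ->
  (forall j, (m' <= j)%N -> 0 <= F j) -> \sum_(m <= j < n) F j <= \sum_(m' <= j < n') F j.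
Proof.
move=> mm nn F0; have [nm|mn] := leqP n m.
  by rewrite big_geq// big_nat sumr_ge0// => j /andP[h _]; exact: F0.
rewrite [leRHS](big_cat_nat (n := m))//=; last exact: leq_trans (ltnW mn) nn.
rewrite [X in _ <= _ + X](big_cat_nat (n := n))//=; last exact: ltnW.
rewrite addrCA lerDl addr_ge0// big_nat sumr_ge0// => j /andP[h _]; first exact: F0.
by apply: F0; exact: leq_trans (leq_trans mm (ltnW mn)) h.
Qed.

End preliminaries.

(** * Absolutely continuous functions *)

(** Finite families of intervals are lists, so that a family can be extended by
    one interval when an argument moves from left to right. *)
Definition real_ac (R : realType) (a b : R) (f : R -> R) :=
  forall eps : R, 0 < eps -> exists2 del : R, 0 < del &
    forall s : seq (R * R),
      (forall p, p \in s -> [/\ a <= p.1, p.1 < p.2 & p.2 <= b]) ->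
      pairwise (fun p q : R * R => (q.2 <= p.1) || (p.2 <= q.1)) s ->
      \sum_(p <- s) (p.2 - p.1) < del ->
      \sum_(p <- s) `|f p.2 - f p.1| < eps.

Lemma derive0_near (R : realType) (f : R -> R) (c eps : R) : 0 < eps ->
  is_derive c 1 f 0 ->
  exists2 r : R, 0 < r & forall x, `|x - c| < r -> `|f x - f c| <= eps * `|x - c|.
Proof.
move=> eps0 [df f'0].
have : h^-1 *: ((f \o shift c) (h *: 1) - f c) @[h --> 0^'] --> (0 : R).
  by rewrite -[X in _ --> X]f'0; exact: df.
move=> /cvgrPdist_le /(_ _ eps0) /nbhs_ballP [r /= r0 H].
exists r => // x xr.
have [->|xc] := eqVneq x c; first by rewrite !subrr normr0 mulr0.
have xc0 : x - c != 0 by rewrite subr_eq0.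
have := H (x - c); rewrite /ball /= sub0r normrN => /(_ xr xc0).
rewrite sub0r normrN /= [(x - c)%:A]mulr1 subrK normrZ normfV.
by rewrite ler_pdivrMl ?normr_gt0 // mulrC.
Qed.

(** The exceptional null set, with the end points, is covered by an open set U
    of measure less than delta. Let P t say that f t - f a is bounded by eps (t
    - a) plus the variation of f over finitely many disjoint intervals whose
    total length is at most the measure of U below t. The supremum argument
    shows P b: at a point of U one adds an interval contained in U, and at any
    other point the derivative is 0, so the term eps (t - a) pays for a small
    move. Absolute continuity then makes the variation at most eps. *)
Lemma ac_derive0_const (R : realType) (a b : R) (f : R -> R) :
  a <= b -> real_ac a b f ->
  {ae @lebesgue_measure R, forall t : R, a < t < b -> is_derive t 1 f 0} ->
  f b = f a.
Proof.
move=> ab fac [N [mN N0 NP]].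
suff H : forall eps : R, 0 < eps -> `|f b - f a| <= eps * (b - a + 1).
  apply/eqP; rewrite -subr_eq0 -normr_le0.
  apply/ler_addgt0Pl => e e0; rewrite addr0.
  have h : 0 < b - a + 1 by lra.
  apply: (le_trans (H (e / (b - a + 1)) _)); first exact: divr_gt0.
  by rewrite divfK// gt_eqF.
move=> eps eps0.
have [del del0 fdel] := fac _ eps0.
pose N' : set R := N `|` ([set a] `|` [set b]).
have mN' : measurable N' by repeat apply: measurableU => //.
have N'0 : lebesgue_measure N' = 0%E.
  have ab0 : lebesgue_measure ([set a] `|` [set b]) = 0%E.
    by rewrite measureU0//; exact: lebesgue_measure_set1.
  by rewrite measureU0//; exact: measurableU.
have [|U [oU N'U mUN']] := lebesgue_regularity_outer mN' _ del0.
  by apply: (eq_ind_r (fun x => (x < +oo)%E) _ N'0); exact: ltry.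
have mU : measurable U := open_measurable oU.
have muU : (lebesgue_measure U < del%:E)%E.
  have -> : U = (U `\` N') `|` N' by rewrite setUC setDUK.
  by rewrite measureU0//; apply: measurableD.
pose P t := exists s : seq (R * R), [/\
   (forall p, p \in s -> [/\ a <= p.1, p.1 < p.2 & p.2 <= t]),
   pairwise (fun p q : R * R => (q.2 <= p.1) || (p.2 <= q.1)) s,
   ((\sum_(p <- s) (p.2 - p.1))%:E <= lebesgue_measure (U `&` `[a, t]))%E &
   `|f t - f a| <= eps * (t - a) + \sum_(p <- s) `|f p.2 - f p.1|].
have stepA s t : P s -> s <= t -> `|f t - f s| <= eps * (t - s) -> P t.
  move=> [q [q1 q2 q3 q4]] st fst; exists q; split => //.
  - by move=> p /q1[? ? ?]; split => //; apply: le_trans st.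
  - apply: (le_trans q3); apply: le_measure; rewrite ?inE.
    + by apply: measurableI.
    + by apply: measurableI.
    + apply: setIS => x /=; rewrite !in_itv/= => /andP[-> h] /=.
      exact: le_trans st.
  - rewrite -(subrKA (f s)) (le_trans (ler_normD _ _))//.
    by nra.
have stepB s t : P s -> a <= s -> s < t -> `[s, t] `<=` U -> P t.
  move=> [q [q1 q2 q3 q4]] as_ st stU; exists ((s, t) :: q); split => //.
  - move=> p; rewrite inE => /orP[/eqP -> //=|/q1[? ? h]].
    by split => //; apply: le_trans (ltW st).
  - rewrite /= q2 andbT; apply/allP => p /q1 [_ _ h].
    by rewrite h.
  - have sub (x : R) : U x /\ a <= x <= s \/ s < x <= t -> U x /\ a <= x <= t.
      move=> [[Ux /andP[h1 h2]]|/andP[h1 h2]].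
        by split => //; rewrite h1 (le_trans h2 (ltW st)).
      split; first by apply: stU; rewrite /= in_itv/= (ltW h1).
      by rewrite h2 (le_trans as_ (ltW h1)).
    rewrite big_cons /= EFinD addeC.
    have -> : ((t - s)%:E = lebesgue_measure `]s, t])%E.
      by rewrite lebesgue_measure_itv/= lte_fin st EFinB.
    apply: (le_trans (leeD2r _ q3)).
    rewrite -measureU//; last first.
    + rewrite -subset0 => x [[_ /=]]; rewrite !in_itv/= => /andP[_ xs] /andP[sx _].
      by move: (lt_le_trans sx xs); rewrite ltxx.
    + exact: measurableI.
    apply: le_measure; rewrite ?inE.
    + by apply: measurableU => //; apply: measurableI.
    + exact: measurableI.
    + exact: sub.
  - rewrite big_cons /= -(subrKA (f s)) (le_trans (ler_normD _ _))//.
    by nra.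
have Pa : P a.
  exists [::]; split => //; rewrite ?big_nil ?measure_ge0//.
  by rewrite !subrr normr0 mulr0 addr0.
have Pb : P b.
  (* The supremum c of the points with P belongs to them and cannot be below b:
     near c, either an interval inside U or the vanishing derivative carries P
     from the left of c to its right. *)
  pose S := [set t | a <= t <= b /\ P t].
  have Sa : S a by split => //; rewrite lexx.
  have supS : has_sup S by split; [exists a|exists b => t [/andP[]]].
  pose c := sup S.
  have ac : a <= c by apply: ub_le_sup Sa; apply: supS.2.
  have cb : c <= b by apply: ge_sup; [apply: supS.1|move=> t [/andP[]]].
  have [r r0 Hr] : exists2 r, 0 < r & forall s t, a <= s -> t <= b ->
      c - r < s -> s <= c -> c <= t -> t < c + r -> P s -> P t.
    have [Uc|nUc] := pselect (U c).
      have := oU; rewrite openE => /(_ _ Uc) /nbhs_ballP [r /= r0 rU].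
      exists r => // s t as_ tb rs sc ct tr Ps.
      have [st|st] := ltP s t; last first.
        by have -> : t = s by lra.
      apply: (stepB s) => // x /=; rewrite in_itv/= => /andP[sx xt].
      apply: rU; rewrite /ball /= ltr_norml.
      by lra.
    have acb : a < c < b.
      rewrite !lt_neqAle ac cb !andbT; apply/andP; split; apply/eqP => cE.
        by apply: nUc; apply: N'U; right; left; rewrite -cE.
      by apply: nUc; apply: N'U; right; right; rewrite cE.
    have dc : is_derive c 1 f 0.
      apply: contrapT => h; apply: nUc; apply: N'U; left; apply: NP => /=.
      by apply/not_implyP.
    have [r r0 hr] := derive0_near eps0 dc.
    exists r => // s t as_ tb rs sc ct tr Ps.
    have Pc : P c.
      apply: (stepA s) => //; rewrite distrC.
      have -> : c - s = `|s - c| by rewrite distrC ger0_norm// subr_ge0.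
      by apply: hr; rewrite ltr_norml; lra.
    apply: (stepA c) => //.
    have -> : t - c = `|t - c| by rewrite ger0_norm// subr_ge0.
    by apply: hr; rewrite ltr_norml; lra.
  have [s [/andP[as_ sb] Ps] rs] := sup_adherent r0 supS.
  have sc : s <= c by apply: ub_le_sup => //; [apply: supS.2|split => //; rewrite as_].
  (* If b is further than r from c, then P holds beyond c, against the choice of
     c. *)
  have [bc|bc] := ltP b (c + r); first by apply: (Hr s).
  have : S (c + r / 2).
    split; first by lra.
    by apply: (Hr s) => //; lra.
  move=> /(ub_le_sup supS.2); rewrite -/c; lra.
have [s [s1 s2 s3 s4]] := Pb.
apply: (le_trans s4).
have : \sum_(p <- s) `|f p.2 - f p.1| < eps.
  apply: fdel => //.
  rewrite -lte_fin; apply: (le_lt_trans s3); apply: le_lt_trans muU.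
  by apply: le_measure; rewrite ?inE//; apply: measurableI.
by nra.
Qed.

Section real_ac_theory.
Context {R : realType}.
Implicit Types (a b c : R) (f g : R -> R).

Lemma real_ac_sub a b a' b' f : a <= a' -> b' <= b ->
  real_ac a b f -> real_ac a' b' f.
Proof.
move=> aa bb fac eps /fac[del del0 H]; exists del => // s s1 s2 s3; apply: H => //.
move=> p /s1[h1 h2 h3]; split => //; first exact: le_trans h1.
exact: le_trans bb.
Qed.

Lemma real_acZ a b c f : real_ac a b f -> real_ac a b (fun t => c * f t).
Proof.
move=> fac eps eps0.
have c0 : 0 < `|c| + 1 by have := normr_ge0 c; lra.
have [del del0 H] := fac _ (divr_gt0 eps0 c0); exists del => // s s1 s2 s3.
have := H s s1 s2 s3; rewrite ltr_pdivlMr// => h.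
apply: le_lt_trans h; rewrite mulr_suml; apply: ler_sum => p _.
rewrite -mulrBr normrM mulrC ler_wpM2l//; lra.
Qed.

Lemma real_acD a b f g : real_ac a b f -> real_ac a b g ->
  real_ac a b (fun t => f t + g t).
Proof.
move=> fac gac eps eps0.
have e2 : 0 < eps / 2 by lra.
have [d1 d10 H1] := fac _ e2; have [d2 d20 H2] := gac _ e2.
exists (Num.min d1 d2); first by rewrite lt_min d10.
move=> s s1 s2; rewrite lt_min => /andP[s3 s4].
have h1 := H1 s s1 s2 s3; have h2 := H2 s s1 s2 s4.
apply: (@le_lt_trans _ _ (\sum_(p <- s) `|f p.2 - f p.1| + \sum_(p <- s) `|g p.2 - g p.1|)); last by lra.
rewrite -big_split /=; apply: ler_sum => p _.
by rewrite opprD addrACA ler_normD.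
Qed.

Lemma real_ac_id a b : real_ac a b id.
Proof.
move=> eps eps0; exists eps => // s s1 s2; apply: le_lt_trans.
rewrite !big_seq; apply: ler_sum => p /s1[_ h _].
by rewrite gtr0_norm// subr_gt0.
Qed.

Lemma real_ac_cvg a b f : a < b -> real_ac a b f -> forall u : nat -> R,
  (forall n, a <= u n < b) -> u n @[n --> \oo] --> b -> f (u n) @[n --> \oo] --> f b.
Proof.
move=> ab fac u uab ub; apply/cvgrPdist_lt => eps eps0.
have [del del0 H] := fac _ eps0.
move/cvgrPdist_lt : ub => /(_ _ del0); apply: filterS => n.
have /andP[h1 h2] := uab n.
have := H [:: (u n, b)]; rewrite /= !big_seq1 /= => K.
rewrite [X in X < del]gtr0_norm ?subr_gt0// => /K; apply => // p.
by rewrite inE => /eqP ->.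
Qed.

Lemma lebesgue_aeS (P Q : R -> Prop) : (forall x, P x -> Q x) ->
  {ae @lebesgue_measure R, forall x, P x} -> {ae @lebesgue_measure R, forall x, Q x}.
Proof. by move=> PQ [N [mN N0 NP]]; exists N; split => // x /= nQ; apply: NP => /= /PQ. Qed.

Lemma ac_derive0_const_itv a b f : a <= b -> real_ac a b f ->
  {ae @lebesgue_measure R, forall t : R, a < t < b -> is_derive t 1 f 0} ->
  forall t, a <= t <= b -> f t = f a.
Proof.
move=> ab fac fd t /andP[at_ tb]; apply: ac_derive0_const => //.
  exact: real_ac_sub fac.
apply: lebesgue_aeS fd => s h /andP[h1 h2]; apply: h; rewrite h1/=.
exact: lt_le_trans tb.
Qed.

Lemma abs_continuous_real_ac a b (f : R -> R[i]) (g : R -> R) :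
  abs_continuous a b f -> (forall x y, `|g x - g y| <= cabs (f x - f y)) ->
  real_ac a b g.
Proof.
move=> fac fg eps /fac[del del0 H]; exists del => // s s1 s2 s3.
have := H (size s) (fun i => (tnth (in_tuple s) i).1) (fun i => (tnth (in_tuple s) i).2).
move=> K; apply: (@le_lt_trans _ _ (\sum_(i < size s) cabs (f (tnth (in_tuple s) i).2 - f (tnth (in_tuple s) i).1))).
  rewrite [X in X <= _](big_tnth _ _ s)/=.
  by apply: ler_sum => i _; apply: fg.
apply: K.
- by move=> i; apply: s1; exact: mem_tnth.
- move=> i j ij.
  move/(pairwiseP (0, 0)): s2 => s2.
  rewrite !(tnth_nth (0, 0)) /=.
  have [h|h|/val_inj/eqP h] := ltngtP i j.
  + by have := s2 i j (ltn_ord _) (ltn_ord _) h => /orP[]; [right|left].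
  + by have := s2 j i (ltn_ord _) (ltn_ord _) h => /orP[]; [left|right].
  + by rewrite h in ij.
- by rewrite [X in X < _](_ : _ = \sum_(p <- s) (p.2 - p.1))// (big_tnth _ _ s).
Qed.

Lemma Re_le_cabs (x : R[i]) : `|complex.Re x| <= cabs x.
Proof.
case: x => x y /=; rewrite /cabs/= -sqrtr_sqr ler_sqrt ?addr_ge0 ?sqr_ge0//.
by rewrite lerDl sqr_ge0.
Qed.

Lemma Im_le_cabs (x : R[i]) : `|complex.Im x| <= cabs x.
Proof.
case: x => x y /=; rewrite /cabs/= -sqrtr_sqr ler_sqrt ?addr_ge0 ?sqr_ge0//.
by rewrite lerDr sqr_ge0.
Qed.

Lemma real_ac_Re a b (f : R -> R[i]) : abs_continuous a b f ->
  real_ac a b (fun t => complex.Re (f t)).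
Proof.
move=> /abs_continuous_real_ac; apply => x y.
by rewrite (_ : _ - _ = complex.Re (f x - f y)) ?Re_le_cabs// raddfB.
Qed.

Lemma real_ac_Im a b (f : R -> R[i]) : abs_continuous a b f ->
  real_ac a b (fun t => complex.Im (f t)).
Proof.
move=> /abs_continuous_real_ac; apply => x y.
by rewrite (_ : _ - _ = complex.Im (f x - f y)) ?Im_le_cabs// raddfB.
Qed.

Lemma is_deriveDfun (x : R) f g df dg : is_derive x 1 f df -> is_derive x 1 g dg ->
  is_derive x 1 (fun t => f t + g t) (df + dg).
Proof. by move=> hf hg; exact: (@is_deriveD _ _ _ f g). Qed.

Lemma is_deriveZfun (x c : R) f df : is_derive x 1 f df ->
  is_derive x 1 (fun t => c * f t) (c * df).
Proof. by move=> hf; exact: (@is_deriveZ _ _ _ f c). Qed.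

(** Here (p + i p', q + i q') is a row of the solution, (c, s) = (cos, sin) of
    the angle and X + i Y is z times the component of the row along (c, s). That
    component has derivative 0, and so does the orthogonal component minus (X +
    i Y) t; solving for the row gives the explicit step. *)
Lemma canonical_interval (a b zr zi c s : R) (p p' q q' : R -> R) :
  a <= b -> c ^+ 2 + s ^+ 2 = 1 ->
  real_ac a b p -> real_ac a b p' -> real_ac a b q -> real_ac a b q' ->
  let X t := zr * (c * p t + s * q t) - zi * (c * p' t + s * q' t) in
  let Y t := zr * (c * p' t + s * q' t) + zi * (c * p t + s * q t) in
  {ae @lebesgue_measure R, forall t : R, a < t < b ->
    [/\ is_derive t 1 p (- s * X t), is_derive t 1 p' (- s * Y t),
        is_derive t 1 q (c * X t) & is_derive t 1 q' (c * Y t)]} ->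
  [/\ p b = p a - s * ((b - a) * X a), p' b = p' a - s * ((b - a) * Y a),
      q b = q a + c * ((b - a) * X a) & q' b = q' a + c * ((b - a) * Y a)].
Proof.
move=> ab cs'; have cs : c ^+ 2 = 1 - s ^+ 2 by lra.
move=> hp hp' hq hq' X Y H.
have S1 t : a <= t <= b -> c * p t + s * q t = c * p a + s * q a.
  apply: (ac_derive0_const_itv (f := fun t => c * p t + s * q t)) => //.
    by apply: real_acD; apply: real_acZ.
  apply: lebesgue_aeS H => u h /h[d1 d2 d3 d4].
  apply: is_derive_eq (is_deriveDfun (is_deriveZfun c d1) (is_deriveZfun s d3)) _.
  by ring.
have S2 t : a <= t <= b -> c * p' t + s * q' t = c * p' a + s * q' a.
  apply: (ac_derive0_const_itv (f := fun t => c * p' t + s * q' t)) => //.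
    by apply: real_acD; apply: real_acZ.
  apply: lebesgue_aeS H => u h /h[d1 d2 d3 d4].
  apply: is_derive_eq (is_deriveDfun (is_deriveZfun c d2) (is_deriveZfun s d4)) _.
  by ring.
have T1 : c * q b + (- s) * p b + (- X a) * b = c * q a + (- s) * p a + (- X a) * a.
  apply: (ac_derive0_const (f := fun t => c * q t + (- s) * p t + (- X a) * t)) => //.
    by apply: real_acD; [apply: real_acD; apply: real_acZ|apply: real_acZ; exact: real_ac_id].
  apply: lebesgue_aeS H => u h uab; have [d1 d2 d3 d4] := h uab.
  have uab' : a <= u <= b by case/andP: uab => *; rewrite !ltW.
  apply: is_derive_eq (is_deriveDfun (is_deriveDfun (is_deriveZfun c d3)
    (is_deriveZfun (- s) d1)) (is_deriveZfun (- X a) (is_derive_id u 1))) _.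
  rewrite mulr1 {1 2}/X (S1 _ uab') (S2 _ uab') -/(X a).
  by ring: cs.
have T2 : c * q' b + (- s) * p' b + (- Y a) * b = c * q' a + (- s) * p' a + (- Y a) * a.
  apply: (ac_derive0_const (f := fun t => c * q' t + (- s) * p' t + (- Y a) * t)) => //.
    by apply: real_acD; [apply: real_acD; apply: real_acZ|apply: real_acZ; exact: real_ac_id].
  apply: lebesgue_aeS H => u h uab; have [d1 d2 d3 d4] := h uab.
  have uab' : a <= u <= b by case/andP: uab => *; rewrite !ltW.
  apply: is_derive_eq (is_deriveDfun (is_deriveDfun (is_deriveZfun c d4)
    (is_deriveZfun (- s) d2)) (is_deriveZfun (- Y a) (is_derive_id u 1))) _.
  rewrite mulr1 {1 2}/Y (S1 _ uab') (S2 _ uab') -/(Y a).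
  by ring: cs.
have bab : a <= b <= b by rewrite ab lexx.
have S1b := S1 b bab; have S2b := S2 b bab.
move: S1b S2b T1 T2; move: (X a) (Y a) => xa ya S1b S2b T1 T2.
have lin (x1 y1 x2 y2 d e x y : R) : x1 = y1 -> x2 = y2 ->
  x - y = d * (x1 - y1) + e * (x2 - y2) -> x = y.
  by move=> -> -> h; apply/eqP; rewrite -subr_eq0 h !subrr !mulr0 addr0.
by split; [apply: (lin _ _ _ _ c (- s) _ _ S1b T1)|apply: (lin _ _ _ _ c (- s) _ _ S2b T2)
  |apply: (lin _ _ _ _ s c _ _ S1b T1)|apply: (lin _ _ _ _ s c _ _ S2b T2)]; ring: cs.
Qed.

End real_ac_theory.

(** * The fundamental solution at the nodes *)

Section hamburger_nodes.
Context {R : realType}.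
Variables (l phi : nat -> R).
Hypothesis l_gt0 : forall j, (0 < j)%N -> 0 < l j.
Hypothesis l_summable : summable_seq l.

Lemma node0 : node l 0 = 0.
Proof. by rewrite /node big_geq. Qed.

Lemma nodeS n : node l n.+1 = node l n + l n.+1.
Proof. by rewrite /node big_nat_recr. Qed.

Lemma node_lt n : node l n < node l n.+1.
Proof. by rewrite nodeS ltrDl l_gt0. Qed.

Lemma node_le : {homo node l : m n / (m <= n)%N >-> m <= n}.
Proof. by apply: homo_leq => // [x y z /le_trans|n]; [exact|exact: ltW (node_lt n)]. Qed.

Lemma node_ge0 n : 0 <= node l n.
Proof. by rewrite -node0 node_le. Qed.

Lemma cvg_node : node l n @[n --> \oo] --> total_length l.
Proof.
rewrite /total_length /tail_sum /node.
by rewrite (cvg_shiftS (fun n => \sum_(1 <= j < n) l j)).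
Qed.

Lemma node_lt_total n : node l n < total_length l.
Proof.
apply: (lt_le_trans (node_lt n)).
rewrite -(cvg_lim (@Rhausdorff R) cvg_node).
apply: nondecreasing_cvgn_le; first exact: node_le.
by apply/cvg_ex; exists (total_length l); exact: cvg_node.
Qed.

(** Resolves the choice of the index in the definition of the Hamiltonian: the
    nodes increase strictly, so at most one index satisfies the condition. *)
Lemma hamburger_node j t : (0 < j)%N -> node l j.-1 <= t < node l j ->
  hamburger l phi t = xi (phi j) *m (xi (phi j))^T.
Proof.
move=> j0 tj; rewrite /hamburger.
suff -> : xget 1%N [set j | (0 < j)%N /\ node l j.-1 <= t < node l j] = j by [].
have [k0 tk] : [set j | (0 < j)%N /\ node l j.-1 <= t < node l j]
   (xget 1%N [set j | (0 < j)%N /\ node l j.-1 <= t < node l j]).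
  by apply: xgetPex; exists j.
move: (xget _ _) k0 tk => k k0 tk.
have aux a b : (0 < b)%N -> node l b.-1 <= t -> t < node l a -> (b <= a)%N.
  move=> b0 h1 h2; rewrite leqNgt; apply/negP => ab.
  have := node_le (_ : a <= b.-1)%N; rewrite -ltnS prednK// => /(_ ab) h3.
  by move: (lt_le_trans h2 (le_trans h3 h1)); rewrite ltxx.
case/andP: tj => t1 t2; case/andP: tk => t3 t4.
by apply/eqP; rewrite eqn_leq; apply/andP; split; apply: aux.
Qed.

End hamburger_nodes.

Section monodromy_steps.
Context {R : realType}.
Variables (l phi : nat -> R) (W : R -> R[i] -> 'M[R[i]]_2).
Hypothesis l_gt0 : forall j, (0 < j)%N -> 0 < l j.
Hypothesis l_summable : summable_seq l.
Hypothesis W_fund : fundamental_solution (hamburger l phi) (total_length l) W.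

Lemma fundamental_solution_init z (i j : 'I_2) : W 0 z i j = (i == j)%:R.
Proof. by have [_ -> _] := W_fund z; rewrite mxE. Qed.

(** The monodromy matrix is the limit of the solution along the nodes because
    the solution is absolutely continuous up to the right end point. *)
Lemma fundamental_solution_cvg z i j :
  complex.Re (W (node l n) z i j) @[n --> \oo] --> complex.Re (W (total_length l) z i j) /\
  complex.Im (W (node l n) z i j) @[n --> \oo] --> complex.Im (W (total_length l) z i j).
Proof.
have [hac _ _] := W_fund z; have hij := hac i j.
have L0 : 0 < total_length l.
  by rewrite -(node0 l) node_lt_total.
split; [apply: (real_ac_cvg (f := fun t => complex.Re (W t z i j)) L0 (real_ac_Re hij))
       |apply: (real_ac_cvg (f := fun t => complex.Im (W t z i j)) L0 (real_ac_Im hij))].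
all: try (by move=> n; rewrite node_ge0// node_lt_total).
all: exact: cvg_node.
Qed.

Lemma fundamental_solution_step (z : R[i]) (i : 'I_2) n :
  let p m := complex.Re (W (node l m) z i 0) in
  let p' m := complex.Im (W (node l m) z i 0) in
  let q m := complex.Re (W (node l m) z i 1) in
  let q' m := complex.Im (W (node l m) z i 1) in
  let c := cos (phi n.+1) in let s := sin (phi n.+1) in
  let X := complex.Re z * (c * p n + s * q n) - complex.Im z * (c * p' n + s * q' n) in
  let Y := complex.Re z * (c * p' n + s * q' n) + complex.Im z * (c * p n + s * q n) in
  [/\ p n.+1 = p n - s * (l n.+1 * X), p' n.+1 = p' n - s * (l n.+1 * Y),
      q n.+1 = q n + c * (l n.+1 * X) & q' n.+1 = q' n + c * (l n.+1 * Y)].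
Proof.
move=> p p' q q' c s X Y.
have [hac _ hae] := W_fund z.
have sub j f : (forall a b, abs_continuous a b (fun t => W t z i j) -> real_ac a b f) ->
    real_ac (node l n) (node l n.+1) f.
  move=> h; apply: real_ac_sub (h _ _ (hac i j)); first exact: node_ge0.
  exact/ltW/node_lt_total.
have := @canonical_interval R (node l n) (node l n.+1) (complex.Re z) (complex.Im z) c s
  (fun t => complex.Re (W t z i 0)) (fun t => complex.Im (W t z i 0))
  (fun t => complex.Re (W t z i 1)) (fun t => complex.Im (W t z i 1)) (ltW (node_lt l_gt0 n)).
rewrite nodeS addrAC subrr add0r -nodeS; apply => //.
- exact: cos2Dsin2.
- by apply: (sub 0) => a b; exact: real_ac_Re.
- by apply: (sub 0) => a b; exact: real_ac_Im.
- by apply: (sub 1) => a b; exact: real_ac_Re.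
- by apply: (sub 1) => a b; exact: real_ac_Im.
apply: lebesgue_aeS hae => t h /andP[t1 t2].
have [|dW dWd dWE] := h.
  rewrite (le_lt_trans (node_ge0 l_gt0 n) t1)/=.
  exact: lt_trans t2 (node_lt_total l_gt0 l_summable _).
have tn : node l n.+1.-1 <= t < node l n.+1 by rewrite /= ltW.
rewrite (hamburger_node phi l_gt0 (ltn0Sn n) tn) in dWE.
have E0 := congr1 (fun M : 'M[R[i]]_2 => M i 0) dWE.
have E1 := congr1 (fun M : 'M[R[i]]_2 => M i 1) dWE.
have [[r0 i0] [r1 i1]] := (dWd i 0, dWd i 1).
move: E0 E1 r0 i0 r1 i1.
rewrite !mxE !big_ord_recl !big_ord0 !mxE !big_ord_recl !big_ord0 !mxE /=.
rewrite (_ : lift ord0 ord0 = 1); last exact: val_inj.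
rewrite -/c -/s -[@ord0 1]/(0 : 'I_2).
move: (dW i 0) (dW i 1) (W t z i 0) (W t z i 1) => [d0 d0'] [d1 d1'] [w0 w0'] [w1 w1'].
clear; case: z => zr zi /=; rewrite !mulr0 !mulr1 !addr0 !add0r mulrN1.
case=> e1 e1' [e0 e0'] r0 i0 r1 i1; split.
- by apply: is_derive_eq r0 _; rewrite -[d0]opprK e0; ring.
- by apply: is_derive_eq i0 _; rewrite -[d0']opprK e0'; ring.
- by apply: is_derive_eq r1 _; rewrite e1; ring.
- by apply: is_derive_eq i1 _; rewrite e1'; ring.
Qed.
End monodromy_steps.

(** * Weighted energies of a row *)

Section energy.
Context {R : realType}.
Implicit Types b psi p q r : R.

(** The squared norm of a row, with its component orthogonal to the direction
    psi scaled by b; a row is given by the real and imaginary parts p, p' and q,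
    q' of its two entries. *)
Definition energy b psi (p p' q q' : R) : R :=
  (cos psi * p + sin psi * q) ^+ 2 + (cos psi * p' + sin psi * q') ^+ 2 +
  b ^+ 2 * ((cos psi * q - sin psi * p) ^+ 2 + (cos psi * q' - sin psi * p') ^+ 2).

Lemma energy_ge0 b psi p p' q q' : 0 <= energy b psi p p' q q'.
Proof. by apply: addr_ge0; [|apply: mulr_ge0 => //]; rewrite ?addr_ge0 ?sqr_ge0. Qed.

Lemma energy1 psi p p' q q' : energy 1 psi p p' q q' = p ^+ 2 + p' ^+ 2 + q ^+ 2 + q' ^+ 2.
Proof.
have cs : cos psi ^+ 2 = 1 - sin psi ^+ 2 by rewrite -(cos2Dsin2 psi) addrK.
by rewrite /energy; ring: cs.
Qed.

(** The triangle inequality |v + w| <= |v| + |w| in dimension 4, in the squared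
    form in which energies are compared. *)
Lemma minkowski4 (E m v1 v2 v3 v4 w1 w2 w3 w4 : R) : 0 <= m ->
  v1 ^+ 2 + v2 ^+ 2 + v3 ^+ 2 + v4 ^+ 2 <= E ->
  w1 ^+ 2 + w2 ^+ 2 + w3 ^+ 2 + w4 ^+ 2 <= m ^+ 2 * E ->
  (v1 + w1) ^+ 2 + (v2 + w2) ^+ 2 + (v3 + w3) ^+ 2 + (v4 + w4) ^+ 2 <= (1 + m) ^+ 2 * E.
Proof.
rewrite le_eqVlt => /orP[/eqP<-|m0] hv hw.
  have sq (x y : R) : 0 <= x ^+ 2 by exact: sqr_ge0.
  have [h1 [h2 [h3 h4]]] : w1 = 0 /\ w2 = 0 /\ w3 = 0 /\ w4 = 0.
    have := sqr_ge0 w1; have := sqr_ge0 w2; have := sqr_ge0 w3; have := sqr_ge0 w4.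
    move=> *; do !split; apply/eqP; rewrite -sqrf_eq0; apply/eqP; lra.
  by rewrite h1 h2 h3 h4; lra.
have amgm (v w : R) : (v + w) ^+ 2 <= (1 + m) * v ^+ 2 + (1 + m^-1) * w ^+ 2.
  rewrite -subr_ge0 (_ : _ - _ = m^-1 * (m * v - w) ^+ 2).
    by rewrite mulr_ge0 ?sqr_ge0// invr_ge0 ltW.
  by field; rewrite gt_eqF.
apply: (@le_trans _ _ ((1 + m) * E + (1 + m^-1) * (m ^+ 2 * E))); last first.
  by rewrite le_eqVlt; apply/orP; left; apply/eqP; field; rewrite gt_eqF.
have h1 : 0 <= 1 + m by lra.
have h2 : 0 <= 1 + m^-1 by rewrite addr_ge0// invr_ge0 ltW.
have := ler_wpM2l h1 hv; have := ler_wpM2l h2 hw.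
have := amgm v1 w1; have := amgm v2 w2; have := amgm v3 w3; have := amgm v4 w4.
lra.
Qed.

(** In the frame psi, with th = phi - psi, the increment of the row is l z times
    its component A along phi times the unit vector orthogonal to phi. The
    energy of this vector is b^2 (cos^2 th + (sin th / b)^2), and Cauchy-Schwarz
    bounds |A|^2 by (cos^2 th + (sin th / b)^2) times the energy. *)
Lemma energy_step b psi phi zr zi r l p p' q q' : 0 < b -> 0 <= l -> 0 <= r ->
  zr ^+ 2 + zi ^+ 2 = r ^+ 2 ->
  forall c s X Y, c = cos phi -> s = sin phi ->
  X = zr * (c * p + s * q) - zi * (c * p' + s * q') ->
  Y = zr * (c * p' + s * q') + zi * (c * p + s * q) ->
  energy b psi (p - s * (l * X)) (p' - s * (l * Y)) (q + c * (l * X)) (q' + c * (l * Y)) <=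
  (1 + r * (l * (b + sin (phi - psi) ^+ 2 / b))) ^+ 2 * energy b psi p p' q q'.
Proof.
move=> b0 l0 r0 zE c s X Y hc hs hX hY.
set th := phi - psi; set E := energy b psi p p' q q'.
have phE : phi = th + psi by rewrite subrK.
pose k := cos th; pose g := sin th.
have kg : k ^+ 2 = 1 - g ^+ 2 by rewrite -(cos2Dsin2 th) addrK.
have cE : c = k * cos psi - g * sin psi by rewrite hc phE cosD.
have sE : s = g * cos psi + k * sin psi by rewrite hs phE sinD.
have cs : cos psi ^+ 2 = 1 - sin psi ^+ 2 by rewrite -(cos2Dsin2 psi) addrK.
pose S := cos psi * p + sin psi * q; pose S' := cos psi * p' + sin psi * q'.
pose T := cos psi * q - sin psi * p; pose T' := cos psi * q' - sin psi * p'.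
have EE : E = S ^+ 2 + S' ^+ 2 + (b * T) ^+ 2 + (b * T') ^+ 2.
  by rewrite /E /energy -/S -/S' -/T -/T'; ring.
pose A := k * S + g * T; pose A' := k * S' + g * T'.
have XE : X = zr * A - zi * A'.
  by rewrite hX /A /A' /S /S' /T /T' cE sE; ring.
have YE : Y = zr * A' + zi * A.
  by rewrite hY /A /A' /S /S' /T /T' cE sE; ring.
have -> : energy b psi (p - s * (l * X)) (p' - s * (l * Y)) (q + c * (l * X)) (q' + c * (l * Y)) =
  (S + - (g * l * X)) ^+ 2 + (S' + - (g * l * Y)) ^+ 2 +
  (b * T + b * k * l * X) ^+ 2 + (b * T' + b * k * l * Y) ^+ 2.
  rewrite /energy.
  have -> : cos psi * (p - s * (l * X)) + sin psi * (q + c * (l * X)) = S + - (g * l * X).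
    by rewrite /S cE sE; ring: cs.
  have -> : cos psi * (p' - s * (l * Y)) + sin psi * (q' + c * (l * Y)) = S' + - (g * l * Y).
    by rewrite /S' cE sE; ring: cs.
  have -> : cos psi * (q + c * (l * X)) - sin psi * (p - s * (l * X)) = T + k * l * X.
    by rewrite /T cE sE; ring: cs.
  have -> : cos psi * (q' + c * (l * Y)) - sin psi * (p' - s * (l * Y)) = T' + k * l * Y.
    by rewrite /T' cE sE; ring: cs.
  by ring.
have E0 : 0 <= E by exact: energy_ge0.
have g2b : 0 <= g ^+ 2 / b by rewrite mulr_ge0 ?sqr_ge0// invr_ge0 ltW.
apply: minkowski4.
- by rewrite !mulr_ge0// addr_ge0// ltW.
- by rewrite EE.
have b1 : b != 0 by rewrite gt_eqF.
have -> : (- (g * l * X)) ^+ 2 + (- (g * l * Y)) ^+ 2 + (b * k * l * X) ^+ 2 + (b * k * l * Y) ^+ 2 =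
  (r * l * b) ^+ 2 * (k ^+ 2 + (g / b) ^+ 2) * (A ^+ 2 + A' ^+ 2).
  rewrite [(r * l * b) ^+ 2](_ : _ = (l * b) ^+ 2 * (zr ^+ 2 + zi ^+ 2)); last by rewrite zE; ring.
  by rewrite XE YE; field.
have csA : A ^+ 2 + A' ^+ 2 <= (k ^+ 2 + (g / b) ^+ 2) * E.
  rewrite EE -subr_ge0 (_ : _ - _ = (k * (b * T) - (g / b) * S) ^+ 2 + (k * (b * T') - (g / b) * S') ^+ 2).
    by rewrite addr_ge0// sqr_ge0.
  by rewrite /A /A'; field.
have h0 : 0 <= (r * l * b) ^+ 2 * (k ^+ 2 + (g / b) ^+ 2).
  by rewrite mulr_ge0 ?sqr_ge0// addr_ge0 ?sqr_ge0.
apply: (le_trans (ler_wpM2l h0 csA)).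
rewrite mulrA ler_wpM2r//.
have -> : (r * l * b) ^+ 2 * (k ^+ 2 + (g / b) ^+ 2) * (k ^+ 2 + (g / b) ^+ 2) =
  (r * (l * (b * k ^+ 2 + g ^+ 2 / b))) ^+ 2 by field.
have k1 : b * k ^+ 2 <= b.
  by have := sqr_ge0 g; rewrite kg; nra.
have k2 : 0 <= b * k ^+ 2 by rewrite mulr_ge0 ?sqr_ge0// ltW.
apply: lerXn2r; rewrite ?nnegrE ?mulr_ge0 ?addr_ge0// ?(ltW b0)//.
by rewrite ler_wpM2l// ler_wpM2l// lerD2r.
Qed.

(** The rotation of the frame by th is cos th times the identity, which does not
    increase the energy, plus sin th times a quarter turn, which multiplies the
    square root of the energy by at most 1 / b because b <= 1. *)
Lemma energy_rotate b psi psi' p p' q q' : 0 < b -> b <= 1 ->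
  energy b psi' p p' q q' <= (1 + `|sin (psi' - psi)| / b) ^+ 2 * energy b psi p p' q q'.
Proof.
move=> b0 b1.
set th := psi' - psi; set E := energy b psi p p' q q'.
have phE : psi' = th + psi by rewrite subrK.
pose k := cos th; pose g := sin th.
have kg : k ^+ 2 = 1 - g ^+ 2 by rewrite -(cos2Dsin2 th) addrK.
have cE : cos psi' = k * cos psi - g * sin psi by rewrite phE cosD.
have sE : sin psi' = g * cos psi + k * sin psi by rewrite phE sinD.
pose S := cos psi * p + sin psi * q; pose S' := cos psi * p' + sin psi * q'.
pose T := cos psi * q - sin psi * p; pose T' := cos psi * q' - sin psi * p'.
have EE : E = S ^+ 2 + S' ^+ 2 + (b * T) ^+ 2 + (b * T') ^+ 2.
  by rewrite /E /energy -/S -/S' -/T -/T'; ring.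
have -> : energy b psi' p p' q q' =
  (k * S + g * T) ^+ 2 + (k * S' + g * T') ^+ 2 + (k * (b * T) + - (b * g * S)) ^+ 2 +
  (k * (b * T') + - (b * g * S')) ^+ 2.
  by rewrite /energy cE sE /S /S' /T /T'; ring.
have E0 : 0 <= E by exact: energy_ge0.
have bi0 : 0 < b^-1 by rewrite invr_gt0.
have bne : b != 0 by rewrite gt_eqF.
apply: minkowski4.
- by rewrite mulr_ge0// ltW.
- have -> : (k * S) ^+ 2 + (k * S') ^+ 2 + (k * (b * T)) ^+ 2 + (k * (b * T')) ^+ 2 = k ^+ 2 * E.
    by rewrite EE; ring.
  by rewrite kg; have := sqr_ge0 g; nra.
- have -> : (`|sin th| / b) ^+ 2 = (g / b) ^+ 2 by rewrite !expr_div_n real_normK ?num_real.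
  rewrite -subr_ge0 (_ : _ - _ = (g / b) ^+ 2 * (1 - b ^+ 4) * (S ^+ 2 + S' ^+ 2)).
    apply: mulr_ge0; last by rewrite addr_ge0 ?sqr_ge0.
    by apply: mulr_ge0; [exact: sqr_ge0|rewrite subr_ge0 exprn_ile1// ltW].
  by rewrite EE -/g; field.
Qed.

(** With k = 1 this says that lowering the weight is free; otherwise raising the
    weight by a factor k costs k. *)
Lemma energy_weight b b' k psi p p' q q' : 0 <= b' -> 1 <= k -> b' <= k * b ->
  energy b' psi p p' q q' <= k ^+ 2 * energy b psi p p' q q'.
Proof.
move=> b0 k1 bk; rewrite /energy.
set A := (_ ^+ 2 + _ ^+ 2 : R); set B := (_ ^+ 2 + _ ^+ 2 : R).
have A0 : 0 <= A by rewrite addr_ge0 ?sqr_ge0.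
have B0 : 0 <= B by rewrite addr_ge0 ?sqr_ge0.
rewrite [k ^+ 2 * _]mulrDr [k ^+ 2 * (_ * _)]mulrA -exprMn; apply: lerD.
  by rewrite ler_peMl// exprn_ege1.
by rewrite ler_wpM2r// lerXn2r// nnegrE//; apply: le_trans bk.
Qed.

End energy.

(** * Energies along the nodes *)

Section row_sequences.
Context {R : realType}.
Variables (l phi : nat -> R) (zr zi r : R) (p p' q q' : nat -> R).
Hypothesis l_ge0 : forall j, (0 < j)%N -> 0 <= l j.
Hypothesis r_ge0 : 0 <= r.
Hypothesis zE : zr ^+ 2 + zi ^+ 2 = r ^+ 2.
Let X n := zr * (cos (phi n.+1) * p n + sin (phi n.+1) * q n) -
           zi * (cos (phi n.+1) * p' n + sin (phi n.+1) * q' n).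
Let Y n := zr * (cos (phi n.+1) * p' n + sin (phi n.+1) * q' n) +
           zi * (cos (phi n.+1) * p n + sin (phi n.+1) * q n).
Hypothesis row_rec : forall n,
  [/\ p n.+1 = p n - sin (phi n.+1) * (l n.+1 * X n),
      p' n.+1 = p' n - sin (phi n.+1) * (l n.+1 * Y n),
      q n.+1 = q n + cos (phi n.+1) * (l n.+1 * X n) &
      q' n.+1 = q' n + cos (phi n.+1) * (l n.+1 * Y n)].

Definition row_energy b psi n := energy b psi (p n) (p' n) (q n) (q' n).

Lemma row_energy_step b psi n : 0 < b ->
  row_energy b psi n.+1 <=
  (1 + r * (l n.+1 * (b + sin (phi n.+1 - psi) ^+ 2 / b))) ^+ 2 * row_energy b psi n.
Proof.
move=> b0; rewrite /row_energy; have [-> -> -> ->] := row_rec n.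
by apply: energy_step => //; [exact: l_ge0|exact: zE].
Qed.

(** The finitely many intervals on which the majorants say nothing cost a fixed
    power of r; the Euclidean energy is enough for them. *)
Lemma row_energy_initial n :
  row_energy 1 0 n <= \prod_(1 <= j < n.+1) (1 + 2 * r * l j) ^+ 2 * row_energy 1 0 0.
Proof.
elim: n => [|n IH]; first by rewrite big_geq// mul1r.
apply: (le_trans (row_energy_step _ _ ltr01)).
rewrite big_nat_recr//= [_ * (1 + _) ^+ 2]mulrC -[leRHS]mulrA.
apply: ler_pM; rewrite ?sqr_ge0 ?energy_ge0//.
have l0 := l_ge0 (ltn0Sn n).
have rl : 0 <= r * l n.+1 by exact: mulr_ge0.
have s1 : sin (phi n.+1 - 0) ^+ 2 <= 1.
  by rewrite -(cos2Dsin2 (phi n.+1 - 0)) lerDr sqr_ge0.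
have s0 := sqr_ge0 (sin (phi n.+1 - 0)).
apply: lerXn2r; rewrite ?nnegrE ?divr1; nra.
Qed.

(** One step rotates the frame, changes the weight and crosses an interval. Both
    the rotation and the interval cost a factor 1 + K x, squared in the energy,
    hence the fourth powers. The change of weight from b n to b n.+1 costs
    P n.+1 / P n: the sequence P is a nondecreasing bookkeeping factor such that
    b / P is nonincreasing, and its contributions telescope. The proof keeps one
    factor (1 + K x n)^2 in reserve for the rotation that starts the next step. *)
Lemma row_energy_head (b P x : nat -> R) (K : R) J :
  (forall n, (J <= n)%N -> 0 < b n /\ b n <= 1) ->
  (forall n, (J <= n)%N -> 0 < P n /\ P n <= P n.+1) ->
  (forall n, (J <= n)%N -> b n.+1 * P n <= P n.+1 * b n) ->
  (forall n, (J <= n)%N -> 0 <= K * x n /\ r * (l n * b n) <= K * x n) ->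
  (forall n, (J <= n)%N -> b n < 1 -> `|sin (phi n.+1 - phi n)| <= K * x n * b n) ->
  forall n, (J <= n)%N ->
  row_energy (b n) (phi n) n <=
  (P n / P J) ^+ 2 * (\prod_(J <= j < n.+1) (1 + K * x j) ^+ 4 * row_energy 1 0 J).
Proof.
move=> hb hP hbP hx hs n Jn.
suff : (1 + K * x n) ^+ 2 * row_energy (b n) (phi n) n <=
   (P n / P J) ^+ 2 * (\prod_(J <= j < n.+1) (1 + K * x j) ^+ 4 * row_energy 1 0 J).
  apply: le_trans; apply: ler_peMl; first exact: energy_ge0.
  by apply: exprn_ege1; rewrite lerDl; have [] := hx n Jn.
have base : (1 + K * x J) ^+ 2 * row_energy (b J) (phi J) J <=
   (P J / P J) ^+ 2 * (\prod_(J <= j < J.+1) (1 + K * x j) ^+ 4 * row_energy 1 0 J).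
  have [PJ0 _] := hP _ (leqnn J).
  rewrite divff ?gt_eqF// expr1n mul1r big_nat1.
  apply: ler_pM; rewrite ?sqr_ge0 ?energy_ge0//.
    by apply: ler_weXn2l => //; rewrite lerDl; case: (hx J (leqnn _)).
  have [b0 b1] := hb J (leqnn _).
  rewrite /row_energy [leRHS]energy1 -(energy1 (phi J)).
  have h : b J <= 1 * 1 by rewrite mul1r.
  by have := energy_weight (phi J) (p J) (p' J) (q J) (q' J) (ltW b0) (lexx 1) h; rewrite expr1n mul1r.
elim: n Jn => [|n IH]; first by rewrite leqn0 => /eqP E; move: base; rewrite E.
rewrite leq_eqVlt => /orP[/eqP E|Jn]; first by move: base; rewrite E.
have Jn1 : (J <= n.+1)%N by exact: leqW.
have [b0 b1] := hb _ Jn1; have [b0' b1'] := hb _ Jn.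
have [P0 PP] := hP _ Jn; have [PJ0 _] := hP _ (leqnn J).
have [x0 xl] := hx _ Jn1; have [x0' _] := hx _ Jn.
have P0' := lt_le_trans P0 PP.
have e1 : row_energy (b n.+1) (phi n.+1) n.+1 <=
    (1 + K * x n.+1) ^+ 2 * row_energy (b n.+1) (phi n.+1) n.
  apply: (le_trans (row_energy_step _ _ b0)).
  rewrite subrr sin0 expr0n/= mul0r addr0 ler_wpM2r ?energy_ge0//.
  rewrite lerXn2r// ?nnegrE ?addr_ge0// ?lerD2l//.
  by rewrite mulr_ge0// mulr_ge0 ?l_ge0// ltW.
have e2 : row_energy (b n.+1) (phi n.+1) n <=
    (P n.+1 / P n) ^+ 2 * row_energy (b n) (phi n.+1) n.
  apply: energy_weight; first exact: ltW.
    by rewrite ler_pdivlMr// mul1r.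
  by rewrite mulrAC ler_pdivlMr// hbP.
have e3 : row_energy (b n) (phi n.+1) n <=
    (1 + K * x n) ^+ 2 * row_energy (b n) (phi n) n.
  have [bn1|bn1] := ltP (b n) 1.
    apply: (le_trans (energy_rotate (phi n) _ _ _ _ _ b0' b1')).
    rewrite ler_wpM2r ?energy_ge0// lerXn2r// ?nnegrE ?addr_ge0//.
      by rewrite mulr_ge0// invr_ge0 ltW.
    by rewrite lerD2l ler_pdivrMr// hs.
  have -> : b n = 1 by apply/eqP; rewrite eq_le b1'.
  rewrite /row_energy !energy1; apply: ler_peMl.
    by rewrite !addr_ge0 ?sqr_ge0.
  by apply: exprn_ege1; rewrite lerDl.
have c0 : 0 <= (1 + K * x n.+1) ^+ 2 by exact: sqr_ge0.
have c1 : 0 <= (P n.+1 / P n) ^+ 2 by exact: sqr_ge0.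
have IHn := IH Jn.
apply: (le_trans (ler_wpM2l c0 e1)).
apply: (le_trans (ler_wpM2l c0 (ler_wpM2l c0 e2))).
apply: (le_trans (ler_wpM2l c0 (ler_wpM2l c0 (ler_wpM2l c1 e3)))).
apply: (le_trans (ler_wpM2l c0 (ler_wpM2l c0 (ler_wpM2l c1 IHn)))).
rewrite (big_nat_recr n.+1)//= le_eqVlt; apply/orP; left; apply/eqP.
move: (\prod_(J <= _ < _) _) => Q; field.
by rewrite !gt_eqF.
Qed.

(** Frame and weight are kept fixed, so no rotations are paid and the steps
    multiply to an exponential. *)
Lemma row_energy_tail b psi N n : 0 < b -> (N <= n)%N ->
  row_energy b psi n <=
  expR (2 * r * \sum_(N.+1 <= j < n.+1) l j * (b + sin (phi j - psi) ^+ 2 / b)) *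
  row_energy b psi N.
Proof.
move=> b0; elim: n => [|n IH].
  by rewrite leqn0 => /eqP ->; rewrite big_geq// mulr0 expR0 mul1r.
rewrite leq_eqVlt => /orP[/eqP ->|]; first by rewrite big_geq// mulr0 expR0 mul1r.
rewrite ltnS => Nn; apply: (le_trans (row_energy_step _ _ b0)).
rewrite (big_nat_recr n.+1)//= [2 * r * _]mulrDr [X in expR X]addrC expRD -[leRHS]mulrA.
apply: ler_pM; rewrite ?sqr_ge0 ?energy_ge0//; last exact: IH.
set m := l n.+1 * _.
have m0 : 0 <= m.
  by rewrite mulr_ge0 ?l_ge0// addr_ge0 ?(ltW b0)// mulr_ge0 ?sqr_ge0// invr_ge0 ltW.
rewrite [leRHS](_ : _ = expR (r * m) ^+ 2); last by rewrite expr2 -expRD; congr expR; ring.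
by apply: lerXn2r; rewrite ?nnegrE ?expR_ge0 ?expR_ge1Dx// addr_ge0// mulr_ge0.
Qed.

End row_sequences.

(** * From energies to the monodromy matrix *)

Section norms.
Context {R : realType}.

Lemma opnorm_le (A : 'M[R[i]]_2) (B : R) : 0 <= B ->
  (forall i, complex.Re (A i 0) ^+ 2 + complex.Im (A i 0) ^+ 2 +
     complex.Re (A i 1) ^+ 2 + complex.Im (A i 1) ^+ 2 <= B ^+ 2) ->
  opnorm A <= 4 * B.
Proof.
move=> B0 hA.
have cabsE (z : R[i]) : cabs z ^+ 2 = complex.Re z ^+ 2 + complex.Im z ^+ 2.
  by case: z => x y; rewrite /cabs/= sqr_sqrtr// addr_ge0 ?sqr_ge0.
have cabs_ge0 (z : R[i]) : 0 <= cabs z by case: z => x y; exact: sqrtr_ge0.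
have entry i j : cabs (A i j) <= B.
  rewrite -(@ler_pXn2r _ 2)// ?nnegrE// cabsE.
  have := hA i; have := sqr_ge0 (complex.Re (A i 0)); have := sqr_ge0 (complex.Re (A i 1)).
  have := sqr_ge0 (complex.Im (A i 0)); have := sqr_ge0 (complex.Im (A i 1)).
  have [->|->] : j = 0 \/ j = 1.
    by case: j => -[|[|//]] hj; [left|right]; exact: val_inj.
    by move=> *; lra.
  by move=> *; lra.
apply: ge_sup.
  exists (vnorm (A *m 0)); exists 0 => //=.
  rewrite /vnorm big1 ?sqrtr0// => i _; rewrite mxE /cabs/= expr0n/=.
  by rewrite addr0 sqrtr0 expr0n.
move=> _ [v /= v1 <-].
have vi i : cabs (v i 0) <= 1.
  apply: le_trans v1; rewrite /vnorm -[leLHS]ger0_norm// -sqrtr_sqr ler_sqrt.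
    by rewrite (bigD1 i)//= lerDl sumr_ge0// => j _; exact: sqr_ge0.
  by rewrite sumr_ge0// => j _; exact: sqr_ge0.
have rowi i : cabs ((A *m v) i 0) <= 2 * B.
  rewrite mxE !big_ord_recl big_ord0 addr0 /cabs.
  apply: (le_trans (le_normcD _ _)); rewrite !Normc.normcM mulr_natl mulr2n.
  by apply: lerD; rewrite -[leRHS]mulr1; apply: ler_pM => //; rewrite ?entry ?vi ?cabs_ge0.
rewrite /vnorm -[leRHS]ger0_norm ?mulr_ge0// -sqrtr_sqr ler_sqrt ?sqr_ge0//.
apply: (@le_trans _ _ (\sum_(i < 2) (2 * B) ^+ 2)).
  apply: ler_sum => i _; apply: lerXn2r => //; rewrite nnegrE//.
  by rewrite mulr_ge0.
by rewrite sumr_const card_ord -mulr_natl; have := sqr_ge0 B; nra.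
Qed.

(** The case where the norms have a nonpositive supremum is harmless because the
    logarithm is then 0. *)
Lemma ln_max_norm_le (M : R[i] -> 'M[R[i]]_2) (r L : R) : 0 <= r -> 0 <= L ->
  (forall z, cabs z = r -> forall i, complex.Re (M z i 0) ^+ 2 + complex.Im (M z i 0) ^+ 2 +
     complex.Re (M z i 1) ^+ 2 + complex.Im (M z i 1) ^+ 2 <= expR L ^+ 2) ->
  ln (max_norm M r) <= ln 4 + L.
Proof.
move=> r0 L0 h.
have [m0|m0] := ltP 0 (max_norm M r); last by rewrite ln0// addr_ge0// ln_ge0//; lra.
rewrite -[L]expRK -lnM ?posrE ?expR_gt0//.
rewrite ler_ln ?posrE ?mulr_gt0 ?expR_gt0//.
apply: ge_sup.
  exists (opnorm (M (Complex r 0))); exists (Complex r 0) => //=.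
  by rewrite /cabs/= expr0n/= addr0 sqrtr_sqr ger0_norm.
by move=> _ [z /= zr <-]; apply: opnorm_le; [exact: expR_ge0|exact: h].
Qed.

End norms.

Section tails.
Context {R : realType}.
Variables (l : nat -> R).
Hypothesis l_gt0 : forall j, (0 < j)%N -> 0 < l j.
Hypothesis l_summable : summable_seq l.

Section partial_sums.
Variables (u : nat -> R) (N : nat).
Hypothesis ul : forall j, (0 < j)%N -> 0 <= u j <= l j.

Let partial_mono : nondecreasing_seq (fun n => \sum_(N.+1 <= j < n) u j).
Proof.
apply/nondecreasing_seqP => n.
have [Nn|nN] := leqP N.+1 n; last by rewrite !big_geq// ltnW.
have n0 : (0 < n)%N by exact: leq_trans Nn.
by rewrite big_nat_recr//= lerDl; case/andP: (ul n0).
Qed.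

Let partial_cvg : cvgn (fun n => \sum_(N.+1 <= j < n) u j).
Proof.
apply: nondecreasing_is_cvgn partial_mono _; exists (total_length l) => _ [n _ <-] /=.
apply: (@le_trans _ _ (node l n)); last exact/ltW/node_lt_total.
apply: (@le_trans _ _ (\sum_(N.+1 <= j < n) l j)).
  by apply: ler_sum_nat => j /andP[Nj _]; have /andP[] := ul (leq_trans (ltn0Sn N) Nj).
by apply: ler_sum_widen => // j /l_gt0/ltW.
Qed.

(** The sequence u is dominated by l, so as to cover both tails of the theorem
    at once. *)
Lemma tail_sum_ge m : \sum_(N.+1 <= j < m) u j <= tail_sum u N.
Proof. exact: (nondecreasing_cvgn_le partial_mono partial_cvg). Qed.

Lemma tail_sum_le_partial B : (forall m, \sum_(N.+1 <= j < m) u j <= B) -> tail_sum u N <= B.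
Proof. by move=> h; apply: limr_le => //; exact: nearW. Qed.

Lemma tail_sum_ge0 : 0 <= tail_sum u N.
Proof. by have := tail_sum_ge 0; rewrite big_geq. Qed.

End partial_sums.

Lemma length_dominated j : (0 < j)%N -> 0 <= l j <= l j.
Proof. by move=> /l_gt0/ltW ->/=. Qed.

Lemma sin_length_dominated (phi : nat -> R) psi j : (0 < j)%N ->
  0 <= l j * sin (phi j - psi) ^+ 2 <= l j.
Proof.
by move=> /l_gt0/ltW lj; rewrite mulr_ge0 ?sqr_ge0//= ler_piMr// -(cos2Dsin2 (phi j - psi)) lerDr sqr_ge0.
Qed.

Lemma tail_sin_le (phi : nat -> R) psi n :
  tail_sum (fun j => l j * sin (phi j - psi) ^+ 2) n <= tail_sum l n.
Proof.
apply: tail_sum_le_partial => [|m]; first exact: sin_length_dominated.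
apply: (le_trans _ (tail_sum_ge n length_dominated m)); apply: ler_sum_nat => j /andP[nj _].
by have /andP[] := sin_length_dominated phi psi (leq_trans (ltn0Sn n) nj).
Qed.

End tails.

Section monodromy_bounds.
Context {R : realType}.
Variables (l phi : nat -> R) (W : R -> R[i] -> 'M[R[i]]_2).
Hypothesis l_gt0 : forall j, (0 < j)%N -> 0 < l j.
Hypothesis l_summable : summable_seq l.
Hypothesis W_fund : fundamental_solution (hamburger l phi) (total_length l) W.

Let rowE z i b psi n := row_energy (fun m => complex.Re (W (node l m) z i 0))
  (fun m => complex.Im (W (node l m) z i 0)) (fun m => complex.Re (W (node l m) z i 1))
  (fun m => complex.Im (W (node l m) z i 1)) b psi n.

(** Row bounds at all late nodes pass to the limit; the threshold may depend on
    z and on the row. *)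
Lemma ln_monodromy_of_nodes (r L : R) : 0 <= r -> 0 <= L ->
  (forall z, cabs z = r -> forall i,
     exists N, forall n, (N <= n)%N -> rowE z i 1 0 n <= expR L ^+ 2) ->
  ln (max_norm (W (total_length l)) r) <= ln 4 + L.
Proof.
move=> r0 L0 h; apply: ln_max_norm_le => // z zr i.
have [N hN] := h z zr i.
have [c1 c2] := fundamental_solution_cvg l_gt0 l_summable W_fund z i 0.
have [c3 c4] := fundamental_solution_cvg l_gt0 l_summable W_fund z i 1.
rewrite ![in leLHS]expr2.
apply: (cvgr_to_le (cvgD (cvgD (cvgD (cvgM c1 c1) (cvgM c2 c2)) (cvgM c3 c3)) (cvgM c4 c4))).
exists N => // n /= /hN; rewrite /rowE /row_energy energy1 !expr2.
exact.
Qed.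

Lemma row_energy_init z i : rowE z i 1 0 0%N = 1.
Proof.
rewrite /rowE /row_energy energy1 node0 !(fundamental_solution_init W_fund).
have [->|->] : i = 0 \/ i = 1.
  by case: i => -[|[|//]] hj; [left|right]; exact: val_inj.
  by rewrite eqxx/= !expr0n/= expr1n !addr0.
by rewrite eqxx/= !expr0n/= expr1n !addr0 !add0r.
Qed.

(** Combines the initial and the weighted steps and returns to the Euclidean
    energy at index n, which costs the factor 1 / b n. *)
Lemma row_energy_weighted r z i (b P x : nat -> R) K J n : 0 <= r -> cabs z = r ->
  (forall n, (J <= n)%N -> 0 < b n /\ b n <= 1) ->
  (forall n, (J <= n)%N -> 0 < P n /\ P n <= P n.+1) ->
  (forall n, (J <= n)%N -> b n.+1 * P n <= P n.+1 * b n) ->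
  (forall n, (J <= n)%N -> 0 <= K * x n /\ r * (l n * b n) <= K * x n) ->
  (forall n, (J <= n)%N -> b n < 1 -> `|sin (phi n.+1 - phi n)| <= K * x n * b n) ->
  (J <= n)%N ->
  rowE z i 1 0 n <= expR (\sum_(1 <= j < J.+1) ln (1 + 2 * r * l j) +
    ln (P n / P J) + 2 * \sum_(J <= j < n.+1) ln (1 + K * x j) - ln (b n)) ^+ 2.
Proof.
move=> r0 zr hb hP hbP hx hs Jn.
have zE : complex.Re z ^+ 2 + complex.Im z ^+ 2 = r ^+ 2.
  by rewrite -zr; case: (z) => x1 y1; rewrite /cabs/= sqr_sqrtr// addr_ge0 ?sqr_ge0.
have l0 j : (0 < j)%N -> 0 <= l j by move=> /l_gt0/ltW.
have rec := fundamental_solution_step l_gt0 l_summable W_fund z i.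
have [b0 b1] := hb _ Jn.
have e1 : rowE z i 1 0 n <= (b n)^-1 ^+ 2 * rowE z i (b n) (phi n) n.
  rewrite /rowE /row_energy [leLHS]energy1 -(energy1 (phi n)).
  apply: energy_weight => //; first by rewrite invf_ge1.
  by rewrite mulVf// gt_eqF.
have e2 := row_energy_head l0 r0 zE rec hb hP hbP hx hs Jn.
have e3 : rowE z i 1 0 J <= \prod_(1 <= j < J.+1) (1 + 2 * r * l j) ^+ 2.
  have := row_energy_initial l0 r0 zE rec J.
  by rewrite -[X in _ * X]/(rowE z i 1 0 0%N) row_energy_init mulr1.
apply: (le_trans e1).
apply: (le_trans (ler_wpM2l _ e2)); first exact: sqr_ge0.
have Q0 : 0 <= \prod_(J <= j < n.+1) (1 + K * x j) ^+ 4.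
  by apply: prodr_ge0 => j _; rewrite exprn_even_ge0.
apply: (le_trans (ler_wpM2l _ (ler_wpM2l _ (ler_wpM2l Q0 e3)))); rewrite ?sqr_ge0//.
have [PJ0 _] := hP J (leqnn _).
have Pn m : (J <= m)%N -> 0 < P m by move=> /hP[].
rewrite !expRD expRN lnK ?posrE ?divr_gt0 ?Pn// lnK ?posrE ?divr_gt0 ?Pn//.
have -> : expR (\sum_(1 <= j < J.+1) ln (1 + 2 * r * l j)) = \prod_(1 <= j < J.+1) (1 + 2 * r * l j).
  rewrite expR_sum; rewrite big_nat [RHS]big_nat; apply: eq_bigr => j /andP[j0 _].
  by rewrite lnK// posrE ltr_pwDl// mulr_ge0 ?l0// mulr_ge0.
have -> : expR (2 * \sum_(J <= j < n.+1) ln (1 + K * x j)) = \prod_(J <= j < n.+1) (1 + K * x j) ^+ 2.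
  rewrite mulr_sumr expR_sum big_nat [RHS]big_nat; apply: eq_bigr => j /andP[Jj _].
  rewrite expRM_natl lnK// posrE ltr_pwDl//.
  by have [] := hx j Jj.
rewrite !exprMn !prodrXl -!exprM.
by rewrite le_eqVlt; apply/orP; left; apply/eqP; ring.
Qed.

End monodromy_bounds.

Section weighted_monodromy_bounds.
Context {R : realType}.
Variables (l phi : nat -> R) (W : R -> R[i] -> 'M[R[i]]_2).
Hypothesis l_gt0 : forall j, (0 < j)%N -> 0 < l j.
Hypothesis l_summable : summable_seq l.
Hypothesis W_fund : fundamental_solution (hamburger l phi) (total_length l) W.
Variables (r K : R) (b P x : nat -> R) (J : nat).
Hypothesis r0 : 0 <= r.
Hypothesis hb : forall n, (J <= n)%N -> 0 < b n /\ b n <= 1.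
Hypothesis hP : forall n, (J <= n)%N -> 0 < P n /\ P n <= P n.+1.
Hypothesis hbP : forall n, (J <= n)%N -> b n.+1 * P n <= P n.+1 * b n.
Hypothesis hx : forall n, (J <= n)%N -> 0 <= K * x n /\ r * (l n * b n) <= K * x n.
Hypothesis hs : forall n, (J <= n)%N -> b n < 1 ->
  `|sin (phi n.+1 - phi n)| <= K * x n * b n.

Let head n := \sum_(1 <= j < J.+1) ln (1 + 2 * r * l j) +
    ln (P n / P J) + 2 * \sum_(J <= j < n.+1) ln (1 + K * x j) - ln (b n).

Let head_ge0 n : (J <= n)%N -> 0 <= head n.
Proof.
move=> Jn; have [b0 b1] := hb Jn; have [P0 _] := hP (leqnn J).
apply: addr_ge0; last by rewrite oppr_ge0 ln_le0.
apply: addr_ge0; last first.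
  rewrite mulr_ge0// big_nat sumr_ge0// => j /andP[Jj _].
  by rewrite ln_ge0// lerDl; case: (hx Jj).
apply: addr_ge0.
  rewrite big_nat sumr_ge0// => j /andP[j0 _].
  by rewrite ln_ge0// lerDl mulr_ge0 ?(ltW (l_gt0 j0))// mulr_ge0.
rewrite ln_ge0// ler_pdivlMr// mul1r.
elim: n Jn {b0 b1} => [|n IH]; first by rewrite leqn0 => /eqP ->.
rewrite leq_eqVlt => /orP[/eqP ->//|Jn].
by apply: (le_trans (IH Jn)); case: (hP Jn).
Qed.

(** Without a cut the head estimate has to be bounded uniformly in n. *)
Lemma ln_monodromy_full (S : R) :
  (forall n, (J <= n)%N -> ln (P n / P J) + 2 * \sum_(J <= j < n.+1) ln (1 + K * x j)
      - ln (b n) <= S) ->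
  ln (max_norm (W (total_length l)) r) <=
  ln 4 + \sum_(1 <= j < J.+1) ln (1 + 2 * r * l j) + S.
Proof.
move=> hS; rewrite -addrA; apply: (ln_monodromy_of_nodes l_gt0 l_summable W_fund) => //.
  apply: (le_trans (head_ge0 (leqnn J))); rewrite /head -!addrA lerD2l !addrA.
  exact: hS.
move=> z zr i; exists J => n Jn.
apply: (le_trans (row_energy_weighted l_gt0 l_summable W_fund i r0 zr hb hP hbP hx hs Jn)).
apply: lerXn2r; rewrite ?nnegrE ?expR_ge0// ler_expR -!addrA lerD2l !addrA.
exact: hS.
Qed.

(** At index n the frame is changed to psi and the weight to b'. Passing from
    the Euclidean energy to the weight b' is free, and returning from it at the
    end costs 1 / b'. *)
Lemma ln_monodromy_cut (psi b' TL TP : R) n : (J <= n)%N -> 0 < b' <= 1 ->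
  tail_sum l n <= TL -> tail_sum (fun j => l j * sin (phi j - psi) ^+ 2) n <= TP ->
  ln (max_norm (W (total_length l)) r) <=
  ln 4 + (\sum_(1 <= j < J.+1) ln (1 + 2 * r * l j) +
    ln (P n / P J) + 2 * \sum_(J <= j < n.+1) ln (1 + K * x j) - ln (b n)) +
  (- ln b' + r * (b' * TL + TP / b')).
Proof.
move=> Jn /andP[b0 b1] hTL hTP; rewrite -/(head n) -addrA.
have usin := sin_length_dominated l_gt0 phi psi; have ul := length_dominated l_gt0.
have TL0 : 0 <= TL by exact: le_trans (tail_sum_ge0 l_gt0 l_summable n ul) hTL.
have TP0 : 0 <= TP by exact: le_trans (tail_sum_ge0 l_gt0 l_summable n usin) hTP.
apply: (ln_monodromy_of_nodes l_gt0 l_summable W_fund) => //.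
  rewrite addr_ge0 ?head_ge0// addr_ge0 ?oppr_ge0 ?ln_le0// mulr_ge0// addr_ge0//.
    by rewrite mulr_ge0// ltW.
  by rewrite mulr_ge0// invr_ge0 ltW.
move=> z zr i; exists n => m nm.
have zE : complex.Re z ^+ 2 + complex.Im z ^+ 2 = r ^+ 2.
  by rewrite -zr; case: (z) => x1 y1; rewrite /cabs/= sqr_sqrtr// addr_ge0 ?sqr_ge0.
have l0 j : (0 < j)%N -> 0 <= l j by move=> /l_gt0/ltW.
have rec := fundamental_solution_step l_gt0 l_summable W_fund z i.
have e1 := row_energy_weighted l_gt0 l_summable W_fund i r0 zr hb hP hbP hx hs Jn.
have e2 := row_energy_tail l0 r0 zE rec psi b0 nm.
have e3 := energy_weight psi (complex.Re (W (node l m) z i 0)) (complex.Im (W (node l m) z i 0))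
  (complex.Re (W (node l m) z i 1)) (complex.Im (W (node l m) z i 1)) (ler01)
  (_ : 1 <= b'^-1) (_ : 1 <= b'^-1 * b').
rewrite invf_ge1// mulVf ?gt_eqF// lexx b1 in e3.
have e4 := energy_weight psi (complex.Re (W (node l n) z i 0)) (complex.Im (W (node l n) z i 0))
  (complex.Re (W (node l n) z i 1)) (complex.Im (W (node l n) z i 1)) (ltW b0)
  (lexx 1) (_ : b' <= 1 * 1).
rewrite mul1r b1 expr1n mul1r energy1 -(energy1 0) in e4.
rewrite /row_energy energy1 -(energy1 psi).
apply: (le_trans (e3 isT isT)).
apply: (le_trans (ler_wpM2l _ e2)); first exact: sqr_ge0.
apply: (le_trans (ler_wpM2l _ (ler_wpM2l _ (e4 isT)))); rewrite ?sqr_ge0 ?expR_ge0//.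
apply: (le_trans (ler_wpM2l _ (ler_wpM2l _ e1))); rewrite ?sqr_ge0 ?expR_ge0//.
rewrite -/(head n); move: (head n) => H.
set y := r * (b' * TL + TP / b').
have -> : expR (H + (- ln b' + y)) ^+ 2 = b'^-1 ^+ 2 * (expR (2 * y) * expR H ^+ 2).
  by rewrite [2 * y]mulr_natl [y *+ 2]mulr2n !expRD expRN lnK ?posrE//; ring.
rewrite ler_wpM2l ?sqr_ge0// ler_wpM2r ?sqr_ge0// ler_expR /y mulrA.
apply: ler_wpM2l; first exact: mulr_ge0.
rewrite (eq_bigr (fun j => b' * l j + l j * sin (phi j - psi) ^+ 2 / b')); last first.
  by move=> j _; ring.
rewrite big_split/= -mulr_sumr -mulr_suml; apply: lerD.
  apply: (ler_wpM2l (ltW b0)); apply: le_trans hTL.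
  exact: (tail_sum_ge l_gt0 l_summable).
apply: ler_wpM2r; first by rewrite invr_ge0 ltW.
by apply: le_trans hTP; apply: (tail_sum_ge l_gt0 l_summable).
Qed.
End weighted_monodromy_bounds.

(** * Regular variation and Potter bounds *)

Section regular_variation.
Context {R : realType}.
Implicit Types (f g h : R -> R) (a b p : R).

Lemma rv_gt0 f a t : regularly_varying_index f a -> 1 <= t -> 0 < f t.
Proof. by case=> _ h _; exact: h. Qed.

Lemma rv_ln_cvg f a (c : R) : regularly_varying_index f a -> 0 < c ->
  ln (f (c * t)) - ln (f t) @[t --> +oo] --> a * ln c.
Proof.
move=> [_ f0 fa] c0.
have h : ln (f (c * t) / f t) @[t --> +oo] --> a * ln c.
  rewrite -ln_powR; apply: continuous_cvg; last exact: fa.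
  by apply: continuous_ln; exact: powR_gt0.
apply: cvg_trans h; apply: near_eq_cvg; apply/near_pinftyE.
exists (Num.max 1 c^-1); first by rewrite le_max lexx.
move=> t; rewrite ge_max => /andP[t1 ct].
have ct1 : 1 <= c * t by rewrite -ler_pdivrMl// mulr1.
by rewrite lnM ?posrE ?invr_gt0 ?f0// lnV ?posrE ?f0.
Qed.

Lemma rv_index_unique f a b :
  regularly_varying_index f a -> regularly_varying_index f b -> a = b.
Proof.
move=> fa fb; have ln20 : 0 < ln 2 :> R by rewrite ln_gt0// ltr1n.
apply: (mulIf (lt0r_neq0 ln20)).
have h := rv_ln_cvg fa (ltr0Sn R 1); have h' := rv_ln_cvg fb (ltr0Sn R 1).
exact: (cvg_unique _ h h').
Qed.

Lemma rv_ind f a : regularly_varying_index f a -> ind f = a.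
Proof.
move=> fa; apply: (rv_index_unique (f := f)) => //.
by rewrite /ind; apply: (@xgetPex _ 0 [set al | regularly_varying_index f al]); exists a.
Qed.

Lemma rv_mul f g a b : regularly_varying_index f a -> regularly_varying_index g b ->
  regularly_varying_index (fun t => f t * g t) (a + b).
Proof.
move=> [mf f0 fa] [mg g0 gb]; split.
- exact: measurable_funM.
- by move=> t t1; rewrite mulr_gt0 ?f0 ?g0.
- move=> la la0; rewrite powRD; last by rewrite (gt_eqF la0) implybT.
  apply: cvg_trans (cvgM (fa _ la0) (gb _ la0)).
  by apply: near_eq_cvg; near=> t; rewrite /= invfM mulrACA.
Unshelve. all: by end_near. Qed.

Lemma rv_powR f h a p : regularly_varying_index f a ->
  (forall t, 1 <= t -> h t = f t `^ p) -> regularly_varying_index h (p * a).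
Proof.
move=> fa hf; have [mf f0 _] := fa; split.
- have mfp : measurable_fun (`[1, +oo[ : set R) (fun t => f t `^ p).
    by apply: (measurableT_comp (measurable_powR p)).
  apply: eq_measurable_fun mfp.
  by move=> t; rewrite inE /= in_itv/= andbT => /hf.
- by move=> t t1; rewrite hf// powR_gt0// f0.
- move=> la la0; have h1 := rv_ln_cvg fa la0.
  have : expR (p * (ln (f (la * t)) - ln (f t))) @[t --> +oo] --> expR (p * (a * ln la)).
    apply: continuous_cvg; first exact: continuous_expR.
    exact: cvgMl_tmp.
  rewrite /powR (gt_eqF la0) mulrA; apply: cvg_trans; apply: near_eq_cvg; apply/near_pinftyE.
  exists (Num.max 1 la^-1); first by rewrite le_max lexx.
  move=> t; rewrite ge_max => /andP[t1 ct].
  have ct1 : 1 <= la * t by rewrite -ler_pdivrMl// mulr1.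
  by rewrite !hf// /powR !gt_eqF ?f0// mulrBr expRD expRN.
Qed.

(** The Potter bounds f t / f s <= e^K (t / s)^(a + eps) for large s <= t, and
    the corresponding lower bounds, in logarithmic form, where they are stable
    under products and powers. *)
Definition potter f a := forall eps : R, 0 < eps ->
  exists K, exists2 T, 1 <= T & forall s t, T <= s -> s <= t ->
  `|ln (f t) - ln (f s) - a * (ln t - ln s)| <= eps * (ln t - ln s) + K.

(** What remains of being comparable to a nonincreasing function, in logarithmic
    form. *)
Definition almost_nonincreasing f :=
  exists K, exists2 T, 1 <= T & forall s t, T <= s -> s <= t -> ln (f t) <= ln (f s) + K.

(** Replaces the comparison function by a positive multiple whose ratio to f is
    within a factor 2; it stays nonincreasing and positive on the whole ray. *)
Lemma approx_nonincreasing_norm f : (forall t, 1 <= t -> 0 < f t) ->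
  approx_nonincreasing f ->
  exists2 g, (forall t, 1 <= t -> 0 < g t) /\ (forall s t, 1 <= s -> s <= t -> g t <= g s) &
    exists2 T, 1 <= T & forall t, T <= t -> g t / 2 <= f t /\ f t <= 2 * g t.
Proof.
move=> f0 [g gmono [c c0 gc]].
have gm s t : 1 <= s -> s <= t -> g t <= g s.
  by move=> s1 st; apply: gmono => //; rewrite in_itv/= andbT// (le_trans s1 st).
have c2 : 0 < c / 2 by lra.
move/cvgrPdist_lt : gc => /(_ _ c2) /near_pinftyE[T T1 hT].
have bd t : T <= t -> 0 < g t /\ (c / 2 * g t <= f t /\ f t <= 2 * c * g t).
  move=> Tt; have ft := f0 t (le_trans T1 Tt).
  have h1 : c / 2 < f t / g t by have := hT _ Tt; rewrite ltr_distlC; lra.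
  have h2 : f t / g t < 2 * c by have := hT _ Tt; rewrite ltr_distlC; lra.
  have gt0 : 0 < g t.
    have : 0 < f t / g t by exact: lt_trans h1.
    by rewrite pmulr_rgt0// invr_gt0.
  split => //; split.
    by rewrite -ler_pdivlMr// ltW.
  by rewrite -ler_pdivrMr// ltW.
have g0 t : 1 <= t -> 0 < g t.
  move=> t1; have [Tt|tT] := leP T t; first by case: (bd t Tt).
  by have [gT _] := bd T (lexx _); apply: lt_le_trans gT _; apply: gm => //; exact: ltW.
exists (fun t => c * g t).
  split=> [t t1|s t s1 st]; first by rewrite mulr_gt0// g0.
  by rewrite ler_pM2l// gm.
exists T => // t Tt; have [_ [h1 h2]] := bd t Tt; split; lra.
Qed.

Lemma approx_nonincreasing_almost f : (forall t, 1 <= t -> 0 < f t) ->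
  approx_nonincreasing f -> almost_nonincreasing f.
Proof.
move=> f0 /(approx_nonincreasing_norm f0)[g [g0 gm] [T T1 hT]].
exists (ln 4); exists T => // s t Ts st.
have [_ h1] := hT _ (le_trans Ts st); have [h2 _] := hT _ Ts.
have s1 := le_trans T1 Ts.
have ft := f0 _ (le_trans s1 st); have fs := f0 _ s1.
rewrite -lnM ?posrE// ler_ln ?posrE ?mulr_gt0//.
by have := gm _ _ s1 st; lra.
Qed.

(** Regular variation is used only for the ratio 2, where the logarithmic
    increment is within eps ln 2 of its limit; these errors add up to eps (ln t
    - ln s). The last step, of ratio less than 2, is controlled up to a constant
    by almost monotonicity. *)
Lemma rv_potter f a : regularly_varying_index f a -> almost_nonincreasing f ->
  potter f a.
Proof.
move=> fa [K0 [T0 T01 hT0]] eps eps0.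
have ln20 : 0 < ln 2 :> R by rewrite ln_gt0// ltr1n.
have := rv_ln_cvg fa (ltr0Sn R 1).
move=> /cvgrPdist_le /(_ _ (mulr_gt0 eps0 ln20)) /near_pinftyE[T1 T11 hT1].
pose T := Num.max T0 T1.
have step s : T <= s -> `|ln (f (2 * s)) - ln (f s) - a * ln 2| <= eps * ln 2.
  by rewrite ge_max => /andP[_ /hT1]; rewrite distrC.
have K00 : 0 <= K0 by have := hT0 T0 T0 (lexx _) (lexx _); lra.
pose K := K0 + (2 * `|a| + eps) * ln 2.
have base s t : T <= s -> s <= t -> t <= 2 * s ->
    `|ln (f t) - ln (f s) - a * (ln t - ln s)| <= K.
  move=> Ts st ts; have := step _ Ts.
  have /andP[T0s _] : (T0 <= s) && (T1 <= s) by rewrite -ge_max.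
  have s0 : 0 < s by lra.
  have u1 := hT0 _ _ T0s st; have u2 := hT0 _ _ (le_trans T0s st) ts.
  have d0 : 0 <= ln t - ln s by rewrite subr_ge0 ler_ln ?posrE//; lra.
  have d1 : ln t - ln s <= ln 2.
    by rewrite lerBlDr -lnM ?posrE// ler_ln ?posrE ?mulr_gt0//; lra.
  have a1 : `|a * (ln t - ln s)| <= `|a| * ln 2.
    by rewrite normrM (ger0_norm d0) ler_wpM2l.
  have a2 : `|a * ln 2| <= `|a| * ln 2 by rewrite normrM (gtr0_norm ln20).
  have -> : K = K0 + `|a| * ln 2 + `|a| * ln 2 + eps * ln 2 by rewrite /K; ring.
  move: (a * (ln t - ln s)) (`|a| * ln 2) (a * ln 2) (eps * ln 2) a1 a2 => p1 p2 p3 p4.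
  by rewrite !ler_norml => /andP[n1 n2] /andP[n3 n4] /andP[v1 v2]; apply/andP; split; lra.
have main n : forall s t, T <= s -> s <= t -> t <= 2 ^+ n * s ->
    `|ln (f t) - ln (f s) - a * (ln t - ln s)| <= eps * (ln t - ln s) + K.
  elim: n => [|n IH] s t Ts st ts.
    have s1 : 1 <= s by apply: le_trans Ts; rewrite le_max T01.
    have d0 : 0 <= ln t - ln s by rewrite subr_ge0 ler_ln ?posrE//; lra.
    apply: le_trans (base s t Ts st _) _; first by move: ts; rewrite expr0; nra.
    by rewrite lerDr mulr_ge0// ltW.
  have s1 : 1 <= s by apply: le_trans Ts; rewrite le_max T01.
  have [t2s|t2s] := leP t (2 * s).
    apply: le_trans (base s t Ts st t2s) _; rewrite lerDr mulr_ge0// ?(ltW eps0)//.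
    by rewrite subr_ge0 ler_ln ?posrE//; lra.
  have IHt := IH s (t / 2) Ts.
  have st' : s <= t / 2 by lra.
  have := IHt st' _; rewrite ler_pdivrMr// mulrAC -exprSr => /(_ ts).
  have := step _ (le_trans Ts st'); rewrite (_ : 2 * (t / 2) = t); last by field.
  have -> : ln (t / 2) = ln t - ln 2 by rewrite lnM ?lnV ?posrE//; lra.
  by rewrite !ler_norml => /andP[v1 v2] /andP[v3 v4]; apply/andP; split; lra.
exists K; exists T; first by rewrite le_max T01.
move=> s t Ts st.
have s1 : 1 <= s by apply: le_trans Ts; rewrite le_max T01.
have [n hn] : exists n, t / s <= 2 ^+ n.
  exists (Num.truncn (t / s)).+1; apply: (le_trans (ltW (truncnS_gt _))).
  by rewrite -natrX ler_nat ltnW// ltn_expl.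
by apply: (main n) => //; rewrite -ler_pdivrMr//; lra.
Qed.

Lemma potter_lin f g h a b x y : potter f a -> potter g b ->
  (forall t, 1 <= t -> ln (h t) = x * ln (f t) + y * ln (g t)) ->
  potter h (x * a + y * b).
Proof.
move=> fa gb hE eps eps0.
have m0 : 0 < `|x| + `|y| + 1 by rewrite ltr_wpDl// addr_ge0.
have [K1 [T1 T11 H1]] := fa _ (divr_gt0 eps0 m0).
have [K2 [T2 T21 H2]] := gb _ (divr_gt0 eps0 m0).
set e := eps / _ in H1 H2.
exists (`|x| * K1 + `|y| * K2); exists (Num.max T1 T2); first by rewrite le_max T11.
move=> s t; rewrite ge_max => /andP[h1 h2] st.
have s1 : 1 <= s by lra.
rewrite !hE//; last by lra.
have d0 : 0 <= ln t - ln s by rewrite subr_ge0 ler_ln ?posrE//; lra.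
have u1 := H1 _ _ h1 st; have u2 := H2 _ _ h2 st.
set A := (X in `|X| <= _) in u1; set B := (X in `|X| <= _) in u2.
rewrite (_ : _ - _ = x * A + y * B); last by rewrite /A /B; ring.
apply: (le_trans (ler_normD _ _)); rewrite !normrM.
have := ler_wpM2l (normr_ge0 x) u1; have := ler_wpM2l (normr_ge0 y) u2.
have e0 : 0 < e by exact: divr_gt0.
have -> : eps = (`|x| + `|y| + 1) * e by rewrite /e mulrC divfK// gt_eqF.
have : 0 <= e * (ln t - ln s) by rewrite mulr_ge0// ltW.
by move: (`|x|) (`|y|) => *; nra.
Qed.

Lemma ln_near_ge (M : R) : exists2 T, 1 <= T & forall t, T <= t -> M <= ln t.
Proof.
exists (Num.max 1 (expR M)); first by rewrite le_max lexx.
move=> t; rewrite ge_max => /andP[t1 Mt].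
by rewrite -[M]expRK ler_ln ?posrE ?expR_gt0//; lra.
Qed.

Lemma potter_power f a : potter f a -> forall eps : R, 0 < eps ->
  exists2 T, 1 <= T & forall t, T <= t -> `|ln (f t) - a * ln t| <= eps * ln t.
Proof.
move=> fa eps eps0.
have e2 : 0 < eps / 2 by lra.
have [K [T T1 H]] := fa _ e2.
have [T' T'1 H'] := ln_near_ge ((`|ln (f T) - a * ln T| + `|K|) / (eps / 2)).
exists (Num.max T T'); first by rewrite le_max T1.
move=> t; rewrite ge_max => /andP[Tt T't].
have := H' _ T't; rewrite ler_pdivrMr// => h.
have := H T t (lexx _) Tt.
have lT : 0 <= ln T by rewrite ln_ge0.
set A := `|_|; move=> h2.
have -> : ln (f t) - a * ln t = (ln (f t) - ln (f T) - a * (ln t - ln T)) + (ln (f T) - a * ln T) by ring.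
apply: (le_trans (ler_normD _ _)); rewrite -/A.
have := ler_norm K; nra.
Qed.

End regular_variation.

(** * A uniform lower bound for regularly varying functions *)

Section uniform_convergence.
Context {R : realType}.

Lemma lebesgue_measure_shift (u : R) (A : set R) : measurable A ->
  lebesgue_measure [set x : R | A (x - u)] = lebesgue_measure A.
Proof.
move=> mA.
pose f : R -> measurableTypeR R := fun x => x - u.
have mf : measurable_fun [set: measurableTypeR R] f by apply: measurable_funB.
change (pushforward lebesgue_measure f A = lebesgue_measure A).
apply/esym/lebesgue_measure_unique => //= _ [[a b]] _ <-.
rewrite /pushforward /=.
have -> : f @^-1` `]a, b] = `]a + u, b + u]%classic.
  by apply/seteqP; split => x; rewrite /= !in_itv/= ltrBrDr lerBlDr.
rewrite !lebesgue_measure_itv/= !lte_fin ltrD2r.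
by case: ifP => // _; rewrite -!EFinB; congr EFin; ring.
Qed.

Section large_sets.
Variables (b : R -> R) (be L : R) (y : nat -> R).
Hypothesis brv : regularly_varying_index b be.
Hypothesis yn : forall n, n%:R <= y n.
Hypothesis L0 : 0 < L.

(** The shifts la in [0, L] for which the logarithmic increment of b from y m to
    y m + la is within 1 of its limit be * la, for all m from n on. *)
Definition good_shift n : set R := [set la | 0 <= la <= L /\ forall m, (n <= m)%N ->
  `|ln (b (expR (y m + la))) - ln (b (expR (y m))) - be * la| <= 1].

Lemma measurable_good_shift n : measurable (good_shift n).
Proof.
pose k m la := ln (b (expR (y m + la))) - ln (b (expR (y m))) - be * la.
pose A m : set R := `[0, L] `&` k m @^-1` `[-1, 1].
have -> : good_shift n = \bigcap_(m in [set m | (n <= m)%N]) A m.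
  apply/seteqP; split => la.
    move=> [h1 h2] m /= nm; split; first by rewrite /= in_itv.
    by rewrite /= in_itv/= -ler_norml h2.
  move=> h; have := h n (leqnn n) => -[]; rewrite /= in_itv/= => h1 _.
  by split => // m nm; have [_] := h m nm; rewrite /= in_itv/= -ler_norml.
have mk m : measurable_fun (`[0, L] : set R) (k m).
  apply: measurable_funB; last exact: measurable_funM.
  apply: measurable_funB; last exact: measurable_cst.
  apply: (measurableT_comp (@measurable_ln R)).
  have [mb _ _] := brv.
  apply: (@measurable_comp _ _ _ _ _ _ (`[1, +oo[ : set R)) => //.
    move=> _ [la /=] /itvP h <-; rewrite in_itv/= andbT -expR0 ler_expR.
    by rewrite addr_ge0 ?h// (le_trans _ (yn m)).
  apply: (measurableT_comp (@measurable_expR R)).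
  exact: measurable_funD.
apply: bigcap_measurable; first by exists n => /=.
by move=> m _; apply: mk => //.
Qed.

(** The good shifts increase to the whole interval [0, L] because each single
    shift becomes good; continuity of the measure gives the rest. *)
Lemma good_shift_large (eta : R) : 0 < eta ->
  exists N, forall n, (N <= n)%N -> ((L - eta)%:E < lebesgue_measure (good_shift n))%E.
Proof.
move=> eta0.
have nd : nondecreasing_seq good_shift.
  move=> n m nm; apply/subsetPset => la [h1 h2]; split => // i mi.
  by apply: h2; exact: leq_trans mi.
have UE : \bigcup_n good_shift n = `[0, L]%classic.
  apply/seteqP; split => la; first by move=> [n _ [h _]]; rewrite /= in_itv.
  rewrite /= in_itv/= => laL.
  have := rv_ln_cvg brv (expR_gt0 la); rewrite expRK.
  move=> /cvgrPdist_le /(_ _ ltr01) /near_pinftyE[T T1 hT].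
  exists (Num.truncn (ln T)).+1 => //; split => // m nm.
  have := hT (expR (y m)); rewrite -expRD distrC [la + y m]addrC; apply.
  rewrite -[leLHS]lnK ?posrE ?(lt_le_trans ltr01 T1)// ler_expR.
  apply: le_trans (yn m); apply: le_trans (ltW (truncnS_gt _)) _.
  by rewrite ler_nat.
have mU : measurable (\bigcup_n good_shift n) by rewrite UE.
have mL : lebesgue_measure (\bigcup_n good_shift n) = L%:E.
  by rewrite UE lebesgue_measure_itv/= lte_fin L0 sube0.
have hc : (lebesgue_measure (good_shift n) @[n --> \oo] --> L%:E)%E.
  by rewrite -mL; exact: (nondecreasing_cvg_mu (mu := lebesgue_measure) measurable_good_shift mU nd).
have [[N hN]|no] := pselect (exists N, ((L - eta)%:E < lebesgue_measure (good_shift N))%E).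
  exists N => n Nn; apply: (lt_le_trans hN); apply: le_measure; rewrite ?inE.
  - exact: measurable_good_shift.
  - exact: measurable_good_shift.
  - exact/subsetPset/nd.
exfalso.
have : (L%:E <= (L - eta)%:E)%E.
  apply: (@cvge_to_le _ _ _ _ _ _ _ hc).
  apply: nearW => n /=; rewrite leNgt; apply/negP => h; apply: no; by exists n.
by rewrite lee_fin; lra.
Qed.

End large_sets.

(** Otherwise there are points x_n tending to infinity and shifts u_n in [0, U]
    with b much smaller at x_n + u_n than at x_n. For large n the good shifts of
    x_n, and those of x_n + u_n moved by u_n, have measure above U + 1 each and
    lie in [0, 2 U + 2], so they meet. A common point compares b at x_n and at
    x_n + u_n with the same value of b, which excludes a large drop. *)
Lemma rv_lower_uniform (b : R -> R) (be U : R) : regularly_varying_index b be -> 0 <= U ->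
  exists c, exists2 X, 0 <= X & forall x u, X <= x -> 0 <= u <= U ->
    ln (b (expR x)) - c <= ln (b (expR (x + u))).
Proof.
move=> brv U0; exists (`|be| * U + 2); apply: contrapT => no.
have bad n : exists xu : R * R, [/\ n%:R <= xu.1, 0 <= xu.2 <= U &
    ln (b (expR (xu.1 + xu.2))) < ln (b (expR xu.1)) - (`|be| * U + 2)].
  apply: contrapT => nb; apply: no; exists n%:R => // x u nx uU.
  by rewrite leNgt; apply/negP => h; apply: nb; exists (x, u).
have {bad}[xu hxu] := choice bad.
have y1 n : n%:R <= (xu n).1 by case: (hxu n).
have y2 n : n%:R <= (xu n).1 + (xu n).2.
  by case: (hxu n) => h1 /andP[h2 _] _; lra.
have L0 : 0 < U + 2 by lra.
have [N1 hN1] := good_shift_large brv y1 L0 ltr01.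
have [N2 hN2] := good_shift_large brv y2 L0 ltr01.
pose n := maxn N1 N2.
have := hN1 n (leq_maxl _ _); have := hN2 n (leq_maxr _ _).
set V := good_shift b be (U + 2) (fun n => (xu n).1 + (xu n).2) n.
set V' := good_shift b be (U + 2) (fun n => (xu n).1) n.
have mV : measurable V by exact: measurable_good_shift.
have mV' : measurable V' by exact: measurable_good_shift.
have [h1 /andP[u0 uU] hlt] := hxu n.
set u := (xu n).2 in u0 uU hlt *; set x := (xu n).1 in h1 hlt *.
rewrite -(lebesgue_measure_shift u mV) => hV hV'.
set Vs := [set x | V (x - u)] in hV.
have mVs : measurable Vs.
  have mf : measurable_fun [set: R] (fun x : R => x - u) by apply: measurable_funB.
  by have := mf measurableT V mV; rewrite setTI.
have disj : V' `&` Vs = set0.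
  rewrite -subset0 => la [[/andP[a1 a2] h] [/andP[a3 a4] h']] /=.
  have := h n (leqnn n); have := h' n (leqnn n); rewrite -/u -/x.
  rewrite (_ : x + u + (la - u) = x + la); last by ring.
  have : - (`|be| * U) <= be * u.
    have := ler_norm (- (be * u)); rewrite normrN normrM (ger0_norm u0).
    by have := ler_wpM2l (normr_ge0 be) uU; lra.
  by rewrite !ler_norml => ? /andP[? ?] /andP[? ?]; lra.
have : (lebesgue_measure (V' `|` Vs) <= (U + U + 2)%:E)%E.
  apply: (@le_trans _ _ (lebesgue_measure (`[0%R, (U + U + 2)%R] : set R))).
    apply: le_measure; rewrite ?inE//; first exact: measurableU.
    move=> la [[/andP[a1 a2] _]|[/andP[a1 a2] _]].
      by change (la \in `[0, U + U + 2]); rewrite in_itv/=; apply/andP; split; lra.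
    by change (la \in `[0, U + U + 2]); rewrite in_itv/=; apply/andP; split; lra.
  rewrite lebesgue_measure_itv/=; case: ifP => _; last by rewrite lee_fin; lra.
  by rewrite sube0.
rewrite measureU//.
have := lteD hV' hV; rewrite -EFinD => h2 h3.
by have := lt_le_trans h2 h3; rewrite lte_fin; lra.
Qed.

End uniform_convergence.

(** * Asymptotic inverses *)

Section asymptotic_inverse.
Context {R : realType}.

(** F may be neither monotone nor continuous, so large x need not be values of
    F; doubling gives a value of F within a bounded factor of x. *)
Lemma doubling_sandwich (F : R -> R) (K T : R) : 0 < T ->
  (forall t, T <= t -> F (2 * t) <= K * F t) ->
  (forall A, exists2 T', 1 <= T' & forall t, T' <= t -> A <= F t) ->
  forall x, F T <= x -> exists2 t, T <= t & F t <= x <= K * F t.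
Proof.
move=> T0 Fd Finf x Fx.
have ex : exists n, x < F (2 ^+ n * T).
  have [T' T'1 hT'] := Finf (x + 1).
  exists (Num.truncn (T' / T)).+1; apply: (@lt_le_trans _ _ (x + 1)); first by rewrite ltrDl.
  apply: hT'; rewrite -ler_pdivrMr//; apply: (le_trans (ltW (truncnS_gt _))).
  by rewrite -natrX ler_nat ltnW// ltn_expl.
case: (ex_minnP ex) => n hn nmin.
case: n hn nmin => [|n] hn nmin.
  by move: hn; rewrite expr0 mul1r => /(le_lt_trans Fx); rewrite ltxx.
exists (2 ^+ n * T).
  by rewrite ler_peMl ?(ltW T0)// exprn_ege1// ler1n.
apply/andP; split.
  by rewrite leNgt; apply/negP => /nmin; rewrite ltnn.
apply: (le_trans (ltW hn)); rewrite exprS -mulrA; apply: Fd.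
by rewrite ler_peMl ?(ltW T0)// exprn_ege1// ler1n.
Qed.

(** At values x = F t the inverse is about t. An arbitrary x lies within a
    bounded factor above some value F t, and there the uniform lower bound for
    the regularly varying function b0 prevents b x from being much smaller than
    b (F t). *)
Lemma asymptotic_inverse_large (F b : R -> R) (K T : R) : asymptotic_inverse F b ->
  1 <= T -> (forall t, T <= t -> F (2 * t) <= K * F t) ->
  (forall A, exists2 T', 1 <= T' & forall t, T' <= t -> A <= F t) ->
  forall M, exists2 X, 1 <= X & forall x, X <= x -> M <= b x.
Proof.
move=> [[b0 [be brv] /near_pinftyE[Tb Tb1 hTb]] _ simb] T1 Fd Finf M.
have h2 : (0 : R) < 2^-1 by [].
move/cvgrPdist_lt : simb => /(_ _ h2) /near_pinftyE[T2 T21 hT2].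
pose K' := Num.max 1 K.
have K'1 : 1 <= K' by rewrite le_max lexx.
have [c [X0 X00 hX0]] := rv_lower_uniform brv (ln_ge0 K'1).
have [T3 T31 hT3] := Finf (Num.max Tb (expR X0)).
pose M' := Num.max 1 M.
have M'1 : 1 <= M' by rewrite le_max lexx.
pose Tbig := Num.max (Num.max T T2) (Num.max T3 (2 * M' * expR c)).
have bigT t : Tbig <= t -> [/\ T <= t, T2 <= t, T3 <= t & 2 * M' * expR c <= t].
  by rewrite !ge_max => /andP[/andP[-> ->] /andP[-> ->]].
have [bT1 bT2 bT3 bT4] := bigT _ (lexx _).
have Tbig1 : 1 <= Tbig by lra.
have Fd' t : Tbig <= t -> F (2 * t) <= K' * F t.
  move=> /bigT[h _ h3 _]; apply: (le_trans (Fd _ h)).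
  apply: ler_wpM2r; last by rewrite le_max lexx orbT.
  have := hT3 _ h3; rewrite ge_max => /andP[h4 _]; lra.
exists (Num.max (Num.max 1 Tb) (F Tbig)); first by rewrite !le_max lexx.
move=> x; rewrite !ge_max => /andP[/andP[x1 xTb] Fx].
have [t tT /andP[Ftx xKF]] := doubling_sandwich (lt_le_trans ltr01 Tbig1) Fd' Finf Fx.
have [ht1 ht2 ht3 ht4] := bigT _ tT.
have := hT3 _ ht3; rewrite ge_max => /andP[Ft1 Ft2].
have Ft0 : 0 < F t by lra.
have x0 : 0 < x by lra.
have t0 : 0 < t by lra.
have lF : X0 <= ln (F t) by rewrite -[X0]expRK ler_ln ?posrE ?expR_gt0.
have u0 : 0 <= ln x - ln (F t) <= ln K'.
  rewrite subr_ge0 ler_ln ?posrE// Ftx/= lerBlDr -lnM ?posrE//; last by lra.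
  by rewrite ler_ln ?posrE// mulr_gt0//; lra.
have := hX0 _ _ lF u0; rewrite subrKC !lnK ?posrE// => key.
have [_ bpos _] := brv.
have bF : b (F t) = b0 (F t) by apply: hTb.
have bx : b x = b0 x by apply: hTb.
have bt : t / 2 <= b0 (F t).
  have := hT2 _ ht2; rewrite /= bF ltr_distlC => /andP[h _].
  have h' : 2^-1 < b0 (F t) / t by lra.
  by rewrite ltr_pdivlMr// in h'; lra.
rewrite bx; apply: (@le_trans _ _ M'); first by rewrite le_max lexx orbT.
have bx0 : 0 < b0 x by exact: bpos.
have bF0 : 0 < b0 (F t) by apply: bpos; lra.
rewrite -ler_ln ?posrE//; last by lra.
apply: le_trans key; rewrite lerBrDr.
have -> : ln M' + c = ln (M' * expR c) by rewrite lnM ?posrE ?expR_gt0 ?expRK//; lra.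
rewrite ler_ln ?posrE// ?mulr_gt0 ?expR_gt0//; lra.
Qed.

End asymptotic_inverse.

(** * Sums and integrals *)

Section sums.
Context {R : realType}.

Lemma ln_succ_le (n : nat) : (0 < n)%N -> ln n.+1%:R - ln n%:R <= (n%:R)^-1 :> R.
Proof.
move=> n0; have n0' : 0 < n%:R :> R by rewrite ltr0n.
have -> : ln n.+1%:R = ln n%:R + ln (1 + (n%:R)^-1) :> R.
  rewrite -lnM ?posrE ?addr_gt0 ?invr_gt0//.
  by congr ln; rewrite mulrDr mulr1 divff ?gt_eqF// -natr1.
rewrite addrAC subrr add0r; apply: le_ln1Dx.
by rewrite (@lt_le_trans _ _ 0)// invr_ge0 ltW.
Qed.

Lemma ln_succ_ge (n : nat) : (0 < n)%N -> (n.+1%:R)^-1 <= ln n.+1%:R - ln n%:R :> R.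
Proof.
move=> n0; have n0' : 0 < n%:R :> R by rewrite ltr0n.
have n1' : 0 < n.+1%:R :> R by rewrite ltr0n.
have -> : ln n%:R = ln n.+1%:R + ln (1 + - (n.+1%:R)^-1) :> R.
  have e : 1 - n.+1%:R^-1 = n%:R / n.+1%:R :> R.
    by rewrite -[X in X - _](divff (lt0r_neq0 n1')) -natr1; field; rewrite natr1 gt_eqF.
  rewrite e -lnM ?posrE ?divr_gt0//.
  by congr ln; field; rewrite gt_eqF.
rewrite opprD addrA subrr add0r lerNr; apply: le_ln1Dx.
by rewrite ltrN2 invf_lt1// ltr1n.
Qed.

(** For N = n this is the bound log(n^n / n!) <= n, here by induction. It makes
    the average of log(N / j) over j <= n bounded, so that the head sums below
    cost no extra logarithm. *)
Lemma sum_ln_ratio (N : R) J n : (0 < J)%N -> (0 < n)%N -> n%:R <= N ->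
  \sum_(J <= j < n.+1) (ln N - ln j%:R) <= n%:R * (1 + (ln N - ln n%:R)).
Proof.
move=> J0 n0 nN.
have N0 : 0 < N by apply: lt_le_trans nN; rewrite ltr0n.
have pos j : (0 < j <= n)%N -> 0 <= ln N - ln j%:R.
  move=> /andP[j0 jn]; rewrite subr_ge0 ler_ln ?posrE ?ltr0n//.
  by apply: le_trans nN; rewrite ler_nat.
apply: (@le_trans _ _ (\sum_(1 <= j < n.+1) (ln N - ln j%:R))).
  have [Jn|nJ] := leqP J n.+1; last first.
    rewrite big_geq ?(ltnW nJ)// big_nat sumr_ge0// => j /andP[j1 jn].
  rewrite [leRHS](big_cat_nat (n := J))//= lerDr big_nat sumr_ge0// => j /andP[j1 jJ].
  apply: pos; rewrite j1/= -ltnS; exact: leq_trans jJ _.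
have h m : \sum_(1 <= j < m.+2) (ln m.+1%:R - ln j%:R) <= m%:R :> R.
  elim: m => [|m IH]; first by rewrite big_nat1 subrr.
  rewrite big_nat_recr//= subrr addr0.
  have -> : \sum_(1 <= i < m.+2) (ln m.+2%:R - ln i%:R) =
    \sum_(1 <= i < m.+2) (ln m.+1%:R - ln i%:R) + m.+1%:R * (ln m.+2%:R - ln m.+1%:R) :> R.
    rewrite mulr_natl -[X in _ + _ *+ X]/(m.+2 - 1)%N -sumr_const_nat -big_split/=.
    by apply: eq_bigr => j _; ring.
  have : m.+1%:R * (ln m.+2%:R - ln m.+1%:R) <= 1 :> R.
    by rewrite mulrC -ler_pdivlMr ?ltr0n// div1r ln_succ_le.
  by move=> h; rewrite -[in leRHS]natr1; apply: lerD.
have -> : \sum_(1 <= j < n.+1) (ln N - ln j%:R) =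
    \sum_(1 <= i < n.+1) (ln n%:R - ln i%:R) + n%:R * (ln N - ln n%:R).
  rewrite mulr_natl -[X in _ + _ *+ X](subn1 n.+1) -sumr_const_nat -big_split/=.
  by apply: eq_bigr => j _; ring.
rewrite [leRHS]mulrDr mulr1 lerD2r.
case: n n0 {nN pos} => // m _; apply: (le_trans (h m)); by rewrite ler_nat.
Qed.

(** Uniform bounds for the partial sums of j^(-1 - eps), by comparison with the
    telescoping sequence j^(-eps) / eps. *)
Lemma sum_power (eps : R) : 0 < eps -> exists2 B, 0 < B &
  forall n, \sum_(1 <= j < n) expR (- (1 + eps) * ln j%:R) <= B.
Proof.
move=> eps0; exists (1 + eps^-1); first by rewrite addr_gt0// invr_gt0.
have ep (n : nat) : 0 <= eps^-1 * expR (- eps * ln n%:R).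
  by rewrite mulr_ge0 ?expR_ge0// invr_ge0 ltW.
have h n : \sum_(1 <= j < n.+2) expR (- (1 + eps) * ln j%:R) <=
    1 + eps^-1 - eps^-1 * expR (- eps * ln n.+1%:R).
  elim: n => [|n IH]; first by rewrite big_nat1 ln1 !mulr0 expR0; lra.
  rewrite big_nat_recr//=.
  suff : expR (- (1 + eps) * ln n.+2%:R) <=
     eps^-1 * expR (- eps * ln n.+1%:R) - eps^-1 * expR (- eps * ln n.+2%:R) by move: IH; lra.
  have -> : expR (- eps * ln n.+1%:R) = expR (- eps * ln n.+2%:R) * expR (eps * (ln n.+2%:R - ln n.+1%:R)).
    by rewrite -expRD; congr expR; ring.
  have -> : expR (- (1 + eps) * ln n.+2%:R) = expR (- eps * ln n.+2%:R) * (n.+2%:R)^-1.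
    have <- : expR (- ln n.+2%:R) = (n.+2%:R)^-1 :> R by rewrite expRN lnK// posrE ltr0n.
    rewrite -expRD.
    by congr expR; ring.
  set E := expR (- eps * ln n.+2%:R); have E0 : 0 < E by exact: expR_gt0.
  have h1 := expR_ge1Dx (eps * (ln n.+2%:R - ln n.+1%:R)).
  have h2 : eps * (n.+2%:R)^-1 <= eps * (ln n.+2%:R - ln n.+1%:R) by rewrite ler_pM2l// ln_succ_ge.
  rewrite -mulrBr -[X in _ <= _ * (_ - X)]mulr1 -mulrBr mulrCA ler_pM2l//.
  by rewrite ler_pdivlMl//; apply: (le_trans h2); rewrite lerBrDl.
move=> [|[|n]]; [by rewrite big_geq//; have := ep 1%N; rewrite ln1 mulr0 expR0; lra| |].
  by rewrite big_geq//; have := ep 1%N; rewrite ln1 mulr0 expR0; lra.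
by apply: (le_trans (h n)); have := ep n.+1; lra.
Qed.

End sums.

Section integrals.
Context {R : realType}.
Variables (f : R -> R) (K T : R).
Hypothesis mf : measurable_fun (`[1, +oo[ : set R) f.
Hypothesis f0 : forall t, 1 <= t -> 0 <= f t.
Hypothesis T1 : 1 <= T.
Hypothesis K0 : 0 < K.
Hypothesis fK : forall s t, T <= s -> s <= t -> f t <= K * f s.
Local Notation mu := (@lebesgue_measure R).

Lemma measurable_ge1 (A : set R) : measurable A -> A `<=` `[1, +oo[ ->
  measurable_fun A (fun x => (f x)%:E).
Proof.
move=> mA A1; apply/measurable_EFinP; apply: measurable_funS A1 mf => //.
Qed.

Lemma itv_ge1 (a b : R) : 1 <= a -> `]a, b]%classic `<=` (`[1, +oo[%classic : set R).
Proof. by move=> a1 x /= /itvP h; rewrite in_itv/= andbT (le_trans a1)// h. Qed.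

(** An almost nonincreasing function is at least f b / K on an interval ending
    at b; this is what turns sums into integrals. *)
Lemma integral_itv_ge (a b : R) : T <= a -> a <= b ->
  (((b - a) * f b)%:E <= K%:E * \int[mu]_(x in `]a, b]) (f x)%:E)%E.
Proof.
move=> Ta ab; have a1 : 1 <= a by exact: le_trans Ta.
have fb : 0 <= f b by apply: f0; exact: le_trans ab.
have -> : (((b - a) * f b)%:E = K%:E * (\int[mu]_(x in `]a, b]) (f b / K)%:E))%E.
  rewrite integral_cst//= lebesgue_measure_itv/= lte_fin.
  case: ifP => h; last first.
    have -> : b = a by apply/eqP; rewrite eq_le ab leNgt h.
    by rewrite subrr mul0r !mule0.
  by rewrite -EFinB -!EFinM; congr EFin; field; rewrite gt_eqF.
rewrite lee_pmul2l//; apply: ge0_le_integral => //.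
- by move=> x _; rewrite lee_fin divr_ge0// ltW.
- by apply: measurable_ge1 => //; exact: itv_ge1.
- move=> x /= /itvP h; rewrite lee_fin ler_pdivrMr// mulrC fK ?h//.
  by rewrite (le_trans Ta)// h.
Qed.

Lemma integral_itv_le (a b : R) : T <= a -> a <= b ->
  (\int[mu]_(x in `[a, b]) (f x)%:E <= ((b - a) * (K * f a))%:E)%E.
Proof.
move=> Ta ab; have a1 : 1 <= a by exact: le_trans Ta.
have fa : 0 <= f a by exact: f0.
apply: (@le_trans _ _ (\int[mu]_(x in `[a, b]) (K * f a)%:E)%E).
  apply: ge0_le_integral => //.
  - by move=> x /= /itvP h; rewrite lee_fin f0// (le_trans a1)// h.
  - apply: measurable_ge1 => //; move=> x /= /itvP h.
    by rewrite in_itv/= andbT (le_trans a1)// h.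
  - by move=> x /= /itvP h; rewrite lee_fin fK// h.
rewrite integral_cst//= lebesgue_measure_itv/= lte_fin.
case: ifP => h; first by rewrite -EFinB -EFinM mulrC.
by rewrite mule0 lee_fin mulr_ge0 ?subr_ge0// mulr_ge0// ltW.
Qed.

Lemma integral_itv_split (a b c : R) : 1 <= a -> a <= b -> b <= c ->
  (\int[mu]_(x in `]a, c]) (f x)%:E =
   \int[mu]_(x in `]a, b]) (f x)%:E + \int[mu]_(x in `]b, c]) (f x)%:E)%E.
Proof.
move=> a1 ab bc.
have -> : `]a, c]%classic = (`]a, b] `|` `]b, c])%classic :> set R.
  apply/seteqP; split => x /=; rewrite !in_itv/=.
    by move=> /andP[ax xc]; have [xb|bx] := leP x b; [left|right]; rewrite ?ax ?xc.
  by move=> [/andP[ax xb]|/andP[bx ->]]; rewrite ?ax ?(le_trans xb)//= (le_lt_trans ab bx).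
rewrite ge0_integral_setU//.
- by apply: measurable_ge1; [exact: measurableU|rewrite subUset; split; apply: itv_ge1 => //; exact: le_trans ab].
- by move=> x [] /= /itvP h; rewrite lee_fin f0// (le_trans a1)// ?h// (le_trans ab)// h.
- apply/disj_setPS => x [/=]; rewrite !in_itv/= => /andP[_ xb] /andP[bx _].
  by move: (le_lt_trans xb bx); rewrite ltxx.
Qed.

Lemma sum_le_integral (m n : nat) : T <= m%:R -> (m <= n)%N ->
  ((\sum_(m.+1 <= j < n.+1) f j%:R)%:E <= K%:E * \int[mu]_(x in `]m%:R, n%:R]) (f x)%:E)%E.
Proof.
move=> Tm; elim: n => [|n IH] mn.
  by rewrite big_geq// mule_ge0 ?lee_fin ?(ltW K0)//; apply: integral_ge0 => x /= /itvP h;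
   rewrite lee_fin f0// (le_trans T1)// (le_trans Tm)// h.
move: mn; rewrite leq_eqVlt => /orP[/eqP mn|].
  rewrite mn big_geq// mule_ge0 ?lee_fin ?(ltW K0)//; apply: integral_ge0 => x /= /itvP h.
  by rewrite lee_fin f0// (le_trans T1)// (le_trans Tm)// mn h.
rewrite ltnS => mn.
have m1 : 1 <= m%:R :> R by exact: le_trans Tm.
have mn' : m%:R <= n%:R :> R by rewrite ler_nat.
have nn' : n%:R <= n.+1%:R :> R by rewrite ler_nat.
rewrite big_nat_recr ?ltnS//= (integral_itv_split m1 mn' nn').
rewrite muleDr//; last first.
  by apply: ge0_adde_def; rewrite inE; apply: integral_ge0 => x /= /itvP h; rewrite lee_fin f0// (le_trans m1)// ?h// (le_trans mn')// h.
rewrite EFinD; apply: leeD; first exact: IH.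
have := @integral_itv_ge n%:R n.+1%:R (le_trans Tm mn') nn'.
by rewrite -[X in X - _]natr1 addrAC subrr add0r mul1r.
Qed.

(** Passes from extended real bounds over A to real integrals over a larger set
    B, where finiteness is known. *)
Lemma le_Rintegral_of_sub (A B : set R) (c x : R) : measurable A -> measurable B ->
  A `<=` B -> B `<=` `[1, +oo[ -> 0 < c ->
  (\int[mu]_(x in B) (f x)%:E < +oo)%E ->
  (x%:E <= c%:E * \int[mu]_(x in A) (f x)%:E)%E -> x <= c * \int[mu]_(x in B) f x.
Proof.
move=> mA mB AB B1 c0 fin h.
have B0 : (0 <= \int[mu]_(x in B) (f x)%:E)%E.
  by apply: integral_ge0 => y /B1; rewrite /= in_itv/= andbT lee_fin => /f0.
rewrite /Rintegral -lee_fin EFinM fineK; last by rewrite ge0_fin_numE.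
apply: (le_trans h); rewrite lee_pmul2l//.
apply: ge0_subset_integral => //; first exact: measurable_ge1.
by move=> y /B1; rewrite /= in_itv/= andbT lee_fin => /f0.
Qed.

Lemma integral_tail_finite (m : nat) (S : R) : T <= m%:R ->
  (forall n, \sum_(m <= j < n) f j%:R <= S) ->
  (\int[mu]_(x in `[m%:R, +oo[) (f x)%:E < +oo)%E.
Proof.
move=> Tm hS.
have m1 : 1 <= m%:R :> R by exact: le_trans Tm.
pose F (n : nat) : set R := `[(m + n)%:R, (m + n).+1%:R[%classic.
have mn n : m%:R <= (m + n)%:R :> R by rewrite ler_nat leq_addr.
have F1 n x : F n x -> 1 <= x.
  by move=> /= /itvP h; rewrite (le_trans m1)// (le_trans (mn n))// h.
have UE : `[m%:R, +oo[%classic = \bigcup_n F n.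
  apply/seteqP; split => x.
    rewrite /= in_itv/= andbT => mx.
    have x0 : 0 <= x by rewrite (le_trans _ mx).
    have /andP[c1 c2] := truncn_itv x0.
    exists (Num.truncn x - m)%N => //=.
    have mt : (m <= Num.truncn x)%N.
      by rewrite -ltnS -(ltr_nat R); exact: le_lt_trans mx c2.
    by rewrite /F /= in_itv/= subnKC// c1.
  move=> [n _] /= /itvP h; rewrite in_itv/= andbT (le_trans (mn n))// h//.
rewrite UE ge0_integral_bigcup//; last 4 first.
- by move=> n; exact: measurable_itv.
- apply: measurable_ge1; first by apply: bigcup_measurable => n _; exact: measurable_itv.
  by move=> x [n _ /F1]; rewrite /= in_itv/= andbT.
- by move=> x [n _ /F1 x1]; rewrite lee_fin f0.
- apply/trivIsetP => i j _ _ ij; rewrite -subset0 => x [/= /itvP h1 /itvP h2].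
  have aux a b : (m + a)%:R <= x -> x < (m + b).+1%:R -> (a <= b)%N.
    by move=> u v; have := le_lt_trans u v; rewrite ltr_nat ltnS leq_add2l.
  by move/eqP: ij; apply; apply/eqP; rewrite eqn_leq !aux ?h1 ?h2.
(* Each unit interval contributes at most K times the value at its left end. *)
apply: (@le_lt_trans _ _ (K * S)%:E); last exact: ltry.
apply: lime_le.
  by apply: is_cvg_nneseries => n _ _; apply: integral_ge0 => x /F1 x1; rewrite lee_fin f0.
apply: nearW => n.
apply: (@le_trans _ _ (\sum_(0 <= i < n) (K * f (m + i)%:R)%:E)%E).
  apply: lee_sum => i _.
  have ii : (m + i)%:R <= (m + i).+1%:R :> R by rewrite ler_nat.
  apply: (@le_trans _ _ (\int[mu]_(x in `[(m + i)%:R, (m + i).+1%:R]) (f x)%:E)%E).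
    apply: ge0_subset_integral => //.
    - exact: measurable_itv.
    - apply: (@measurable_ge1 `[(m + i)%:R, (m + i).+1%:R]%classic) => // x /= /itvP h.
      by rewrite in_itv/= andbT (le_trans m1)// (le_trans (mn i))// h.
    - by move=> x /= /itvP h; rewrite lee_fin f0// (le_trans m1)// (le_trans (mn i))// h.
    - by move=> x /= /itvP h; rewrite in_itv/= !h.
  have := integral_itv_le (le_trans Tm (mn i)) ii.
  by rewrite -[X in X - _]natr1 addrAC subrr add0r mul1r.
rewrite sumEFin lee_fin -mulr_sumr ler_pM2l//.
apply: le_trans (hS (m + n)%N).
suff -> : \sum_(m <= j < m + n) f j%:R = \sum_(0 <= i < n) f (m + i)%:R by [].
rewrite -{1}[m]add0n big_addn [(m + n)%N]addnC addnK.
by apply: eq_bigr => i _; rewrite addnC.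
Qed.

End integrals.

(** * Bounds with and without a cut *)

Section heads.
Context {R : realType}.
Implicit Types (logM f C D : R -> R) (tail : nat -> R).

(** The logarithmic cost of the steps from J to n at radius r; in the
    application f is sqrt(d_l d_phi), that is, D^(-1/2). *)
Definition head_sum f (K r : R) (J n : nat) : R :=
  \sum_(J <= j < n.+1) ln (1 + K * (Num.sqrt r * f j%:R)).

(** The main estimate before the choice of the index n. The constant K0 inside
    the logarithms and the threshold J come first; the sum may then be started
    at any later index J1, at the price of other outer constants. *)
Definition cut_bound logM f tail := exists K0 J, 1 <= K0 /\
  forall J1, (J <= J1)%N -> exists K1 N, [/\ 1 <= K1, (J1 <= N)%N &
  forall r n, 1 <= r -> (N <= n)%N ->
  logM r <= K1 * (1 + ln r + ln n%:R) + 2 * head_sum f K0 r J1 n + K1 * (r * tail n)].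

(** The counterpart of the bound with a cut when nothing is cut off: S is any
    uniform bound for the head sums. *)
Definition full_bound logM f := exists K0 J, 1 <= K0 /\
  forall J1, (J <= J1)%N -> exists K1 R0, [/\ 1 <= K1, 1 <= R0 &
  forall r S, R0 <= r -> (forall n, (J1 <= n)%N -> 2 * head_sum f K0 r J1 n <= S) ->
  logM r <= K1 * (1 + ln r) + S].

Section positive.
Variable f : R -> R.
Hypothesis f0 : forall t, 1 <= t -> 0 < f t.

Let fj_gt0 J j : (1 <= J)%N -> (J <= j)%N -> 0 < f j%:R.
Proof. by move=> J1 Jj; apply: f0; rewrite ler1n (leq_trans J1). Qed.

Lemma head_term_ge0 K r J j : (1 <= J)%N -> 0 <= K -> (J <= j)%N -> 0 <= K * (Num.sqrt r * f j%:R).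
Proof. by move=> J1 K0 Jj; rewrite !mulr_ge0 ?sqrtr_ge0// ltW// (fj_gt0 J1). Qed.

Lemma head_sum_leK K K' r J n : (1 <= J)%N -> 0 <= K -> K <= K' ->
  head_sum f K r J n <= head_sum f K' r J n.
Proof.
move=> J1 K0 KK; apply: ler_sum_nat => j /andP[Jj _].
apply: ln1p_le; first exact: (head_term_ge0 _ J1).
by rewrite ler_wpM2r// mulr_ge0 ?sqrtr_ge0// ltW// (fj_gt0 J1).
Qed.

Lemma head_sum_widen K r J n n' : (1 <= J)%N -> 0 <= K -> (n <= n')%N ->
  head_sum f K r J n <= head_sum f K r J n'.
Proof.
move=> J1 K0 nn; apply: ler_sum_widen => // j Jj.
by rewrite ln_ge0// lerDl (head_term_ge0 _ J1).
Qed.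

(** The linear bound log(1 + x) <= x, adequate for the terms with r <= D. *)
Lemma head_sum_le_sum K r J n : 0 <= K -> (1 <= J)%N ->
  head_sum f K r J n <= K * (Num.sqrt r * \sum_(J <= j < n.+1) f j%:R).
Proof.
move=> K0 J1; rewrite !mulr_sumr; apply: ler_sum_nat => j /andP[Jj _].
by apply: le_ln1Dx; apply: (@lt_le_trans _ _ 0); rewrite ?ltrN10 ?(head_term_ge0 _ J1).
Qed.

(** Each of the finitely many dropped terms is O(1 + log r). *)
Lemma head_sum_shift (K : R) J J1 : 1 <= K -> (1 <= J)%N ->
  (J <= J1)%N -> exists2 Kc, 0 <= Kc & forall r n, 1 <= r -> (J1 <= n)%N ->
  head_sum f K r J n <= Kc * (1 + ln r) + head_sum f K r J1 n.
Proof.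
move=> K1 J1' JJ1; have K0 : 0 <= K by lra.
pose c := \sum_(J <= j < J1) ln (1 + K * f j%:R).
have kf j : (J <= j)%N -> 0 <= K * f j%:R by move=> h; rewrite mulr_ge0// ltW// (fj_gt0 J1').
have c0 : 0 <= c.
  by rewrite /c big_nat sumr_ge0// => j /andP[Jj _]; rewrite ln_ge0// lerDl kf.
exists (c + (J1 - J)%:R); first by rewrite addr_ge0.
move=> r n r1 J1n; have lr : 0 <= ln r by rewrite ln_ge0.
rewrite /head_sum (big_cat_nat (n := J1))//=; last exact: leqW.
rewrite lerD2r.
apply: (@le_trans _ _ (\sum_(J <= j < J1) (ln (1 + K * f j%:R) + ln r))).
  apply: ler_sum_nat => j /andP[Jj _]; have := kf _ Jj => h.
  rewrite -lnM ?posrE; [|lra|lra].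
  have -> : K * (Num.sqrt r * f j%:R) = Num.sqrt r * (K * f j%:R) by ring.
  have := sqrtr_le_self r1; have := sqrtr_ge0 r; move: (K * _) h => u u0 s0 sr.
  have : Num.sqrt r * u <= r * u by rewrite ler_wpM2r.
  by move: (Num.sqrt r * u) (mulr_ge0 s0 u0) => v v0 vr; rewrite ler_ln ?posrE; nra.
rewrite big_split/= sumr_const_nat -/c -mulr_natl.
by have := ler0n R (J1 - J); clear -c0 lr; nra.
Qed.

Lemma cut_bound_shift logM tail : (forall n, 0 <= tail n) ->
  (exists K J N, [/\ 1 <= K, (1 <= J)%N & forall r n, 1 <= r -> (N <= n)%N ->
     logM r <= K * (1 + ln r + ln n%:R) + 2 * head_sum f K r J n + K * (r * tail n)]) ->
  cut_bound logM f tail.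
Proof.
move=> t0 [K [J [N [K1 J1 H]]]]; exists K, J; split => // J' JJ'.
have [Kc Kc0 hKc] := head_sum_shift K1 J1 JJ'.
exists (K + 2 * Kc), (maxn J' N); split; [lra|exact: leq_maxl|].
move=> r n r1; rewrite geq_max => /andP[J'n Nn].
apply: (le_trans (H r n r1 Nn)); have := hKc r n r1 J'n.
have n1 : 1 <= n%:R :> R by rewrite ler1n (leq_trans J1)// (leq_trans JJ').
have rt : 0 <= Kc * (r * tail n) by rewrite !mulr_ge0//; lra.
have p : 0 <= Kc * ln n%:R by rewrite mulr_ge0// ln_ge0.
move: (head_sum _ _ _ _ _) (head_sum _ _ _ _ _) => s1 s2; clear -rt p; lra.
Qed.

Lemma full_bound_shift logM :
  (exists K J, [/\ 1 <= K, (1 <= J)%N & forall r S, 1 <= r ->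
     (forall n, (J <= n)%N -> 2 * head_sum f K r J n <= S) -> logM r <= K * (1 + ln r) + S]) ->
  full_bound logM f.
Proof.
move=> [K [J [K1 J1 H]]]; exists K, J; split => // J' JJ'.
have [Kc Kc0 hKc] := head_sum_shift K1 J1 JJ'.
exists (K + 2 * Kc), 1; split; [lra|by []|].
move=> r S r1 hS; have K0 : 0 <= K by lra.
have : logM r <= K * (1 + ln r) + (2 * Kc * (1 + ln r) + S); last by lra.
apply: H => // n Jn.
have mono := head_sum_widen r J1 K0 (leq_maxr J' n).
have := hKc r (maxn J' n) r1 (leq_maxl _ _); have := hS (maxn J' n) (leq_maxl _ _).
by move: mono; move: (head_sum _ _ _ _ _) (head_sum _ _ _ _ _) (head_sum _ _ _ _ _) => s1 s2 s3; lra.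
Qed.

End positive.

(** When gamma is positive the tail r / C(n) is bounded for n about r^(2 /
    gamma), where log n is still O(log r). *)
Lemma full_bound_of_cut logM f C gamma : (forall t, 1 <= t -> 0 < C t) ->
  cut_bound logM f (fun n => 1 / C n%:R) -> potter C gamma -> 0 < gamma ->
  full_bound logM f.
Proof.
move=> C0 [K0 [J [K01 H]]] Cp g0; exists K0, (maxn 1 J); split => // J1 JJ1.
have [h0 h1] : (1 <= J1)%N /\ (J <= J1)%N by apply/andP; rewrite -geq_max.
have [K1 [N [K11 J1N hN]]] := H J1 h1.
have g2 : 0 < gamma / 2 by lra.
have [T T1 hT] := potter_power Cp g2.
have gi : 0 < 2 / gamma by rewrite divr_gt0.
pose M := Num.max T N.+1%:R.
have [R0 R01 hR0] := ln_near_ge (gamma / 2 * ln M).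
have M0 : 0 < M by rewrite lt_max (lt_le_trans ltr01).
exists (K1 * (3 + 2 / gamma)), R0; split => //.
  by rewrite -[leLHS]mulr1; apply: ler_pM => //; clear -gi; lra.
move=> r S hr hS; have r1 : 1 <= r by exact: le_trans hr.
have lr : 0 <= ln r by rewrite ln_ge0.
(* C(n) has exponent at least gamma / 2 and v = r^(2 / gamma), so r / C(n) <=
   1. *)
pose v := expR (2 / gamma * ln r); pose n := (Num.truncn v).+1.
have v1 : 1 <= v by rewrite -[leLHS]expR0 ler_expR mulr_ge0// ltW.
have vn : v <= n%:R by apply: ltW; exact: truncnS_gt.
have nv : n%:R <= 2 * v.
  have /andP[h _] := truncn_itv (le_trans ler01 v1).
  by rewrite /n -natr1; clear -h v1; lra.
have Mv : M <= v.
  rewrite -[leLHS]lnK ?posrE// ler_expR -ler_pdivrMl// invfM invrK [_ * gamma]mulrC.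
  exact: hR0.
have /andP[Tn Nn] : (T <= n%:R) && (N.+1%:R <= n%:R :> R) by rewrite -ge_max; exact: le_trans vn.
have Nn' : (N <= n)%N by rewrite -(ler_nat R); apply: le_trans Nn; rewrite ler_nat.
have n0 : 0 < n%:R :> R by rewrite ltr0n.
have lnn : ln n%:R <= 1 + 2 / gamma * ln r.
  apply: (@le_trans _ _ (ln (2 * v))); first by rewrite ler_ln ?posrE// mulr_gt0// expR_gt0.
  by rewrite lnM ?posrE ?expR_gt0// /v expRK lerD2r ln2_le1.
have rC : r / C n%:R <= 1.
  have n1 : 1 <= n%:R :> R by exact: le_trans vn.
  have r0 : 0 < r by exact: lt_le_trans r1.
  rewrite ler_pdivrMr ?C0// mul1r -ler_ln ?posrE ?C0//.
  have := hT _ Tn; rewrite ler_norml => /andP[h _].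
  have : 2 / gamma * ln r <= ln n%:R by rewrite -[leLHS]expRK ler_ln ?posrE ?expR_gt0.
  by rewrite -ler_pdivlMl// invfM invrK => h2; clear -h h2; lra.
apply: (le_trans (hN r n r1 Nn')).
have := hS n (leq_trans J1N Nn').
rewrite mul1r; move: (head_sum _ _ _ _ _) => s hs.
have e1 : K1 * (r / C n%:R) <= K1 by rewrite ler_piMr//; clear -K11; lra.
have e2 : K1 * ln n%:R <= K1 * (1 + 2 / gamma * ln r) by rewrite ler_wpM2l//; clear -K11; lra.
have e3 : 0 <= K1 * ((2 / gamma) + 2 * ln r) by rewrite mulr_ge0//; clear -gi lr K11; lra.
by clear -e1 e2 e3 hs; lra.
Qed.

(** With N comparable to n and r at most A y^2 D(N), the Potter bound for D
    gives r / D(j) <= A' y^2 (N / j)^(delta + 1), so that the term of index j is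
    O(1 + log y + log(N / j)); the last part is bounded on average by
    [sum_ln_ratio]. *)
Lemma head_sum_log f D delta : (forall t, 1 <= t -> 0 < D t) -> (forall t, 1 <= t -> 0 < f t) ->
  (forall t, 1 <= t -> ln (f t) = - ln (D t) / 2) -> potter D delta -> 0 <= delta ->
  forall K0 A, 1 <= K0 -> 1 <= A -> exists K1 J2, [/\ 1 <= K1, (1 <= J2)%N &
  forall (J1 n : nat) (N y r : R), (J2 <= J1)%N -> (J1 <= n)%N -> N / 2 <= n%:R -> n%:R <= N ->
  1 <= y -> 0 < r -> r <= A * y ^+ 2 * D N ->
  head_sum f K0 r J1 n <= K1 * (n%:R * (1 + ln y))].
Proof.
move=> D0 f0 lnf Dp d0 K0 A K01 A1.
have [K [T T1 hT]] := Dp 1 ltr01.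
have lK0 : 0 <= ln K0 by rewrite ln_ge0.
have lA : 0 <= ln A by rewrite ln_ge0.
have K00 : 0 < K0 by exact: lt_le_trans K01.
have A0 : 0 < A by exact: lt_le_trans A1.
pose c := 1 + ln K0 + ln A / 2 + `|K| / 2.
have c1 : 1 <= c by rewrite /c; have := normr_ge0 K; clear -lK0 lA; lra.
exists (c + (delta + 1)), (Num.truncn T).+1; split => //; first by clear -c1 d0; lra.
move=> J1 n N y r TJ1 J1n Nn nN y1 r0 hr.
have J10 : (0 < J1)%N by exact: leq_trans TJ1.
have n0 : (0 < n)%N by exact: leq_trans J1n.
have ly : 0 <= ln y by rewrite ln_ge0.
have n1 : 1 <= n%:R :> R by rewrite ler1n.
have N1 : 1 <= N by exact: le_trans nN.
have y0 : 0 < y by exact: lt_le_trans y1.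
have lnr : ln r <= ln A + 2 * ln y + ln (D N).
  have y2 : 0 < y ^+ 2 by rewrite exprn_gt0.
  have Ay := mulr_gt0 A0 y2; have DN := D0 _ N1.
  have <- : ln (A * y ^+ 2 * D N) = ln A + 2 * ln y + ln (D N).
    by rewrite lnM ?posrE// lnM ?posrE// expr2 lnM ?posrE//; clear; ring.
  by rewrite ler_ln ?posrE// mulr_gt0.
apply: (@le_trans _ _ (\sum_(J1 <= j < n.+1) ((c + ln y) + (delta + 1) / 2 * (ln N - ln j%:R)))).
  apply: ler_sum_nat => j /andP[J1j jn].
  have Tj : T <= j%:R by apply: natr_ge_truncn; exact: leq_trans J1j.
  have jN : j%:R <= N by apply: le_trans nN; rewrite ler_nat -ltnS.
  have j1 : 1 <= j%:R :> R by exact: le_trans Tj.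
  have dN : 0 <= (delta + 1) * (ln N - ln j%:R).
    by apply: mulr_ge0; [exact: addr_ge0|rewrite subr_ge0 ler_ln ?posrE ?(lt_le_trans ltr01)].
  have sf : 0 < Num.sqrt r * f j%:R by rewrite mulr_gt0 ?sqrtr_gt0// f0.
  apply: (le_trans (ln1p_le_max (B := c - 1 + ln y + (delta + 1) / 2 * (ln N - ln j%:R)) _ _ _)).
  - exact: mulr_gt0.
  - by clear -c1 ly dN; lra.
  - rewrite lnM ?posrE// lnM ?posrE ?sqrtr_gt0 ?f0// ln_sqrt// lnf//.
    have := hT _ _ Tj jN; rewrite ler_norml => /andP[_ h].
    by rewrite /c; have := ler_norm K; clear -h lnr; lra.
  - by clear; lra.
rewrite big_split/= sumr_const_nat -mulr_sumr -mulr_natl.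
have := sum_ln_ratio J10 n0 nN.
have lNn : ln N - ln n%:R <= 1.
  have n00 : 0 < n%:R :> R by rewrite ltr0n.
  apply: le_trans ln2_le1; rewrite lerBlDr -lnM ?posrE// ler_ln ?posrE ?mulr_gt0//.
    by clear -Nn; lra.
  exact: lt_le_trans nN.
have h1 : (n.+1 - J1)%:R <= n%:R :> R by rewrite ler_nat leq_subLR; exact: (leq_add J10 (leqnn n)).
have h2 : (n.+1 - J1)%:R * (c + ln y) <= n%:R * (c + ln y) by rewrite ler_wpM2r//; clear -c1 ly; lra.
have h3 : n%:R * (1 + (ln N - ln n%:R)) <= n%:R * 2 by rewrite ler_wpM2l//; clear -lNn; lra.
move: (\sum_(_ <= _ < _) _) => s hs.
have h4 : (delta + 1) / 2 * s <= (delta + 1) / 2 * (n%:R * 2).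
  by rewrite ler_wpM2l//; clear -d0 hs h3; lra.
have h6 : 0 <= (c + delta) * (n%:R * ln y).
  by rewrite !mulr_ge0//; clear -c1 d0; lra.
by clear -h2 h4 h6; lra.
Qed.

End heads.

(** * The choice of the weights *)

Section weights.
Context {R : realType}.

(** For q = d_phi / d_l the weight sqrt(q / r) makes the length cost r l b and
    the rotation cost |sin| / b of the same order x. Where the weight is cut at
    1 the length cost is only smaller and there is no rotation to pay. *)
Lemma weight_costs (r K A q gl gp lj sj : R) : 1 <= r -> 0 < q -> 0 < gl -> 1 <= K -> 1 <= A ->
  gp <= A * (q * gl) -> 0 <= lj -> lj <= K * gl -> sj <= K * gp ->
  let b := Num.min 1 (Num.sqrt (q / r)) in
  let x := gl * Num.sqrt (q * r) in
  [/\ 0 < b, b <= 1, r * (lj * b) <= (K * A) * x, b < 1 -> sj <= K * A * x * b & 0 <= x].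
Proof.
move=> r1 q0 gl0 K1 A1 gpq lj0 ljK sjK b x.
have r0 : 0 < r by lra.
have s0 : 0 < Num.sqrt (q / r) by rewrite sqrtr_gt0 divr_gt0.
have qr0 : 0 < q * r by rewrite mulr_gt0.
have rs : r * Num.sqrt (q / r) = Num.sqrt (q * r).
  rewrite -[X in X * _ = _]gtr0_norm// -sqrtr_sqr -sqrtrM ?sqr_ge0//.
  by congr Num.sqrt; field; rewrite gt_eqF.
have sx : Num.sqrt (q * r) * Num.sqrt (q / r) = q.
  rewrite -sqrtrM ?(ltW qr0)// (_ : q * r * (q / r) = q ^+ 2); first by rewrite sqrtr_sqr gtr0_norm.
  by field; rewrite gt_eqF.
have x0 : 0 <= x by rewrite mulr_ge0 ?sqrtr_ge0// ltW.
have b0 : 0 < b by rewrite lt_min ltr01.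
have KA : K <= K * A by rewrite ler_peMr//; lra.
split => //; first by rewrite ge_min lexx.
  have bs : b <= Num.sqrt (q / r) by rewrite ge_min lexx orbT.
  have h1 : lj * b <= K * gl * Num.sqrt (q / r).
    by apply: ler_pM => //; exact: ltW.
  apply: (le_trans (ler_wpM2l (ltW r0) h1)).
  have -> : r * (K * gl * Num.sqrt (q / r)) = K * x by rewrite /x -rs; ring.
  exact: ler_wpM2r.
rewrite /b; case: (leP 1 (Num.sqrt (q / r))) => h; first by rewrite ltxx.
move=> _; apply: (le_trans sjK).
have e : x * Num.sqrt (q / r) = q * gl by rewrite /x -mulrA sx mulrC.
by rewrite -[leRHS]mulrA e -mulrA ler_wpM2l//; lra.
Qed.

Lemma ln_weight (q r : R) : 0 < q -> 0 < r ->
  - ln (Num.min 1 (Num.sqrt (q / r))) <= (`|ln q| + `|ln r|) / 2.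
Proof.
move=> q0 r0; have h0 := normr_ge0 (ln q); have h1 := normr_ge0 (ln r).
case: (leP 1 (Num.sqrt (q / r))) => h; first by rewrite ln1; lra.
rewrite ln_sqrt ?divr_gt0// lnM ?posrE ?invr_gt0// lnV ?posrE//.
have := ler_norm (- ln q); have := ler_norm (ln r); rewrite normrN; lra.
Qed.

(** The balanced cost is sqrt(r d_l d_phi), even if q is only comparable with
    d_phi / d_l. *)
Lemma sqrt_cost (r gl gp dl dp q A : R) : 0 <= r -> 0 < gl -> 0 < q -> 1 <= A ->
  gl <= 2 * dl -> gp <= 2 * dp -> q * gl <= A * gp ->
  gl * Num.sqrt (q * r) <= 2 * A * (Num.sqrt r * Num.sqrt (dl * dp)).
Proof.
move=> r0 gl0 q0 A1 h1 h2 h3; have A0 : 0 <= 2 * A by move: A1; drop_facts; lra.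
have qg : 0 < q * gl by rewrite mulr_gt0.
rewrite [q * r]mulrC sqrtrM// [leLHS]mulrCA [leRHS]mulrCA ler_wpM2l ?sqrtr_ge0//.
rewrite -{1}[gl](gtr0_norm gl0) -sqrtr_sqr -sqrtrM ?sqr_ge0//.
rewrite -[2 * A](ger0_norm A0) -sqrtr_sqr -sqrtrM ?sqr_ge0// ler_wsqrtr//.
have -> : gl ^+ 2 * q = gl * (q * gl) by ring.
have h4 : q * gl <= 2 * A * dp.
  by apply: (le_trans h3); rewrite [2 * A]mulrC -mulrA ler_wpM2l//; move: A1; drop_facts; lra.
apply: (@le_trans _ _ (2 * dl * (2 * A * dp))).
  by apply: ler_pM => //; exact: ltW.
have dp0 : 0 <= 2 * A * dp by exact: le_trans (ltW qg) h4.
have -> : (2 * A) ^+ 2 * (dl * dp) = 2 * dl * (2 * A * dp) * A by ring.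
by rewrite ler_peMr// mulr_ge0//; move: gl0 h1; drop_facts; lra.
Qed.

Lemma ln_comparable (x y : R) : 0 < x -> 0 < y -> y / 2 <= x -> x <= 2 * y ->
  `|ln y| <= `|ln x| + 1.
Proof.
move=> x0 y0 h1 h2.
have e1 : ln y <= ln x + 1.
  apply: (@le_trans _ _ (ln (2 * x))); first by rewrite ler_ln ?posrE ?mulr_gt0//; lra.
  by rewrite lnM ?posrE// addrC lerD2l ln2_le1.
have e2 : ln x <= ln y + 1.
  apply: (@le_trans _ _ (ln (2 * y))); first by rewrite ler_ln ?posrE ?mulr_gt0//; lra.
  by rewrite lnM ?posrE// addrC lerD2l ln2_le1.
have := ler_norm (ln x); have := ler_norm (- ln x); rewrite normrN ler_norml => k1 k2.
by apply/andP; split; lra.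
Qed.

(** The weight making b' c_l and c_phi / b' equal up to constants; the constant
    c with c_phi <= c c_l keeps it at most 1. *)
Lemma balanced_weight (cl cp c : R) : 0 < cl -> 0 < cp -> 1 <= c -> cp <= c * cl ->
  let b := Num.sqrt (cp / (c * cl)) in let Z := Num.sqrt (cl * cp) in
  [/\ 0 < b <= 1, b * cl <= Z, cp / b <= c * Z & - ln b <= `|ln cl| + `|ln cp| + ln c].
Proof.
move=> cl0 cp0 c1 cpc b Z; have c0 : 0 < c by exact: lt_le_trans c1.
have ccl : 0 < c * cl by rewrite mulr_gt0.
have q0 : 0 < cp / (c * cl) by rewrite divr_gt0.
have b0 : 0 < b by rewrite sqrtr_gt0.
split.
- by rewrite b0 -sqrtr1 ler_wsqrtr// ler_pdivrMr// mul1r.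
- rewrite -[X in _ * X <= _](gtr0_norm cl0) -sqrtr_sqr /b -sqrtrM ?(ltW q0)// ler_wsqrtr//.
  have -> : cp / (c * cl) * cl ^+ 2 = (cl * cp) / c by field; rewrite !gt_eqF.
  by rewrite ler_piMr ?invf_le1// mulr_ge0 ?ltW.
- rewrite ler_pdivrMr// -mulrA /Z /b -sqrtrM ?mulr_ge0 ?(ltW cl0) ?(ltW cp0)//.
  rewrite -[X in X * _](gtr0_norm c0) -sqrtr_sqr -sqrtrM ?sqr_ge0//.
  rewrite -[leLHS](gtr0_norm cp0) -sqrtr_sqr ler_wsqrtr//.
  have -> : c ^+ 2 * (cl * cp * (cp / (c * cl))) = c * cp ^+ 2 by field; rewrite !gt_eqF.
  by rewrite ler_peMl ?sqr_ge0.
rewrite /b ln_sqrt// lnM ?posrE ?invr_gt0// lnV ?posrE// lnM ?posrE//.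
have := ler_norm (ln cl); have := ler_norm (- ln cp); rewrite normrN.
have := normr_ge0 (ln cl); have := normr_ge0 (ln cp); have := ln_ge0 c1; drop_facts; lra.
Qed.

Lemma regularly_varying_gt0 (f : R -> R) t : regularly_varying f -> 1 <= t -> 0 < f t.
Proof. by move=> [a fa]; exact: rv_gt0 fa. Qed.

(** Bounds the cost of entering and leaving a weight: its logarithm is O(log n). *)
Lemma rv_ln_bound (f : R -> R) : regularly_varying f -> approx_nonincreasing f ->
  exists K, exists2 T, 1 <= T & forall t : R, T <= t -> `|ln (f t)| <= K * ln t.
Proof.
move=> [a fa] fm; have fp := rv_potter fa (approx_nonincreasing_almost (fun t => rv_gt0 fa) fm).
have [T T1 hT] := potter_power fp ltr01.
exists (`|a| + 1); exists T => // t Tt.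
have -> : ln (f t) = (ln (f t) - a * ln t) + a * ln t by ring.
have l0 : 0 <= ln t by rewrite ln_ge0//; lra.
apply: (le_trans (ler_normD _ _)); rewrite normrM (ger0_norm l0).
by have := hT _ Tt; lra.
Qed.

Lemma initial_cost (l : nat -> R) J : (forall j, (0 < j)%N -> 0 < l j) ->
  exists2 c, 0 <= c & forall r, 1 <= r ->
  ln 4 + \sum_(1 <= j < J.+1) ln (1 + 2 * r * l j) <= c * (1 + ln r).
Proof.
move=> l_gt0; pose S := \sum_(1 <= j < J.+1) ln (1 + 2 * l j).
have S0 : 0 <= S.
  by rewrite /S big_nat sumr_ge0// => j /andP[j1 _]; rewrite ln_ge0// lerDl mulr_ge0// ltW// l_gt0.
have l4 : 0 <= ln 4 :> R by rewrite ln_ge0//; lra.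
exists (ln 4 + S + J%:R); first by rewrite !addr_ge0.
move=> r r1; have lr : 0 <= ln r by rewrite ln_ge0.
suff : \sum_(1 <= j < J.+1) ln (1 + 2 * r * l j) <= J%:R * ln r + S.
  have : 0 <= (ln 4 + S) * ln r by rewrite mulr_ge0// addr_ge0.
  by have := ler0n R J; move: (\sum_(_ <= _ < _) _) => s; drop_facts; lra.
have -> : J%:R * ln r = \sum_(1 <= j < J.+1) ln r by rewrite sumr_const_nat subn1 mulr_natl.
rewrite -big_split/=; apply: ler_sum_nat => j /andP[/l_gt0 lj _].
have r0 : 0 < r by exact: lt_le_trans r1.
have rl : l j <= r * l j by rewrite ler_peMl// ltW.
by rewrite -lnM ?posrE ?ler_ln ?posrE; move: r1 lj rl r0; drop_facts => r1 lj rl r0; nra.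
Qed.

Variables (l phi : nat -> R).
Hypothesis l_gt0 : forall j, (0 < j)%N -> 0 < l j.
Variables (d_l d_phi : R -> R).
Hypothesis d_l_rv : regularly_varying d_l.
Hypothesis d_phi_rv : regularly_varying d_phi.
Hypothesis d_l_mono : approx_nonincreasing d_l.
Hypothesis d_phi_mono : approx_nonincreasing d_phi.
Hypothesis l_bound : lesssim_near \oo l (fun j => d_l j%:R).
Hypothesis phi_bound : lesssim_near \oo (fun j => `|sin (phi j.+1 - phi j)|)
                                  (fun j => d_phi j%:R).

(** Truly nonincreasing sequences gl and gp, comparable with d_l and d_phi, that
    majorize lengths and angle differences. Monotonicity is needed for the
    telescoping factors. *)
Lemma majorants : exists (gl gp : nat -> R) K J, [/\ (1 <= J)%N, 1 <= K,
  forall n, (J <= n)%N -> [/\ 0 < gl n, 0 < gp n, gl n.+1 <= gl n & gp n.+1 <= gp n],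
  forall n, (J <= n)%N -> [/\ l n <= K * gl n, `|sin (phi n.+1 - phi n)| <= K * gp n,
     d_l n%:R <= 2 * gl n /\ gl n <= 2 * d_l n%:R & d_phi n%:R <= 2 * gp n /\ gp n <= 2 * d_phi n%:R] &
  forall n, (J <= n)%N -> `|ln (gl n)| <= K * (1 + ln n%:R) /\ `|ln (gp n)| <= K * (1 + ln n%:R)].
Proof.
have [gl [gl0 glm] [T1 T11 hT1]] := approx_nonincreasing_norm (fun t => regularly_varying_gt0 d_l_rv) d_l_mono.
have [gp [gp0 gpm] [T2 T21 hT2]] := approx_nonincreasing_norm (fun t => regularly_varying_gt0 d_phi_rv) d_phi_mono.
have [K3 [T3 T31 hT3]] := rv_ln_bound d_l_rv d_l_mono.
have [K4 [T4 T41 hT4]] := rv_ln_bound d_phi_rv d_phi_mono.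
have [c1 c10 /near_inftyE[N1 hN1]] := l_bound.
have [c2 c20 /near_inftyE[N2 hN2]] := phi_bound.
pose K := 1 + 2 * c1 + 2 * c2 + `|K3| + `|K4|.
have [Kc1 Kc2 Kk3 Kk4] : [/\ 2 * c1 <= K, 2 * c2 <= K, `|K3| + 1 <= K & `|K4| + 1 <= K].
  by have := normr_ge0 K3; have := normr_ge0 K4; rewrite /K; move: c10 c20; drop_facts => c10 c20; split; lra.
pose J := maxn (maxn N1 N2) (Num.truncn (Num.max (Num.max T1 T2) (Num.max T3 T4))).+1.
exists (fun n => gl n%:R), (fun n => gp n%:R), K, J.
have hJ n : (J <= n)%N -> [/\ (N1 <= n)%N, (N2 <= n)%N, T1 <= n%:R /\ T2 <= n%:R & T3 <= n%:R /\ T4 <= n%:R].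
  rewrite !geq_max => /andP[/andP[-> ->] /natr_ge_truncn].
  by rewrite !ge_max => /andP[/andP[-> ->] /andP[-> ->]].
have lnat n : (J <= n)%N -> 1 <= n%:R :> R by move=> /hJ[_ _ [h _] _]; exact: le_trans h.
have cmp (d g : R -> R) k (t : R) : 1 <= t -> 0 < d t -> 0 < g t -> g t / 2 <= d t /\ d t <= 2 * g t ->
    `|k| + 1 <= K -> `|ln (d t)| <= k * ln t -> `|ln (g t)| <= K * (1 + ln t).
  move=> t1 d0 g0 [h1 h2] kK h3; apply: (le_trans (ln_comparable d0 g0 h1 h2)).
  have lt0 : 0 <= ln t by rewrite ln_ge0.
  have u1 : k * ln t <= `|k| * ln t by rewrite ler_wpM2r// ler_norm.
  have u2 : (`|k| + 1) * (1 + ln t) <= K * (1 + ln t) by rewrite ler_wpM2r// addr_ge0.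
  by have := normr_ge0 k; move: h3 u1 u2 lt0; drop_facts; lra.
split.
- by rewrite leq_max orbC ltnS leq0n.
- by rewrite /K; move: c10 c20; drop_facts => c10 c20; have := normr_ge0 K3; have := normr_ge0 K4; lra.
- move=> n Jn; have n1 := lnat _ Jn; have nS : n%:R <= n.+1%:R :> R by rewrite ler_nat.
  by split; [exact: gl0|exact: gp0|exact: glm|exact: gpm].
- move=> n Jn; have [h1 h2 [h3 h4] _] := hJ _ Jn; have n1 := lnat _ Jn.
  have [u1 u2] := hT1 _ h3; have [v1 v2] := hT2 _ h4.
  have m1 : c1 * d_l n%:R <= c1 * (2 * gl n%:R) by rewrite ler_pM2l.
  have m2 : c2 * d_phi n%:R <= c2 * (2 * gp n%:R) by rewrite ler_pM2l.
  have m3 : 2 * c1 * gl n%:R <= K * gl n%:R by rewrite ler_wpM2r// ltW// gl0.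
  have m4 : 2 * c2 * gp n%:R <= K * gp n%:R by rewrite ler_wpM2r// ltW// gp0.
  have x1 := hN1 _ h1; have x2 := hN2 _ h2.
  by move: u1 u2 v1 v2 m1 m2 m3 m4 x1 x2; drop_facts => u1 u2 v1 v2 m1 m2 m3 m4 x1 x2; split; [lra|lra|split; lra|split; lra].
- move=> n Jn; have n1 := lnat _ Jn; have [_ _ [h3 h4] [h5 h6]] := hJ _ Jn.
  split; [apply: (cmp d_l gl K3)|apply: (cmp d_phi gp K4)] => //.
  + exact: regularly_varying_gt0 d_l_rv n1.
  + exact: gl0.
  + exact: hT1.
  + exact: hT3.
  + exact: regularly_varying_gt0 d_phi_rv n1.
  + exact: gp0.
  + exact: hT2.
  + exact: hT4.
Qed.

(** The hypotheses of the head estimate for the weight min(1, sqrt(q / r)),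
    where q is any sequence comparable with gp / gl. *)
Section weighted_rows.
Variables (f : R -> R) (gl gp q : nat -> R) (K A r : R) (J : nat).
Hypothesis fE : forall t, 1 <= t -> f t = Num.sqrt (d_l t * d_phi t).
Hypothesis J1 : (1 <= J)%N.
Hypothesis K1 : 1 <= K.
Hypothesis A1 : 1 <= A.
Hypothesis r1 : 1 <= r.
Hypothesis hg : forall n, (J <= n)%N -> [/\ 0 < gl n, 0 < gp n, gl n.+1 <= gl n & gp n.+1 <= gp n].
Hypothesis hd : forall n, (J <= n)%N -> [/\ l n <= K * gl n, `|sin (phi n.+1 - phi n)| <= K * gp n,
     d_l n%:R <= 2 * gl n /\ gl n <= 2 * d_l n%:R & d_phi n%:R <= 2 * gp n /\ gp n <= 2 * d_phi n%:R].
Hypothesis hq : forall n, (J <= n)%N ->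
  [/\ 0 < q n, q n * gl n <= A * gp n & gp n <= A * (q n * gl n)].

Let b m := Num.min 1 (Num.sqrt (q m / r)).
Let x m := gl m * Num.sqrt (q m * r).

Let costs m : (J <= m)%N -> [/\ 0 < b m, b m <= 1, r * (l m * b m) <= K * A * x m,
    b m < 1 -> `|sin (phi m.+1 - phi m)| <= K * A * x m * b m & 0 <= x m].
Proof.
move=> Jm; have [g1 _ _ _] := hg Jm; have [d1 d2 _ _] := hd Jm; have [q1 _ q3] := hq Jm.
have lm : 0 <= l m by rewrite ltW// l_gt0// (leq_trans J1).
exact: (weight_costs r1 q1 g1 K1 A1 q3 lm d1 d2).
Qed.

Lemma weight_range m : (J <= m)%N -> 0 < b m /\ b m <= 1.
Proof. by move=> /costs[]. Qed.

Lemma weight_length_cost m : (J <= m)%N -> 0 <= K * A * x m /\ r * (l m * b m) <= K * A * x m.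
Proof.
move=> /costs[_ _ h _ x0]; split => //; apply: mulr_ge0 => //.
by rewrite mulr_ge0// (le_trans ler01).
Qed.

Lemma weight_angle_cost m : (J <= m)%N -> b m < 1 ->
  `|sin (phi m.+1 - phi m)| <= K * A * x m * b m.
Proof. by move=> /costs[]. Qed.

Lemma weight_head_sum K' n : 2 * K * A ^+ 2 <= K' ->
  \sum_(J <= j < n.+1) ln (1 + K * A * x j) <= head_sum f K' r J n.
Proof.
move=> KK; apply: ler_sum_nat => j /andP[Jj _].
have [h1 _ _ _] := hg Jj; have [_ _ [_ d1] [_ d2]] := hd Jj; have [q1 q2 _] := hq Jj.
have [x0 _] := weight_length_cost Jj; apply: ln1p_le => //.
have r0 : 0 <= r by exact: le_trans r1.
have := sqrt_cost r0 h1 q1 A1 d1 d2 q2; rewrite -fE ?ler1n ?(leq_trans J1)//.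
have sf : 0 <= Num.sqrt r * f j%:R.
  by rewrite fE ?ler1n ?(leq_trans J1)// mulr_ge0 ?sqrtr_ge0.
have KA : 0 <= K * A by rewrite mulr_ge0// (le_trans ler01).
move=> /(ler_wpM2l KA) h; apply: (le_trans h).
have := ler_wpM2r sf KK; move: (Num.sqrt r * _) => u; apply: le_trans.
by rewrite le_eqVlt; apply/orP; left; apply/eqP; ring.
Qed.

End weighted_rows.

Variable W : R -> R[i] -> 'M[R[i]]_2.
Hypothesis l_summable : summable_seq l.
Hypothesis W_fund : fundamental_solution (hamburger l phi) (total_length l) W.
Variable f : R -> R.
Hypothesis fE : forall t, 1 <= t -> f t = Num.sqrt (d_l t * d_phi t).
Let logM (r : R) : R := ln (max_norm (W (total_length l)) r).

Let f_gt0 t : 1 <= t -> 0 < f t.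
Proof. by move=> t1; rewrite fE// sqrtr_gt0 mulr_gt0 ?(regularly_varying_gt0 d_l_rv) ?(regularly_varying_gt0 d_phi_rv). Qed.

(** Here q = gp / gl need not be monotone. But b sqrt(gl) is the minimum of
    sqrt(gl) and sqrt(gp / r), hence nonincreasing, so 1 / sqrt(gl) is a
    telescoping factor, and its total cost is O(log n). *)
Lemma head_tail_bound (psi : R) : exists K J, [/\ 1 <= K, (1 <= J)%N &
  forall (r b' TL TP : R) n, 1 <= r -> (J <= n)%N -> 0 < b' <= 1 ->
  tail_sum l n <= TL -> tail_sum (fun j => l j * sin (phi j - psi) ^+ 2) n <= TP ->
  logM r <= K * (1 + ln r + ln n%:R) + 2 * head_sum f K r J n +
    (- ln b' + r * (b' * TL + TP / b'))].
Proof.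
have [gl [gp [K [J [J1 K1 hg hd hln]]]]] := majorants.
have [c c0 init] := initial_cost J l_gt0.
pose K' := c + 2 * K + 1.
exists K', J; split => //; first by rewrite /K'; move: c0 K1; drop_facts; lra.
move=> r b' TL TP n r1 Jn b'1 hTL hTP.
have r0 : 0 < r by exact: lt_le_trans r1.
pose q m := gp m / gl m.
have q0 m : (J <= m)%N -> 0 < q m by move=> /hg[? ? _ _]; exact: divr_gt0.
have hq m : (J <= m)%N -> [/\ 0 < q m, q m * gl m <= 1 * gp m & gp m <= 1 * (q m * gl m)].
  move=> Jm; have [h _ _ _] := hg _ Jm.
  by rewrite !mul1r /q divfK ?gt_eqF// lexx; split => //; exact: q0.
pose P m := (Num.sqrt (gl m))^-1.
have sg m : (J <= m)%N -> 0 < Num.sqrt (gl m) by move=> /hg[? _ _ _]; rewrite sqrtr_gt0.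
have hP m : (J <= m)%N -> 0 < P m /\ P m <= P m.+1.
  move=> Jm; have [_ _ g3 _] := hg _ Jm.
  by rewrite /P invr_gt0 lef_pV2 ?posrE ?sg// ?ler_wsqrtr// leqW.
pose b m := Num.min 1 (Num.sqrt (q m / r)).
have hbP m : (J <= m)%N -> b m.+1 * P m <= P m.+1 * b m.
  move=> Jm; have [_ _ g3 g4] := hg _ Jm; have Jm1 := leqW Jm.
  rewrite /P ler_pdivrMr ?sg// -mulrA [leRHS]mulrC ler_pdivlMr ?sg//.
  (* By this formula b sqrt(gl) is the minimum of two nonincreasing
     sequences. *)
  have bs i : (J <= i)%N -> b i * Num.sqrt (gl i) = Num.min (Num.sqrt (gl i)) (Num.sqrt (gp i / r)).
    move=> Ji; have [h1 _ _ _] := hg _ Ji.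
    rewrite /b minr_pMl ?sqrtr_ge0// mul1r -sqrtrM ?(ltW (divr_gt0 (q0 _ Ji) r0))//.
    by congr (Num.min _ (Num.sqrt _)); rewrite /q; field; rewrite !gt_eqF.
  have w1 : Num.sqrt (gl m.+1) <= Num.sqrt (gl m) by rewrite ler_wsqrtr.
  have w2 : Num.sqrt (gp m.+1 / r) <= Num.sqrt (gp m / r).
    by rewrite ler_wsqrtr// ler_wpM2r// invr_ge0 ltW.
  by rewrite bs// [b m * _]bs// le_min !ge_min w1 w2 orbT.
have hb := weight_range J1 K1 (lexx 1) r1 hg hd hq.
have := ln_monodromy_cut l_gt0 l_summable W_fund (ltW r0) hb hP hbP
  (weight_length_cost J1 K1 (lexx 1) r1 hg hd hq) (weight_angle_cost J1 K1 (lexx 1) r1 hg hd hq)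
  Jn b'1 hTL hTP.
move=> /le_trans; apply; rewrite lerD2r.
have lnn : 0 <= ln n%:R :> R by rewrite ln_ge0// ler1n (leq_trans J1).
have lnr : 0 <= ln r by rewrite ln_ge0.
have [g1 _ _ _] := hg _ Jn; have [gJ _ _ _] := hg _ (leqnn J).
have [u1 u2] := hln _ Jn; have [v1 _] := hln _ (leqnn J).
have lJn : K * (1 + ln J%:R) <= K * (1 + ln n%:R).
  rewrite ler_wpM2l ?(le_trans ler01)// lerD2l ler_ln ?posrE ?ltr0n ?(leq_trans J1)//.
  by rewrite ler_nat.
have e2 : ln (P n / P J) <= K * (1 + ln n%:R).
  rewrite /P invrK lnM ?posrE ?invr_gt0 ?sqrtr_gt0// lnV ?posrE ?sqrtr_gt0// !ln_sqrt//.
  have := ler_norm (- ln (gl n)); have := ler_norm (ln (gl J)); rewrite normrN.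
  by move: u1 v1 lJn; drop_facts; lra.
have e3 : - ln (b n) <= K * (1 + ln n%:R) + ln r.
  apply: (le_trans (ln_weight (q0 _ Jn) r0)); rewrite (ger0_norm lnr).
  have : `|ln (q n)| <= `|ln (gp n)| + `|ln (gl n)|.
    have [_ h _ _] := hg _ Jn.
    by rewrite /q lnM ?posrE ?invr_gt0// lnV ?posrE// (le_trans (ler_normD _ _))// normrN.
  by move: u1 u2 lnr; drop_facts; lra.
have := weight_head_sum fE J1 K1 (lexx 1) r1 hg hd hq (K' := K') n.
rewrite expr1n mulr1 /K' => e4.
have {}e4 : \sum_(J <= j < n.+1) ln (1 + K * 1 * (gl j * Num.sqrt (q j * r))) <= head_sum f K' r J n.
  by apply: e4; move: c0; drop_facts; lra.
have e1 := init _ r1.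
have p1 : 0 <= c * ln n%:R + 2 * K * ln r + ln n%:R + 1.
  by rewrite !addr_ge0// !mulr_ge0// (le_trans ler01).
rewrite /K'; move: e1 e4; move: (\sum_(_ <= _ < _) _) (\sum_(_ <= _ < _) _) (head_sum _ _ _ _ _).
move=> s1 s2 s3; rewrite /K'; move: e2 e3 p1; drop_facts; lra.
Qed.

(** If q = d_phi / d_l is nondecreasing then so is the weight b, which can serve
    as its own telescoping factor. The total cost b n / b J is then compensated
    by the cost 1 / b n of returning to the Euclidean energy, and the logarithm
    of n disappears from the bound. *)
Lemma nondecreasing_ratio_bound : approx_nondecreasing (fun t => d_phi t / d_l t) -> full_bound logM f.
Proof.
move=> [q0 q0mono [c c0 /cvgrPdist_lt qc]]; apply: full_bound_shift => //.
have c2 : 0 < c / 2 by move: c0; drop_facts; lra.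
have /near_pinftyE[T T1 hT] := qc _ c2.
have [gl [gp [K [J0 [J01 K1 hg hd hln]]]]] := majorants.
pose J := maxn J0 (Num.truncn T).+1.
have J1 : (1 <= J)%N by exact: leq_trans (leq_maxl _ _).
have JJ0 n : (J <= n)%N -> (J0 <= n)%N by apply: leq_trans; exact: leq_maxl.
have JT n : (J <= n)%N -> T <= n%:R.
  by move=> h; apply: natr_ge_truncn; apply: leq_trans h; exact: leq_maxr.
have n1 n : (J <= n)%N -> 1 <= n%:R :> R by move=> /JT; exact: le_trans.
pose q n := c * q0 n%:R.
have hq n : (J <= n)%N -> [/\ 0 < q n, q n * gl n <= 8 * gp n & gp n <= 8 * (q n * gl n)].
  move=> Jn; have dl0 := regularly_varying_gt0 d_l_rv (n1 _ Jn); have dp0 := regularly_varying_gt0 d_phi_rv (n1 _ Jn).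
  have [g1 g2 _ _] := hg _ (JJ0 _ Jn); have [_ _ [u1 u2] [v1 v2]] := hd _ (JJ0 _ Jn).
  have := hT _ (JT _ Jn); rewrite ltr_distlC.
  set ra := d_phi _ / d_l _ => /andP[w1 w2].
  have raE : ra * d_l n%:R = d_phi n%:R by rewrite /ra divfK// gt_eqF.
  have ra0 : 0 < ra by exact: divr_gt0.
  have w3 : c / 2 < ra / q0 n%:R by move: w1; drop_facts; lra.
  have w4 : ra / q0 n%:R < 3 * c / 2 by move: w2; drop_facts; lra.
  have q00 : 0 < q0 n%:R.
    by have := lt_trans c2 w3; rewrite pmulr_rgt0// invr_gt0.
  rewrite ltr_pdivlMr// in w3; rewrite ltr_pdivrMr// in w4.
  have qn0 : 0 < q n by rewrite mulr_gt0.
  have qn : q n <= 2 * ra by rewrite /q; move: w3; drop_facts; lra.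
  have qn' : ra <= 2 * q n by rewrite /q; move: qn0; rewrite /q; move: w4; drop_facts; lra.
  have h1 : q n * gl n <= (2 * ra) * (2 * d_l n%:R) by apply: ler_pM => //; exact: ltW.
  have h2 : ra * d_l n%:R <= (2 * q n) * (2 * gl n) by apply: ler_pM => //; exact: ltW.
  by move: qn0 h1 h2 raE v1 v2; drop_facts => qn0 h1 h2 raE v1 v2; split => //; lra.
have qmono n : (J <= n)%N -> q n <= q n.+1.
  move=> Jn; have h2 : n%:R <= n.+1%:R :> R by rewrite ler_nat.
  have h1 := n1 _ Jn; rewrite /q ler_pM2l//; apply: q0mono => //; rewrite in_itv/= andbT//.
  exact: le_trans h2.
have hg' n (Jn : (J <= n)%N) := hg n (JJ0 _ Jn); have hd' n (Jn : (J <= n)%N) := hd n (JJ0 _ Jn).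
have [c' c'0 init] := initial_cost J l_gt0.
have A1 : 1 <= 8 :> R by drop_facts; lra.
have lq := normr_ge0 (ln (q J)).
pose K' := c' + `|ln (q J)| + 128 * K + 1.
exists K', J; split => //; first by rewrite /K'; move: c'0 lq K1; drop_facts; lra.
move=> r S r1 hS; have r0 : 0 < r by exact: lt_le_trans r1.
pose b m := Num.min 1 (Num.sqrt (q m / r)).
have hb := weight_range J1 K1 A1 r1 hg' hd' hq.
have hP m : (J <= m)%N -> 0 < b m /\ b m <= b m.+1.
  move=> Jm; split; first by case: (hb _ Jm).
  rewrite le_min !ge_min lexx ler_wsqrtr ?orbT//.
  by rewrite ler_wpM2r ?qmono// invr_ge0 ltW.
have hbP m : (J <= m)%N -> b m.+1 * b m <= b m.+1 * b m by [].
have := ln_monodromy_full l_gt0 l_summable W_fund (ltW r0) hb hP hbP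
  (weight_length_cost J1 K1 A1 r1 hg' hd' hq) (weight_angle_cost J1 K1 A1 r1 hg' hd' hq)
  (S := - ln (b J) + S).
move=> h; apply: (le_trans (h _)).
  move=> n Jn; have [b0 _] := hb _ Jn; have [bJ0 _] := hb _ (leqnn J).
  rewrite lnM ?posrE ?invr_gt0// lnV ?posrE//.
  have e4 := weight_head_sum fE J1 K1 A1 r1 hg' hd' hq (K' := K') n.
  have {}e4 := e4 ltac:(by rewrite /K'; move: c'0 lq; drop_facts; lra).
  have := hS n Jn; move: e4; move: (\sum_(_ <= _ < _) _) (head_sum _ _ _ _ _) => s1 s2; drop_facts; lra.
have lnr : 0 <= ln r by rewrite ln_ge0.
have [qJ _ _] := hq _ (leqnn J).
have e3 := ln_weight qJ r0; rewrite (ger0_norm lnr) -/(b J) in e3.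
have p1 : 0 <= 128 * K * (1 + ln r) by rewrite !mulr_ge0 ?addr_ge0// (le_trans ler01).
have p2 : 0 <= `|ln (q J)| * ln r by rewrite mulr_ge0.
have := init _ r1; rewrite /K'; move: (\sum_(_ <= _ < _) _) => s.
by move: p1 p2 e3 lq lnr; drop_facts; lra.
Qed.

(** The weight 1 in the tail, for any frame: every remaining interval costs at
    most its length. *)
Lemma head_isotropic_tail_bound : cut_bound logM f (tail_sum l).
Proof.
have tail0 n : 0 <= tail_sum l n := tail_sum_ge0 l_gt0 l_summable n (length_dominated l_gt0).
apply: cut_bound_shift => //.
have [K [J [K1 J1 H]]] := head_tail_bound 0.
exists (K + 1), J, J; split => //; first by move: K1; drop_facts; lra.
move=> r n r1 Jn; have n1 : 1 <= n%:R :> R by rewrite ler1n (leq_trans J1).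
have := H r 1 _ _ n r1 Jn; rewrite ltr01 lexx.
move=> /(_ _ _ isT (lexx _) (tail_sin_le l_gt0 l_summable _ _ _)).
rewrite ln1 oppr0 add0r mul1r divr1 => h; apply: (le_trans h).
have KK : K <= K + 1 by rewrite lerDl.
have h1 := head_sum_leK f_gt0 r n J1 (le_trans ler01 K1) KK.
have rt : 0 <= r * tail_sum l n by rewrite mulr_ge0// (le_trans ler01).
have krt : 2 * (r * tail_sum l n) <= (K + 1) * (r * tail_sum l n).
  by rewrite ler_wpM2r//; move: K1; drop_facts; lra.
have lr : 0 <= ln r by rewrite ln_ge0.
have l_n : 0 <= ln n%:R :> R by rewrite ln_ge0.
move: h1; move: (head_sum _ _ _ _ _) (head_sum _ _ _ _ _) => s1 s2; move: krt lr l_n; drop_facts; lra.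
Qed.

Variables (psi : R) (c_l c_phi : R -> R).
Hypothesis c_l_rv : regularly_varying c_l.
Hypothesis c_phi_rv : regularly_varying c_phi.
Hypothesis c_l_mono : approx_nonincreasing c_l.
Hypothesis c_phi_mono : approx_nonincreasing c_phi.
Hypothesis c_phi_c_l : lesssim_near +oo c_phi c_l.
Hypothesis l_tail : lesssim_near \oo (tail_sum l) (fun N => c_l N%:R).
Hypothesis phi_tail : lesssim_near \oo
                  (tail_sum (fun j => l j * sin (phi j - psi) ^+ 2))
                  (fun N => c_phi N%:R).

(** The frame psi of the hypotheses and the balanced weight in the tail. *)
Lemma head_anisotropic_tail_bound :
  cut_bound logM f (fun n => Num.sqrt (c_l n%:R * c_phi n%:R)).
Proof.
apply: cut_bound_shift => //.
have [K [J [K1 J1 H]]] := head_tail_bound psi.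
have [c c0 /near_pinftyE[T T1 hT]] := c_phi_c_l.
have [A1 A10 /near_inftyE[N1 hN1]] := l_tail.
have [A2 A20 /near_inftyE[N2 hN2]] := phi_tail.
have [K3 [T3 T31 hT3]] := rv_ln_bound c_l_rv c_l_mono.
have [K4 [T4 T41 hT4]] := rv_ln_bound c_phi_rv c_phi_mono.
pose N := maxn (maxn J (maxn N1 N2)) (Num.truncn (Num.max T (Num.max T3 T4))).+1.
pose c' := Num.max 1 c.
have c'1 : 1 <= c' by rewrite le_max lexx.
have lc0 := ln_ge0 c'1.
pose K' := K + `|K3| + `|K4| + ln c' + A1 + A2 * c'.
have A2c : 0 < A2 * c' by rewrite mulr_gt0// (lt_le_trans ltr01).
have K3n := normr_ge0 K3; have K4n := normr_ge0 K4.
exists K', J, N; split => //; first by rewrite /K'; move: K1 lc0 A10 A2c K3n K4n; drop_facts; lra.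
move=> r n r1; rewrite !geq_max -andbA => /and3P[Jn /andP[h1 h2] /natr_ge_truncn].
rewrite !ge_max => /and3P[h3 h4 h5].
have n1 : 1 <= n%:R :> R by exact: le_trans h3.
have cl0 := regularly_varying_gt0 c_l_rv n1; have cp0 := regularly_varying_gt0 c_phi_rv n1.
have cpl : c_phi n%:R <= c' * c_l n%:R.
  by apply: (le_trans (hT _ h3)); rewrite ler_pM2r// le_max lexx orbT.
have [] := balanced_weight cl0 cp0 c'1 cpl.
set b' := Num.sqrt (_ / _); set Z := Num.sqrt (_ * _) => b'1 bZ1 bZ2 e6.
apply: (le_trans (H r b' _ _ n r1 Jn b'1 (hN1 _ h1) (hN2 _ h2))).
have e4 : head_sum f K r J n <= head_sum f K' r J n.
  apply: head_sum_leK => //; first exact: le_trans K1.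
  by rewrite /K'; move: lc0 A10 A2c K3n K4n; drop_facts; lra.
have lnn : 0 <= ln n%:R :> R by rewrite ln_ge0.
have lnr : 0 <= ln r by rewrite ln_ge0.
have {}e6 : - ln b' <= (`|K3| + `|K4|) * ln n%:R + ln c'.
  have q1 := hT3 _ h4; have q2 := hT4 _ h5.
  have q3 := ler_wpM2r lnn (ler_norm K3); have q4 := ler_wpM2r lnn (ler_norm K4).
  by move: e6 q1 q2 q3 q4; drop_facts; lra.
have r0 : 0 <= r by exact: le_trans r1.
have e7 : r * (b' * (A1 * c_l n%:R) + A2 * c_phi n%:R / b') <= (A1 + A2 * c') * (r * Z).
  rewrite [leRHS]mulrCA ler_wpM2l// [leRHS]mulrDl; apply: lerD.
    by rewrite mulrCA ler_pM2l.
  by rewrite -!mulrA ler_pM2l.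
have p1 : 0 <= (`|K3| + `|K4| + A1 + A2 * c' + ln c') * ln r.
  by apply: mulr_ge0; move: lnr lc0 A10 A2c K3n K4n; drop_facts; lra.
have p2 : 0 <= (A1 + A2 * c' + ln c') * ln n%:R.
  by apply: mulr_ge0; move: lnn lc0 A10 A2c; drop_facts; lra.
have p3 : 0 <= (K + `|K3| + `|K4| + ln c') * (r * Z).
  by apply: mulr_ge0; [move: K1 lc0 K3n K4n; drop_facts; lra|rewrite mulr_ge0 ?sqrtr_ge0].
move: e4; move: (head_sum _ _ _ _ _) (head_sum _ _ _ _ _) => s1 s2.
by rewrite /K'; move: e6 e7 p1 p2 p3 K3n K4n A10 A2c; drop_facts; lra.
Qed.

End weights.

(** * Growth exponents *)

Section growth.
Context {R : realType}.
Implicit Types (logM f C D : R -> R) (F G : R -> R).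

(** A bound for the order of growth in a form that passes to sums. *)
Definition growth_le F (rho : R) := forall eps : R, 0 < eps ->
  exists K, exists2 R0, 1 <= R0 & forall r, R0 <= r -> F r <= K * expR ((rho + eps) * ln r).

(** For F = log max |M| the growth exponent bounds the order; a nonpositive
    value of F gives a vanishing iterated logarithm. *)
Lemma growth_order (M : R[i] -> 'M[R[i]]_2) (rho : R) : 0 <= rho ->
  growth_le (fun r => ln (max_norm M r)) rho -> (order M <= rho%:E)%E.
Proof.
move=> rho0 gM; apply/lee_addgt0Pr => e e0.
have e2 : 0 < e / 2 by lra.
have [K [R0 R01 hR0]] := gM _ e2.
have [R1 R11 hR1] := ln_near_ge (Num.max 1 (`|ln (Num.max 1 K)| / (e / 2))).
rewrite /order /limf_esup; apply: ge_ereal_inf.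
exists (ereal_sup [set (ln (ln (max_norm M r)) / ln r)%:E | r in [set r | Num.max R0 R1 <= r]]).
  exists [set r | Num.max R0 R1 <= r] => //.
  exists (Num.max R0 R1); split; first exact: num_real.
  by move=> x /= /ltW.
apply: ge_ereal_sup => _ [r /= hr <-]; rewrite -EFinD lee_fin.
move: hr; rewrite ge_max => /andP[h0 h1].
have := hR1 _ h1; rewrite ge_max => /andP[l1 l2].
have l0 : 0 < ln r by lra.
rewrite ler_pdivrMr//.
have [m0|m0] := leP (ln (max_norm M r)) 0.
  by rewrite ln0// mulr_ge0//; lra.
have K0 : 0 < Num.max 1 K by rewrite lt_max ltr01.
have hM : ln (max_norm M r) <= Num.max 1 K * expR ((rho + e / 2) * ln r).
  apply: (le_trans (hR0 _ h0)); rewrite ler_wpM2r ?expR_ge0//.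
  by rewrite le_max lexx orbT.
have : ln (ln (max_norm M r)) <= ln (Num.max 1 K) + (rho + e / 2) * ln r.
  rewrite -[X in _ + X]expRK -lnM ?posrE ?expR_gt0// ler_ln ?posrE//.
  by rewrite mulr_gt0// expR_gt0.
move: l2; rewrite ler_pdivrMr// => l2.
have := ler_norm (ln (Num.max 1 K)); lra.
Qed.

Lemma growth_leD F G rho : growth_le F rho -> growth_le G rho ->
  growth_le (fun r => F r + G r) rho.
Proof.
move=> gF gG eps eps0.
have [K1 [R1 R11 h1]] := gF _ eps0; have [K2 [R2 R21 h2]] := gG _ eps0.
exists (K1 + K2); exists (Num.max R1 R2); first by rewrite le_max R11.
by move=> r; rewrite ge_max mulrDl => /andP[/h1 u1 /h2 u2]; exact: lerD.
Qed.

Lemma growth_leZ F (c rho : R) : 0 <= c -> growth_le F rho -> growth_le (fun r => c * F r) rho.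
Proof.
move=> c0 gF eps eps0; have [K [R1 R11 h]] := gF _ eps0.
exists (c * K); exists R1 => // r /h; rewrite -mulrA; exact: ler_wpM2l.
Qed.

Lemma growth_leW F G rho rho' : rho <= rho' ->
  (exists R0, forall r, R0 <= r -> F r <= G r) -> growth_le G rho -> growth_le F rho'.
Proof.
move=> rr [R0 hR] gG eps eps0; have [K [R1 R11 h]] := gG _ eps0.
exists (Num.max 0 K); exists (Num.max R0 R1); first by rewrite le_max R11 orbT.
move=> r; rewrite ge_max => /andP[r0 r1]; apply: (le_trans (hR _ r0)).
apply: (le_trans (h _ r1)).
have lr : 0 <= ln r by rewrite ln_ge0//; lra.
apply: (@le_trans _ _ (Num.max 0 K * expR ((rho + eps) * ln r))).
  by rewrite ler_wpM2r ?expR_ge0// le_max lexx orbT.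
rewrite ler_wpM2l ?le_max ?lexx// ler_expR ler_wpM2r//; lra.
Qed.

Lemma ln_le_power (eps x : R) : 0 < eps -> 0 <= x -> x <= eps^-1 * expR (eps * x).
Proof.
move=> e0 x0; rewrite ler_pdivlMl//; have := expR_ge1Dx (eps * x); lra.
Qed.

Lemma growth_le_ln (c rho : R) : 0 <= c -> 0 <= rho -> growth_le (fun r => c * (1 + ln r)) rho.
Proof.
move=> c0 r0; apply: (@growth_leW _ (fun r => c * (1 + ln r)) 0) => //; first by exists 0.
apply: growth_leZ => // eps e0; exists (1 + eps^-1); exists 1 => // r r1.
have lr : 0 <= ln r by rewrite ln_ge0.
rewrite add0r mulrDl mul1r lerD ?ln_le_power//.
by rewrite -[leLHS]expR0 ler_expR mulr_ge0// ltW.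
Qed.

Definition cut_index (kappa r : R) := (Num.truncn (expR (kappa * ln r))).+1.

Lemma cut_indexP kappa r : 0 <= kappa -> 1 <= r ->
  kappa * ln r <= ln (cut_index kappa r)%:R <= kappa * ln r + 1 /\
  (cut_index kappa r)%:R <= 2 * expR (kappa * ln r).
Proof.
move=> k0 r1; have lr : 0 <= ln r by rewrite ln_ge0.
have v1 : 1 <= expR (kappa * ln r) by rewrite -expR0 ler_expR mulr_ge0.
have h1 : expR (kappa * ln r) <= (cut_index kappa r)%:R by apply: ltW; exact: truncnS_gt.
have h2 : (cut_index kappa r)%:R <= 2 * expR (kappa * ln r).
  have /andP[h _] := truncn_itv (le_trans ler01 v1).
  by rewrite /cut_index -natr1; lra.
have n0 : 0 < (cut_index kappa r)%:R :> R by rewrite ltr0n.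
split => //; apply/andP; split.
  by rewrite -[leLHS]expRK ler_ln ?posrE ?expR_gt0.
apply: (@le_trans _ _ (ln (2 * expR (kappa * ln r)))).
  by rewrite ler_ln ?posrE ?mulr_gt0 ?expR_gt0.
rewrite lnM ?posrE ?expR_gt0// expRK; have := @ln2_le1 R; lra.
Qed.

Lemma cut_index_large kappa (N : nat) : 0 < kappa ->
  exists2 R0, 1 <= R0 & forall r, R0 <= r -> (N <= cut_index kappa r)%N.
Proof.
move=> k0; have [R0 R01 h] := ln_near_ge (ln N.+1%:R / kappa : R).
exists R0 => // r hr; have r1 : 1 <= r by lra.
have [/andP[h1 _] _] := cut_indexP (ltW k0) r1.
have : ln N.+1%:R <= ln (cut_index kappa r)%:R :> R.
  by apply: le_trans h1; rewrite mulrC -ler_pdivrMr// h.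
by rewrite ler_ln ?posrE ?ltr0n// ler_nat; apply: ltnW.
Qed.

Lemma cut_growth logM f (tail : nat -> R) kappa rho : 0 < kappa -> 0 <= rho ->
  cut_bound logM f tail ->
  (forall (K0 : R) J1, 1 <= K0 -> (1 <= J1)%N ->
     growth_le (fun r => head_sum f K0 r J1 (cut_index kappa r)) rho) ->
  growth_le (fun r => r * tail (cut_index kappa r)) rho ->
  growth_le logM rho.
Proof.
move=> k0 rho0 [K0 [J [K01 H]]] hhead htail.
pose J1 := maxn J 1; have [K1 [N [K11 J1N hN]]] := H J1 (leq_maxl _ _).
have [R0 R01 hR0] := @cut_index_large kappa N k0.
have g1 := hhead K0 J1 K01 (leq_maxr _ _).
apply: (@growth_leW _ (fun r => (K1 * (2 + kappa)) * (1 + ln r) +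
   (2 * head_sum f K0 r J1 (cut_index kappa r) + K1 * (r * tail (cut_index kappa r)))) rho) => //.
  exists R0 => r hr; have r1 : 1 <= r by exact: le_trans hr.
  apply: (le_trans (hN r _ r1 (hR0 _ hr))).
  have [/andP[_ h] _] := cut_indexP (ltW k0) r1.
  have lr : 0 <= ln r by rewrite ln_ge0.
  have h1 : K1 * (1 + ln r + ln (cut_index kappa r)%:R) <= K1 * ((2 + kappa) * (1 + ln r)).
    rewrite ler_wpM2l ?(le_trans ler01)//.
    by move: h lr k0; drop_facts; lra.
  by move: h1; move: (head_sum _ _ _ _ _) => u; drop_facts; lra.
apply: growth_leD; first by apply: growth_le_ln => //; rewrite mulr_ge0//; lra.
apply: growth_leD; apply: growth_leZ => //; lra.
Qed.

End growth.

(** * Orders from a cut at a power *)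

Section power_cuts.
Context {R : realType}.
Variables (logM f D C : R -> R) (delta gamma : R).
Hypothesis f0 : forall t, 1 <= t -> 0 < f t.
Hypothesis lnf : forall t, 1 <= t -> ln (f t) = - ln (D t) / 2.
Hypothesis Dp : potter D delta.
Hypothesis C0 : forall t, 1 <= t -> 0 < C t.
Hypothesis Cp : potter C gamma.

Lemma step_cost_power (eps : R) : 0 < eps ->
  exists2 T, 1 <= T & forall t, T <= t -> ln (f t) <= (- (delta / 2) + eps) * ln t.
Proof.
move=> e0; have [T T1 hT] := potter_power Dp e0.
exists T => // t Tt; have t1 : 1 <= t by lra.
have lt0 : 0 <= ln t by rewrite ln_ge0.
have := hT _ Tt; rewrite lnf// ler_norml => /andP[h _].
have : 0 <= eps * ln t by rewrite mulr_ge0// ltW.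
by move: h; drop_facts; lra.
Qed.

Lemma tail_growth kappa : 0 < kappa -> 0 <= gamma ->
  growth_le (fun r => r * (1 / C (cut_index kappa r)%:R)) (1 - gamma * kappa).
Proof.
move=> k0 g0 eps e0.
have ek : 0 < eps / kappa by rewrite divr_gt0.
have [T T1 hT] := potter_power Cp ek.
have [R0 R01 hR0] := @cut_index_large R kappa (Num.truncn T).+1 k0.
exists (expR (eps / kappa)); exists R0 => // r hr.
have r1 : 1 <= r by lra.
have lr : 0 <= ln r by rewrite ln_ge0.
have [/andP[n1 n2] _] := cut_indexP (ltW k0) r1.
have Tn : T <= (cut_index kappa r)%:R.
  by apply: natr_ge_truncn; exact: hR0.
set n := (cut_index kappa r)%:R in n1 n2 Tn *.
have Cn : 0 < C n by apply: C0; lra.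
have r0 : 0 < r by lra.
rewrite -expRD div1r -[leLHS]lnK ?posrE ?mulr_gt0 ?invr_gt0// ler_expR.
rewrite lnM ?posrE ?invr_gt0// lnV ?posrE//.
have := hT _ Tn; rewrite ler_norml => /andP[h _].
have u1 : eps / kappa * ln n <= eps / kappa * (kappa * ln r + 1) by rewrite ler_pM2l.
have u2 : eps / kappa * (kappa * ln r + 1) = eps * ln r + eps / kappa.
  by field; rewrite gt_eqF.
have u3 : gamma * (kappa * ln r) <= gamma * ln n by rewrite ler_wpM2l.
by move: h u1 u3; rewrite u2; move: (eps / kappa) => w; lra.
Qed.

(** Interpolates between the logarithm (p near 0) and the linear bound (p = 1). *)
Lemma ln_1p_power (p x : R) : 0 < p -> p <= 1 -> 0 < x -> ln (1 + x) <= (1 + p^-1) * expR (p * ln x).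
Proof.
move=> p0 p1 x0; have pi : 0 < p^-1 by rewrite invr_gt0.
have [x1|x1] := leP x 1.
  apply: (@le_trans _ _ x); first by apply: le_ln1Dx; lra.
  have lx : ln x <= 0 by rewrite ln_le0.
  apply: (@le_trans _ _ (expR (p * ln x))).
    by rewrite -[leLHS]lnK ?posrE// ler_expR ler_niMl.
  by rewrite ler_peMl ?expR_ge0//; lra.
have lx : 0 <= ln x by rewrite ln_ge0// ltW.
have : ln (1 + x) <= ln 2 + ln x by rewrite -lnM ?posrE// ler_ln ?posrE; lra.
have := ln_le_power p0 lx; have := expR_ge1Dx (p * ln x); have := @ln2_le1 R.
have : 0 <= p * ln x by rewrite mulr_ge0// ltW.
by rewrite mulrDl mul1r; lra.
Qed.

Lemma head_sum_power (p K0 e : R) : 0 < p -> p <= 1 -> 1 <= K0 -> 0 < e ->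
  exists B J2, [/\ 0 < B, (1 <= J2)%N & forall r J1 n, 1 <= r -> (J2 <= J1)%N ->
  head_sum f K0 r J1 n <= B * (expR (p / 2 * ln r) *
    \sum_(J1 <= j < n.+1) expR ((- (p * (delta / 2)) + e) * ln j%:R))].
Proof.
move=> p0 p1 K01 e0; have [T T1 hT] := step_cost_power e0.
have K00 : 0 < K0 by exact: lt_le_trans K01.
have q0 : 0 < 1 + p^-1 by rewrite addr_gt0// invr_gt0.
exists ((1 + p^-1) * expR (p * ln K0)), (Num.truncn T).+1; split => //.
  by rewrite mulr_gt0// expR_gt0.
move=> r J1 n r1 TJ1; have r0 : 0 < r by exact: lt_le_trans r1.
rewrite !mulr_sumr; apply: ler_sum_nat => j /andP[J1j _].
have Tj : T <= j%:R by apply: natr_ge_truncn; exact: leq_trans J1j.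
have j1 : 1 <= j%:R :> R by exact: le_trans Tj.
have fj0 := f0 j1; have lj : 0 <= ln j%:R :> R by rewrite ln_ge0.
have sr0 : 0 < Num.sqrt r by rewrite sqrtr_gt0.
have sf : 0 < Num.sqrt r * f j%:R by rewrite mulr_gt0.
apply: (le_trans (ln_1p_power p0 p1 (mulr_gt0 K00 sf))).
rewrite lnM ?posrE// lnM ?posrE// ln_sqrt// -[leRHS]mulrA -!expRD ler_pM2l// ler_expR.
have h1 := ler_wpM2l (ltW p0) (hT _ Tj).
have h2 : p * (e * ln j%:R) <= e * ln j%:R by rewrite ler_piMl// mulr_ge0// ltW.
by move: h1 h2; drop_facts; lra.
Qed.

(** By the p-th power bound each term is O(r^(p/2) j^(-p delta / 2)) up to eps,
    and summing these powers up to r^kappa gives the exponent. *)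
Lemma head_growth (kappa p K0 : R) J1 : 0 < kappa -> 0 < p -> p <= 1 -> p * (delta / 2) <= 1 ->
  1 <= K0 -> (1 <= J1)%N ->
  growth_le (fun r => head_sum f K0 r J1 (cut_index kappa r)) (p / 2 + (1 - p * (delta / 2)) * kappa).
Proof.
move=> k0 p0 p1 pd K01 J11 eps e0; set s := p * (delta / 2).
pose e := eps / (2 * kappa); have ek : 0 < e by rewrite divr_gt0// mulr_gt0.
have eE : 2 * e * kappa = eps by rewrite /e; field; rewrite gt_eqF.
have s0 : 0 <= 1 - s + 2 * e by rewrite addr_ge0 ?subr_ge0// mulr_ge0// ltW.
have [B [J2 [B0 J21 hB]]] := head_sum_power p0 p1 K01 ek.
have [B' B'0 hB'] := @sum_power R _ ek.
have [Kc Kc0 hKc] := head_sum_shift f0 K01 J11 (leq_maxl J1 J2).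
have [R0 R01 hR0] := @cut_index_large R kappa (maxn J1 J2) k0.
set rho := p / 2 + _.
have rho0 : 0 <= rho.
  by rewrite addr_ge0 ?mulr_ge0 ?subr_ge0 ?(ltW k0)// ltW// divr_gt0.
have [Kl [R1 R11 hl]] := growth_le_ln Kc0 rho0 e0.
exists (Kl + B * (B' * expR (1 - s + 2 * e))); exists (Num.max R0 R1); first by rewrite le_max R01.
move=> r; rewrite ge_max => /andP[hr hr1]; have r1 : 1 <= r by exact: le_trans hr.
have [/andP[_ n2] _] := cut_indexP (ltW k0) r1; have nJ := hR0 _ hr.
apply: (le_trans (hKc r _ r1 nJ)); rewrite mulrDl; apply: lerD; first exact: hl.
apply: (le_trans (hB r _ _ r1 (leq_maxr J1 J2))); rewrite -[leRHS]mulrA ler_pM2l//.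
set n := cut_index kappa r in n2 nJ *.
apply: (@le_trans _ _ (expR (p / 2 * ln r) * (B' * expR ((1 - s + 2 * e) * ln n%:R)))).
  rewrite ler_wpM2l ?expR_ge0//.
  apply: (@le_trans _ _ (\sum_(maxn J1 J2 <= j < n.+1) expR (- (1 + e) * ln j%:R) * expR ((1 - s + 2 * e) * ln n%:R))).
    apply: ler_sum_nat => j /andP[Jj jn]; rewrite -expRD ler_expR.
    have j0 : (0 < j)%N by apply: leq_trans Jj; rewrite leq_max J11.
    have : ln j%:R <= ln n%:R :> R.
      by rewrite ler_ln ?posrE ?ltr0n ?ler_nat//; exact: leq_trans j0 _.
    by move=> /(ler_wpM2l s0); rewrite /s; drop_facts; lra.
  rewrite -mulr_suml ler_wpM2r ?expR_ge0//; apply: le_trans (hB' n.+1).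
  by apply: ler_sum_widen => //; rewrite leq_max J11.
rewrite [leLHS]mulrCA -[leRHS]mulrA ler_pM2l// -!expRD ler_expR.
have := ler_wpM2l s0 n2; rewrite /rho -/s -eE; drop_facts; lra.
Qed.

(** A tiny power p shows that the head is r^kappa up to eps; kappa = 1 / (1 +
    gamma) is where the head r^kappa and the tail r^(1 - gamma kappa) agree. *)
Lemma log_cut_order : 0 < delta -> 0 <= gamma ->
  cut_bound logM f (fun n => 1 / C n%:R) -> growth_le logM (1 / (1 + gamma)).
Proof.
move=> d0 g0 cb; set kappa := 1 / (1 + gamma).
have k0 : 0 < kappa by rewrite divr_gt0// ltr_pwDl.
apply: (cut_growth k0 (ltW k0) cb) => [K0 J1 K01 J11 eps e0|]; last first.
  have {2}-> : kappa = 1 - gamma * kappa by rewrite /kappa; field; rewrite gt_eqF// ltr_pwDl.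
  exact: tail_growth.
(* For small p the factor r^(p / 2) is within r^eps; the bound p <= 2 / delta
   keeps the exponent 1 - p delta / 2 of their sum nonnegative. *)
pose p := Num.min (Num.min 1 eps) (2 / delta).
have p0 : 0 < p by rewrite !lt_min ltr01 e0 divr_gt0.
have [p1 pe pd] : [/\ p <= 1, p <= eps & p <= 2 / delta].
  by rewrite /p !ge_min !lexx !orbT; split.
have pd1 : p * (delta / 2) <= 1.
  by rewrite mulrA ler_pdivrMr// mul1r -ler_pdivlMr.
have e2 : 0 < eps / 2 by rewrite divr_gt0.
have [B [R0 R01 hB]] := head_growth k0 p0 p1 pd1 K01 J11 e2.
exists (Num.max 0 B); exists R0 => // r hr; apply: (le_trans (hB _ hr)).
have r1 : 1 <= r by exact: le_trans hr.
apply: (@le_trans _ _ (Num.max 0 B * expR ((p / 2 + (1 - p * (delta / 2)) * kappa + eps / 2) * ln r))).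
  by rewrite ler_wpM2r ?expR_ge0// le_max lexx orbT.
rewrite ler_wpM2l ?le_max ?lexx// ler_expR ler_wpM2r ?ln_ge0//.
have : 0 <= p * (delta / 2) * kappa by exact: (mulr_ge0 (mulr_ge0 (ltW p0) (divr_ge0 (ltW d0) (ler0n _ 2))) (ltW k0)).
by move: pe; drop_facts; lra.
Qed.

(** With p = 1 the head has exponent 1/2 + (1 - delta/2) kappa, which meets the
    tail exponent 1 - gamma kappa at kappa = 1 / (2 - delta + 2 gamma). *)
Lemma primitive_cut_order : delta <= 2 -> 0 <= gamma -> 0 < 2 - delta + 2 * gamma ->
  cut_bound logM f (fun n => 1 / C n%:R) ->
  growth_le logM ((2 - delta + gamma) / (2 - delta + 2 * gamma)).
Proof.
move=> d2 g0 s0 cb; pose kappa := 1 / (2 - delta + 2 * gamma).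
have k0 : 0 < kappa by rewrite divr_gt0.
have sne : 2 - delta + 2 * gamma != 0 by rewrite gt_eqF.
apply: (cut_growth k0 _ cb) => [|K0 J1 K01 J11|].
- by rewrite divr_ge0 ?(ltW s0)// addr_ge0// subr_ge0.
- have -> : (2 - delta + gamma) / (2 - delta + 2 * gamma) = 1 / 2 + (1 - 1 * (delta / 2)) * kappa.
    by rewrite /kappa; field.
  by apply: head_growth => //; rewrite mul1r ler_pdivrMr// mul1r.
- have -> : (2 - delta + gamma) / (2 - delta + 2 * gamma) = 1 - gamma * kappa.
    by rewrite /kappa; field.
  exact: tail_growth.
Qed.

(** If delta <= 2 the linear bound gives sqrt r, and 1/2 <= 1/delta. If delta >
    2 the powers j^(-p delta / 2) are still summable for p above 2 / delta and
    arbitrarily close to it, which gives r^(p / 2). *)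
Lemma full_sum_order (S0 : R) J0 : 0 < delta -> (1 <= J0)%N -> (forall n, \sum_(J0 <= j < n) f j%:R <= S0) ->
  full_bound logM f -> growth_le logM (1 / delta).
Proof.
move=> d0 J01 hS0 [K0 [J [K01 H]]] eps e0.
have di : 0 < 1 / delta by rewrite divr_gt0.
suff [p [B [J1 [p0 pe B0 J1J hB]]]] : exists p B J1, [/\ 0 < p, p / 2 <= 1 / delta + eps, 0 <= B,
    (J <= J1)%N & forall r n, 1 <= r -> (J1 <= n)%N -> head_sum f K0 r J1 n <= B * expR (p / 2 * ln r)].
  have [K1 [R0 [K11 R01 hR]]] := H J1 J1J.
  have [Kl [R1 R11 hl]] := growth_le_ln (le_trans ler01 K11) (ltW di) e0.
  exists (Kl + 2 * B); exists (Num.max R0 R1); first by rewrite le_max R01.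
  move=> r; rewrite ge_max => /andP[hr hr1]; have r1 : 1 <= r by exact: le_trans hr.
  apply: (le_trans (hR r (2 * B * expR (p / 2 * ln r)) hr _)).
    by move=> n Jn; rewrite -[leRHS]mulrA ler_pM2l// hB.
  rewrite [leRHS]mulrDl; apply: lerD; first exact: hl.
  by rewrite ler_wpM2l ?mulr_ge0// ler_expR ler_wpM2r ?ln_ge0.
have [d2|d2] := leP delta 2.
  exists 1, (K0 * `|S0|), (maxn (maxn 1 J) J0); split => //.
  - have : 1 / 2 <= 1 / delta by rewrite !div1r lef_pV2 ?posrE.
    by move: e0; drop_facts; lra.
  - by rewrite mulr_ge0// (le_trans ler01).
  - by rewrite !leq_max leqnn orbT.
  move=> r n r1 Jn; have J11 : (1 <= maxn (maxn 1 J) J0)%N by rewrite !leq_max leqnn.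
  apply: (le_trans (head_sum_le_sum f0 r n (le_trans ler01 K01) J11)).
  rewrite -[leRHS]mulrA ler_wpM2l ?(le_trans ler01)// mulrC.
  have r0 : 0 < r by exact: lt_le_trans r1.
  have -> : expR (1 / 2 * ln r) = Num.sqrt r by rewrite -powR12_sqrt ?(ltW r0)// /powR gt_eqF// div1r.
  rewrite ler_wpM2r ?sqrtr_ge0//; apply: le_trans (ler_norm _); apply: le_trans (hS0 n.+1).
  by apply: ler_sum_widen => // [|j Jj]; [exact: leq_maxr|rewrite ltW// f0// ler1n (leq_trans J01)].
(* Any power p with p delta > 2 makes the sum of the p-th powers converge *)
pose p := Num.min 1 (2 * (1 / delta + eps)).
have p0 : 0 < p by rewrite lt_min ltr01 mulr_gt0// addr_gt0.
have p1 : p <= 1 by rewrite ge_min lexx.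
have pe : p / 2 <= 1 / delta + eps by rewrite ler_pdivrMr// mulrC ge_min lexx orbT.
have pd : 1 < p * (delta / 2).
  rewrite -ltr_pdivrMr ?divr_gt0// invfM invrK mul1r lt_min; apply/andP; split.
    by rewrite mulrC ltr_pdivrMr// mul1r.
  by rewrite mulrC ltr_pM2l// div1r ltrDl.
(* The excess of p delta / 2 over 1 is split between the error of the power
   bound and the convergence of the sum. *)
pose e := (p * (delta / 2) - 1) / 2.
have ee : 0 < e by rewrite divr_gt0// subr_gt0.
have [B [J2 [B0 J21 hB]]] := head_sum_power p0 p1 K01 ee.
have [B' B'0 hB'] := @sum_power R _ ee.
exists p, (B * B'), (maxn J J2); split => //; first by rewrite mulr_ge0 ?ltW.
  exact: leq_maxl.
move=> r n r1 _; apply: (le_trans (hB r _ n r1 (leq_maxr J J2))).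
rewrite -[leRHS]mulrA ler_pM2l// mulrC ler_wpM2r ?expR_ge0//; apply: le_trans (hB' n.+1).
have -> : - (p * (delta / 2)) + e = - (1 + e) by rewrite /e; field.
by apply: ler_sum_widen => //; rewrite leq_max J21 orbT.
Qed.

End power_cuts.

Section length_tail.
Context {R : realType}.
Variables (logM f D dl : R -> R) (tail : nat -> R) (delta delta_l delta_phi : R).
Hypothesis f0 : forall t, 1 <= t -> 0 < f t.
Hypothesis lnf : forall t, 1 <= t -> ln (f t) = - ln (D t) / 2.
Hypothesis Dp : potter D delta.
Hypothesis dl0 : forall t, 1 <= t -> 0 < dl t.
Hypothesis dlp : potter dl (- delta_l).
Hypothesis deltaE : delta = delta_l + delta_phi.
Variables (c : R) (Jt : nat).
Hypothesis c0 : 0 < c.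
Hypothesis tail_le : forall n S, (Jt <= n)%N ->
  (forall m, \sum_(n.+1 <= j < m) dl j%:R <= S) -> tail n <= c * S.

(** For delta_l > 1 the sum of d_l beyond n is O(n^(1 - delta_l + eps)). For
    delta_l <= 1 the exponent (1 - delta_l) / (delta_l - delta_phi) is
    nonnegative and it is enough that the sum is bounded. *)
Lemma dl_tail_growth (Sd : R) Jd : (1 <= Jd)%N -> (forall m, \sum_(Jd <= j < m) dl j%:R <= Sd) ->
  delta_phi < delta_l ->
  growth_le (fun r => r * tail (cut_index (1 / (delta_l - delta_phi)) r))
    (1 + (1 - delta_l) / (delta_l - delta_phi)).
Proof.
move=> Jd1 hSd dd eps e0; set kappa := 1 / _.
have p0 : 0 < delta_l - delta_phi by lra.
have k0 : 0 < kappa by rewrite divr_gt0.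
have kE : (1 - delta_l) / (delta_l - delta_phi) = (1 - delta_l) * kappa by rewrite /kappa div1r.
have [dl1|dl1] := leP delta_l 1.
  have [R0 R01 hR0] := @cut_index_large R kappa (maxn Jt Jd) k0.
  exists (c * `|Sd|); exists R0 => // r hr; have r1 : 1 <= r by lra.
  have r0 : 0 < r by lra.
  have lr : 0 <= ln r by rewrite ln_ge0.
  have := hR0 _ hr; rewrite geq_max => /andP[n1 n2].
  have ht : tail (cut_index kappa r) <= c * `|Sd|.
    apply: tail_le => // m; apply: le_trans (ler_norm _).
    apply: le_trans (hSd m); apply: ler_sum_widen => // [|j Jj]; first exact: leqW.
    by rewrite ltW// dl0// ler1n (leq_trans Jd1).
  apply: (le_trans (ler_wpM2l (ltW r0) ht)); rewrite mulrC ler_wpM2l ?mulr_ge0 ?(ltW c0)//.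
  rewrite -[leLHS]lnK ?posrE// ler_expR ler_peMl//.
  have : 0 <= (1 - delta_l) * kappa by rewrite mulr_ge0//; lra.
  by rewrite kE; lra.
pose ep := Num.min ((delta_l - 1) / 2) (eps / (2 * kappa)).
have ep0 : 0 < ep by rewrite lt_min; apply/andP; split; [lra|rewrite divr_gt0// mulr_gt0].
have ep1 : ep <= (delta_l - 1) / 2 by rewrite ge_min lexx.
have ep2 : 2 * ep * kappa <= eps.
  have h : ep <= eps / (2 * kappa) by rewrite ge_min lexx orbT.
  have k2 : 0 < 2 * kappa by rewrite mulr_gt0.
  by rewrite (ler_pdivlMr _ _ k2) in h; rewrite -mulrA mulrCA.
have [T T1 hT] := potter_power dlp ep0.
have [B B0 hB] := @sum_power R _ ep0.
have [R0 R01 hR0] := @cut_index_large R kappa (maxn Jt (Num.truncn T).+1) k0.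
exists (c * B); exists R0 => // r hr; have r1 : 1 <= r by lra.
have r0 : 0 < r by lra.
have lr : 0 <= ln r by rewrite ln_ge0.
have := hR0 _ hr; rewrite geq_max => /andP[n1 n2].
have [/andP[m1 m2] _] := cut_indexP (ltW k0) r1.
set n := cut_index kappa r in n1 n2 m1 m2 *.
have ht : tail n <= c * (B * expR ((1 - delta_l + 2 * ep) * ln n%:R)).
  apply: tail_le => // m.
  apply: (@le_trans _ _ (\sum_(n.+1 <= j < m) expR (- (1 + ep) * ln j%:R) * expR ((1 - delta_l + 2 * ep) * ln n%:R))).
    apply: ler_sum_nat => j /andP[nj _].
    have Tj : T <= j%:R by apply: natr_ge_truncn; exact: leq_trans n2 (ltnW nj).
    have j1 : 1 <= j%:R :> R by lra.
    rewrite -expRD -[leLHS]lnK ?posrE ?dl0// ler_expR.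
    have := hT _ Tj; rewrite ler_norml => /andP[_ h].
    have : ln n%:R <= ln j%:R :> R by rewrite ler_ln ?posrE ?ltr0n ?(leq_trans _ nj)// ler_nat ltnW.
    have h2 : 1 - delta_l + 2 * ep <= 0 by lra.
    by move=> /(ler_wnM2l h2); lra.
  rewrite -mulr_suml ler_wpM2r ?expR_ge0//.
  by apply: le_trans (hB m); apply: ler_sum_widen.
apply: (le_trans (ler_wpM2l (ltW r0) ht)).
have -> : r * (c * (B * expR ((1 - delta_l + 2 * ep) * ln n%:R))) =
  c * B * (r * expR ((1 - delta_l + 2 * ep) * ln n%:R)) by ring.
rewrite ler_pM2l ?mulr_gt0// -[X in X * _]lnK ?posrE// -expRD ler_expR.
have h2 : 1 - delta_l + 2 * ep <= 0 by lra.
have h3 := ler_wnM2l h2 m1.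
have h4 : 2 * ep * kappa * ln r <= eps * ln r by rewrite ler_wpM2r.
rewrite kE; lra.
Qed.

(** The cut r^kappa with kappa = 1 / (delta_l - delta_phi) is where the weight
    sqrt(d_phi / (r d_l)) reaches 1, that is, the size of h(r). *)
Lemma length_tail_order (Sd : R) Jd : (1 <= Jd)%N -> (forall m, \sum_(Jd <= j < m) dl j%:R <= Sd) ->
  delta_phi < delta_l -> delta <= 2 -> cut_bound logM f tail ->
  growth_le logM ((1 - delta_phi) / (delta_l - delta_phi)).
Proof.
move=> Jd1 hSd dd d2 cb.
have p0 : 0 < delta_l - delta_phi by lra.
have pne : delta_l - delta_phi != 0 by rewrite gt_eqF.
have k0 : 0 < 1 / (delta_l - delta_phi) by rewrite divr_gt0.
apply: (cut_growth k0 _ cb).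
- by rewrite divr_ge0//; move: d2; rewrite deltaE; lra.
- move=> K0' J1 K0'1 J11.
  have -> : (1 - delta_phi) / (delta_l - delta_phi) =
      1 / 2 + (1 - 1 * (delta / 2)) * (1 / (delta_l - delta_phi)) by rewrite deltaE; field.
  by apply: (head_growth f0 lnf Dp) => //; rewrite mul1r ler_pdivrMr// mul1r.
- have -> : (1 - delta_phi) / (delta_l - delta_phi) = 1 + (1 - delta_l) / (delta_l - delta_phi) by field.
  exact: (dl_tail_growth Jd1 hSd dd).
Qed.

End length_tail.

(** * The cut at an asymptotic inverse *)

Section inverse_cut.
Context {R : realType}.

Lemma potter_doubling (g : R -> R) a : (forall t, 1 <= t -> 0 < g t) -> potter g a ->
  exists K, exists2 T, 1 <= K /\ 1 <= T & forall s t, T <= s -> s <= t -> t <= 2 * s ->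
  g t <= K * g s /\ g s <= K * g t.
Proof.
move=> g0 gp; have [K [T T1 hT]] := gp 1 ltr01.
exists (expR (`|a| + 1 + `|K|)); exists T.
  by split => //; rewrite -[leLHS]expR0 ler_expR !addr_ge0.
move=> s t Ts st ts.
have s0 : 0 < s by lra.
have d0 : 0 <= ln t - ln s by rewrite subr_ge0 ler_ln ?posrE//; lra.
have d1 : ln t - ln s <= 1.
  apply: le_trans (@ln2_le1 R); rewrite lerBlDr -lnM ?posrE// ler_ln ?posrE ?mulr_gt0//; lra.
have gs : 0 < g s by apply: g0; lra.
have gt : 0 < g t by apply: g0; lra.
have := hT _ _ Ts st.
have : `|a * (ln t - ln s)| <= `|a| by rewrite normrM (ger0_norm d0) ler_piMr.
have := ler_norm K; rewrite !ler_norml => k /andP[a1 a2] /andP[h1 h2].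
split.
  by rewrite -[leLHS]lnK ?posrE// -[X in _ * X]lnK ?posrE// -expRD ler_expR; lra.
by rewrite -[leLHS]lnK ?posrE// -[X in _ * X]lnK ?posrE// -expRD ler_expR; lra.
Qed.

Lemma sim_half (F b : R -> R) : sim (F \o b) id ->
  exists2 X, 1 <= X & forall x, X <= x -> x / 2 <= F (b x) /\ F (b x) <= 2 * x.
Proof.
have h2 : (0 : R) < 2^-1 by [].
move=> /cvgrPdist_lt /(_ _ h2) /near_pinftyE[X X1 hX]; exists X => // x Xx.
have x0 : 0 < x by lra.
have := hX _ Xx; rewrite /= ltr_distlC => /andP[h1 h3]; split.
  have : 2^-1 < F (b x) / x by lra.
  by rewrite ltr_pdivlMr//; lra.
have : F (b x) / x < 2 by lra.
by rewrite ltr_pdivrMr//; lra.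
Qed.

(** The scheme shared by both bounds of the form r / C(F^-(r)): it is enough
    that at every N with F(N) comparable to r the logarithms and the head are
    O(r / C(N)). The cut is placed at the integer part of N = F^-(r), which
    tends to infinity, and doubling for C absorbs the rounding. *)
Lemma bound_at_inverse (logM f C F f_inv : R -> R) (gamma K T : R) :
  (forall t, 1 <= t -> 0 < C t) -> potter C gamma -> cut_bound logM f (fun n => 1 / C n%:R) ->
  asymptotic_inverse F f_inv -> 1 <= T -> (forall t, T <= t -> F (2 * t) <= K * F t) ->
  (forall A, exists2 T', 1 <= T' & forall t, T' <= t -> A <= F t) ->
  (exists B T', forall N r, T' <= N -> 1 <= r -> r / 2 <= F N -> F N <= 2 * r ->
     1 + ln r + ln N <= B * (r / C N)) ->
  (forall K0, 1 <= K0 -> exists B J2 T', forall J1 n N r, (J2 <= J1)%N -> (J1 <= n)%N ->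
     T' <= N -> N / 2 <= n%:R -> n%:R <= N -> 1 <= r -> r / 2 <= F N -> F N <= 2 * r ->
     head_sum f K0 r J1 n <= B * (r / C N)) ->
  lesssim_near +oo logM (fun r => r / C (f_inv r)).
Proof.
move=> C0 Cp [K0 [J [K01 H]]] Finv T1 Fd Finf [B1 [T2 hlog]] hhead.
have [Kc [Tc [Kc1 Tc1] hC]] := potter_doubling C0 Cp.
have large := asymptotic_inverse_large Finv T1 Fd Finf.
have [X1 X11 hX1] := sim_half (let: And3 _ h _ := Finv in h).
have [B2 [J2 [T3 {}hhead]]] := hhead _ K01.
have [K1 [N0 [K11 J1N hN]]] := H (maxn J J2) (leq_maxl _ _).
have [X2 X21 hX2] := large (Num.max (Num.max (2 * Tc) (2 * N0.+1%:R)) (Num.max T2 T3)).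
have K10 : 0 < K1 by exact: lt_le_trans K11.
exists (K1 * `|B1| + 2 * `|B2| + K1 * Kc).
  by rewrite ltr_wpDl ?addr_ge0 ?mulr_ge0 ?(ltW K10)// mulr_gt0// (lt_le_trans ltr01).
apply/near_pinftyE; exists (Num.max X1 X2); first by rewrite le_max X11.
move=> r; rewrite ge_max => /andP[r1 r2].
have rr1 : 1 <= r by exact: le_trans r1.
have r0 : 0 < r by exact: lt_le_trans rr1.
have [Fr1 Fr2] := hX1 _ r1; have := hX2 _ r2.
set N := f_inv r in Fr1 Fr2 *; rewrite !ge_max => /andP[/andP[Nc NN] /andP[NT2 NT3]].
have N02 : 2 <= N by apply: le_trans NN; rewrite ler_peMr// ler1n.
have [n1 n2] := truncn_half N02; set n := Num.truncn N in n1 n2 *.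
have N2N : N0.+1%:R <= N / 2 by rewrite ler_pdivlMr// mulrC.
have N0n : (N0 <= n)%N.
  by rewrite -(ler_nat R); apply: le_trans (le_trans N2N n1); rewrite ler_nat.
have c2N : Tc <= n%:R by apply: le_trans n1; rewrite ler_pdivlMr// mulrC.
have nn1 : 1 <= n%:R :> R by exact: le_trans c2N.
have CN : 0 < C N by apply: C0; exact: le_trans n2.
have T00 : 0 <= r / C N by rewrite divr_ge0// ltW.
apply: (le_trans (hN r n rr1 N0n)).
have h1 := hhead _ n N r (leq_maxr J J2) (leq_trans J1N N0n) NT3 n1 n2 rr1 Fr1 Fr2.
have h2 := hlog N r NT2 rr1 Fr1 Fr2.
have h3 : ln n%:R <= ln N by rewrite ler_ln ?posrE// (lt_le_trans ltr01)// (le_trans nn1).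
have h4 : r * (1 / C n%:R) <= Kc * (r / C N).
  have [e2 _] := hC n%:R N c2N n2 ltac:(by move: n1; rewrite ler_pdivrMr// mulrC).
  rewrite div1r mulrCA ler_pM2l// ler_pdivlMr// -ler_pdivlMl ?invr_gt0 ?C0// invrK.
  by rewrite mulrC.
have u1 : K1 * (1 + ln r + ln n%:R) <= K1 * (`|B1| * (r / C N)).
  rewrite ler_pM2l//; apply: (@le_trans _ _ (B1 * (r / C N))).
    by apply: le_trans h2; rewrite lerD2l.
  by rewrite ler_wpM2r// ler_norm.
have u2 : B2 * (r / C N) <= `|B2| * (r / C N) by rewrite ler_wpM2r// ler_norm.
have u3 : K1 * (r * (1 / C n%:R)) <= K1 * (Kc * (r / C N)) by rewrite ler_pM2l.
move: h1 u1 u2 u3; move: (head_sum _ _ _ _ _) (r * (1 / C n%:R)) (r / C N) => u v w.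
by drop_facts; lra.
Qed.

End inverse_cut.

(** * The cut with a logarithmic factor *)

(** Here y = alpha t C / D >= 4 and F = t C log y, so that r comparable to F(N)
    means that r / C(N) is comparable to N log y. *)
Section logarithmic_cut.
Context {R : realType}.
Variables (f D C F : R -> R) (delta gamma alpha : R).
Hypothesis f0 : forall t, 1 <= t -> 0 < f t.
Hypothesis lnf : forall t, 1 <= t -> ln (f t) = - ln (D t) / 2.
Hypothesis D0 : forall t, 1 <= t -> 0 < D t.
Hypothesis Dp : potter D delta.
Hypothesis C0 : forall t, 1 <= t -> 0 < C t.
Hypothesis Cp : potter C gamma.
Let y t := alpha * (t * C t / D t).
Hypothesis y4 : forall t, 1 <= t -> 4 <= y t.
Hypothesis FE : forall t, F t = t * C t * ln (y t).

Let y_ge1 t : 1 <= t -> 1 <= y t.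
Proof. by move=> /y4; apply: le_trans; rewrite ler1n. Qed.

Let y_gt0 t : 1 <= t -> 0 < y t.
Proof. by move=> /y_ge1; exact: lt_le_trans. Qed.

Lemma ln4_ge1 : 1 <= ln 4 :> R.
Proof.
have -> : 4 = 2 * 2 :> R by ring.
rewrite lnM ?posrE//.
have : ln (1 + - 2^-1) <= - 2^-1 :> R by apply: le_ln1Dx; lra.
have -> : 1 + - 2^-1 = 2^-1 :> R by lra.
by rewrite lnV ?posrE//; lra.
Qed.

Let ly_ge1 t : 1 <= t -> 1 <= ln (y t).
Proof. by move=> t1; apply: (le_trans ln4_ge1); rewrite ler_ln ?posrE ?y_gt0 ?y4. Qed.

Lemma log_cut_doubling : 0 < alpha -> exists K, exists2 T, 1 <= T &
  forall t, T <= t -> F (2 * t) <= K * F t.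
Proof.
move=> a0; have [Kc [Tc [Kc1 Tc1] hC]] := potter_doubling C0 Cp.
have [Kd [Td [Kd1 Td1] hD]] := potter_doubling D0 Dp.
exists (2 * Kc * (ln (2 * Kc * Kd) + 1)); exists (Num.max Tc Td); first by rewrite le_max Tc1.
move=> t; rewrite ge_max => /andP[tc td].
have t1 : 1 <= t by exact: le_trans tc.
have tt : t <= 2 * t by rewrite ler_peMl ?ler1n// (le_trans ler01).
have t2 : 1 <= 2 * t by exact: le_trans tt.
have t0 : 0 < t by exact: lt_le_trans t1.
have [c1 _] := hC t (2 * t) tc tt (lexx _); have [_ e1] := hD t (2 * t) td tt (lexx _).
have Dt := D0 t1; have Dt2 := D0 t2.
have KK1 : 1 <= 2 * Kc * Kd by apply: mulr_ege1 => //; apply: mulr_ege1 => //; rewrite ler1n.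
have KK0 : 0 < 2 * Kc * Kd by exact: lt_le_trans KK1.
have tC : 2 * t * C (2 * t) <= 2 * Kc * (t * C t).
  have -> : 2 * Kc * (t * C t) = 2 * t * (Kc * C t) by ring.
  by rewrite ler_pM2l// mulr_gt0.
have yy : y (2 * t) <= 2 * Kc * Kd * y t.
  have -> : 2 * Kc * Kd * y t = alpha * (2 * Kc * (t * C t) * (Kd / D t)) by rewrite /y; ring.
  rewrite /y ler_pM2l//; apply: ler_pM => //.
  - by rewrite mulr_ge0 ?(ltW (C0 t2))// mulr_ge0// ltW.
  - by rewrite invr_ge0 ltW.
  - by rewrite ler_pdivlMr// mulrC ler_pdivrMr.
have l1 : ln (y (2 * t)) <= (ln (2 * Kc * Kd) + 1) * ln (y t).
  apply: (@le_trans _ _ (ln (2 * Kc * Kd) + ln (y t))).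
    by rewrite -lnM ?posrE ?y_gt0// ler_ln ?posrE ?y_gt0// (mulr_gt0 KK0 (y_gt0 t1)).
  by rewrite [leRHS]mulrDl mul1r lerD2r ler_peMr ?ly_ge1// ln_ge0.
rewrite !FE; have -> : 2 * Kc * (ln (2 * Kc * Kd) + 1) * (t * C t * ln (y t)) =
    (2 * Kc * (t * C t)) * ((ln (2 * Kc * Kd) + 1) * ln (y t)) by ring.
apply: ler_pM => //; first by rewrite mulr_ge0 ?(ltW (C0 t2))// mulr_ge0// ltW.
exact: le_trans (ly_ge1 t2).
Qed.

Lemma log_cut_ge : (exists2 T, 1 <= T & forall t, T <= t -> 1 <= C t) ->
  exists2 T, 1 <= T & forall t, T <= t -> t <= F t.
Proof.
move=> [T T1 hT]; exists T => // t Tt; have t1 : 1 <= t by exact: le_trans Tt.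
have t0 : 0 <= t by exact: le_trans t1.
rewrite FE -mulrA ler_peMr//; exact: mulr_ege1 (hT _ Tt) (ly_ge1 t1).
Qed.

(** F(N) / C(N) = N log y dominates log N, log C(N) and log y, and log r is
    their sum up to constants. *)
Lemma log_cut_logs : (exists2 T, 1 <= T & forall t, T <= t -> 1 <= C t) -> 0 <= gamma ->
  exists B T', forall N r, T' <= N -> 1 <= r -> r / 2 <= F N -> F N <= 2 * r ->
     1 + ln r + ln N <= B * (r / C N).
Proof.
move=> C1 g0; have [T2 T21 hT2] := potter_power Cp ltr01; have [T1 T11 hT1] := log_cut_ge C1.
exists (2 * (gamma + 6)), T2 => N r NT r1 Fr1 Fr2.
have N1 : 1 <= N by exact: le_trans NT.
have N0 : 0 < N by exact: lt_le_trans N1.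
have CN := C0 N1; have y0 := y_gt0 N1; have ly := ly_ge1 N1.
have ly0 : 0 < ln (y N) by exact: lt_le_trans ly.
set u := N * ln (y N).
have uT : u <= 2 * (r / C N).
  by rewrite mulrA ler_pdivlMr// /u mulrAC -FE.
have NC0 : 0 < N * C N by rewrite mulr_gt0.
have Nu : N <= u by rewrite /u ler_peMr// ltW.
have lyu : ln (y N) <= u by rewrite /u ler_peMl// ltW.
have lnN : ln N <= u by exact: le_trans (ln_le_self N0) Nu.
have u1 : 1 <= u by exact: le_trans Nu.
have lnC : ln (C N) <= (gamma + 1) * u.
  have := hT2 _ NT; rewrite ler_norml => /andP[_ h].
  apply: (@le_trans _ _ ((gamma + 1) * ln N)); first by move: h; lra.
  by rewrite ler_wpM2l// addr_ge0.
have lnr : ln r <= 1 + (ln N + ln (C N)) + ln (y N).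
  have r0 : 0 < r by exact: lt_le_trans r1.
  apply: (@le_trans _ _ (ln (2 * (N * C N * ln (y N))))).
    rewrite ler_ln ?posrE ?mulr_gt0// -FE; move: Fr1; rewrite ler_pdivrMr// mulrC; exact: id.
  rewrite lnM ?posrE ?mulr_gt0// lnM ?posrE// lnM ?posrE//.
  have := ln_le_self ly0; have := @ln2_le1 R; lra.
have guT : (gamma + 6) * u <= (gamma + 6) * (2 * (r / C N)) by rewrite ler_wpM2l// addr_ge0.
rewrite -[leRHS]mulrA [leRHS]mulrCA; apply: le_trans guT.
have u2 : ln (ln (y N)) <= ln (y N) by exact: ln_le_self.
lra.
Qed.

(** r is at most about N C(N) y = y^2 D(N) / alpha, so [head_sum_log] bounds the
    head by a multiple of N log y. *)
Lemma log_cut_head K0 : 1 <= K0 -> 0 <= delta -> 0 < alpha ->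
  exists B J2 T', forall J1 n N r, (J2 <= J1)%N -> (J1 <= n)%N ->
     T' <= N -> N / 2 <= n%:R -> n%:R <= N -> 1 <= r -> r / 2 <= F N -> F N <= 2 * r ->
     head_sum f K0 r J1 n <= B * (r / C N).
Proof.
move=> K01 d0 a0; pose A := Num.max 1 (2 / alpha).
have A1 : 1 <= A by rewrite le_max lexx.
have A2 : 2 / alpha <= A by rewrite le_max lexx orbT.
have [B [J2 [B1 J21 hB]]] := head_sum_log D0 f0 lnf Dp d0 K01 A1.
have B0 : 0 < B by exact: lt_le_trans B1.
exists (4 * B), J2, 1 => J1 n N r JJ Jn N1 n1 n2 r1 Fr1 Fr2.
have N0 : 0 < N by exact: lt_le_trans N1.
have CN := C0 N1; have DN := D0 N1; have yN := y_ge1 N1; have ly := ly_ge1 N1.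
have r0 : 0 < r by exact: lt_le_trans r1.
have yE : N * C N = y N * D N / alpha by rewrite /y; field; rewrite !gt_eqF.
have hr : r <= A * y N ^+ 2 * D N.
  have e0 : 0 <= y N * D N / alpha by rewrite -yE mulr_ge0// ltW.
  have e1 : F N <= y N * D N / alpha * y N.
    by rewrite FE yE ler_wpM2l// ln_le_self// y_gt0.
  have e2 : 2 / alpha * (y N ^+ 2 * D N) <= A * (y N ^+ 2 * D N).
    by rewrite ler_wpM2r// mulr_ge0 ?sqr_ge0// ltW.
  rewrite -mulrA; apply: le_trans e2; move: Fr1; rewrite ler_pdivrMr// => Fr1.
  apply: (le_trans Fr1); have -> : 2 / alpha * (y N ^+ 2 * D N) = y N * D N / alpha * y N * 2.
    by ring.
  by rewrite ler_pM2r.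
apply: (le_trans (hB J1 n N (y N) r JJ Jn n1 n2 yN r0 hr)).
rewrite [4 * B]mulrC -mulrA ler_pM2l//; apply: (@le_trans _ _ (N * (2 * ln (y N)))).
  apply: ler_pM => //; first by rewrite addr_ge0// ln_ge0.
  by rewrite mulr_natl mulr2n lerD2r.
have : N * ln (y N) <= 2 * (r / C N) by rewrite mulrA ler_pdivlMr// mulrAC -FE.
have -> : 4 * (r / C N) = 2 * (2 * (r / C N)) by ring.
by move=> h; rewrite [leLHS]mulrCA ler_pM2l.
Qed.

End logarithmic_cut.

Lemma log_cut_bound (R : realType) (logM f D C F f_inv : R -> R) (delta gamma alpha : R) :
  (forall t, 1 <= t -> 0 < f t) -> (forall t, 1 <= t -> ln (f t) = - ln (D t) / 2) ->
  (forall t, 1 <= t -> 0 < D t) -> potter D delta ->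
  (forall t, 1 <= t -> 0 < C t) -> potter C gamma ->
  (exists2 T, 1 <= T & forall t, T <= t -> 1 <= C t) ->
  cut_bound logM f (fun n => 1 / C n%:R) -> 0 <= delta -> 0 <= gamma -> 0 < alpha ->
  (forall t, 1 <= t -> 4 <= alpha * (t * C t / D t)) ->
  (forall t, F t = t * C t * ln (alpha * (t * C t / D t))) ->
  asymptotic_inverse F f_inv -> lesssim_near +oo logM (fun r => r / C (f_inv r)).
Proof.
move=> f0 lnf D0 Dp C0 Cp C1 cb d0 g0 a0 y4 FE Finv.
have [K [T T1 Fd]] := log_cut_doubling D0 Dp C0 Cp y4 FE a0.
apply: (bound_at_inverse C0 Cp cb Finv T1 Fd) => [A||K0 K01].
- have [T' T'1 hT'] := log_cut_ge y4 FE C1; exists (Num.max T' A); first by rewrite le_max T'1.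
  by move=> t; rewrite ge_max => /andP[h1 h2]; apply: le_trans h2 (hT' _ h1).
- exact: log_cut_logs C0 Cp y4 FE C1 g0.
- exact (log_cut_head f0 lnf D0 Dp C0 y4 FE K01 d0 a0).
Qed.

(** * The cut at the inverse of a weighted primitive *)

Section primitive.
Context {R : realType}.
Variables (f : R -> R) (K T : R).
Hypothesis mf : measurable_fun (`[1, +oo[ : set R) f.
Hypothesis f0 : forall t, 1 <= t -> 0 < f t.
Hypothesis T1 : 1 <= T.
Hypothesis K0 : 0 < K.
Hypothesis fK : forall s t, T <= s -> s <= t -> f t <= K * f s.
Local Notation mu := (@lebesgue_measure R).
Hypothesis floc : forall t, 1 <= t -> (\int[mu]_(x in `[1%R, t]) (f x)%:E < +oo)%E.
Let f0' t : 1 <= t -> 0 <= f t. Proof. by move=> /f0 /ltW. Qed.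
Let I (t : R) := \int[mu]_(x in `[1, t]) f x.

Let itv1 (t : R) : `[1, t]%classic `<=` (`[1, +oo[%classic : set R).
Proof. by move=> x /= /itvP h; rewrite in_itv/= andbT h. Qed.

Lemma primitiveE t : 1 <= t -> (\int[mu]_(x in `[1%R, t]) (f x)%:E = (I t)%:E)%E.
Proof.
move=> t1; rewrite /I /Rintegral fineK// ge0_fin_numE; first exact: floc.
by apply: integral_ge0 => x /itv1; rewrite /= in_itv/= andbT lee_fin; exact: f0'.
Qed.

Lemma primitive_ge a t x c : 1 <= a -> a <= t -> 0 < c ->
  (x%:E <= c%:E * \int[mu]_(x in `]a, t]) (f x)%:E)%E -> x <= c * I t.
Proof.
move=> a1 at_ c0; apply: (le_Rintegral_of_sub mf f0') => //.
- by move=> y /= /itvP h; rewrite in_itv/= (le_trans a1) ?h.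
- by apply: floc; exact: le_trans at_.
Qed.

Lemma primitive_nondecreasing s t : 1 <= s -> s <= t -> I s <= I t.
Proof.
move=> s1 st; rewrite -lee_fin -!primitiveE//; last exact: le_trans st.
apply: ge0_subset_integral => //.
- by apply: (measurable_ge1 mf); [exact: measurable_itv|exact: itv1].
- by move=> x /itv1; rewrite /= in_itv/= andbT lee_fin; exact: f0'.
- by move=> x /= /itvP h; rewrite in_itv/= h (le_trans _ st)// h.
Qed.

Lemma primitive_ge_last t : 2 * T <= t -> t * f t <= 2 * K * I t.
Proof.
have T1' := T1; have K0' := K0.
move=> Tt; have t2 : T <= t / 2 by lra.
have t3 : t / 2 <= t by lra.
have K2 : 0 < 2 * K by lra.
apply: (@primitive_ge (t / 2)) => //; first by move: T1; lra.
have := integral_itv_ge mf f0' T1 K0 fK t2 t3.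
have -> : t - t / 2 = t / 2 by field.
have -> : t * f t = 2 * (t / 2 * f t) by field.
by move=> h; rewrite (EFinM 2) (EFinM 2 K) -muleA lee_pmul2l.
Qed.

Lemma primitive_gt0 t : 2 * T <= t -> 0 < I t.
Proof.
have T1' := T1; have K0' := K0.
move=> h; have := primitive_ge_last h.
have tp : 0 < t * f t by rewrite mulr_gt0 ?f0//; lra.
move=> /(lt_le_trans tp); rewrite pmulr_rgt0//; lra.
Qed.

(** The integral over [t, 2 t] is at most K t f(t), and t f(t) is in turn at
    most 2 K times the integral over [t / 2, t]. *)
Lemma primitive_doubling t : 2 * T <= t -> I (2 * t) <= (1 + 2 * K ^+ 2) * I t.
Proof.
have T1' := T1; have K0' := K0.
move=> Tt; have t1 : 1 <= t by lra.
have tt : t <= 2 * t by lra.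
have t2 : 1 <= 2 * t by lra.
have h1 := primitive_ge_last Tt.
suff : ((I (2 * t))%:E <= (I t)%:E + ((2 * t - t) * (K * f t))%:E)%E.
  rewrite -EFinD lee_fin => h; apply: (le_trans h); rewrite [leRHS]mulrDl mul1r lerD2l.
  have -> : (2 * t - t) * (K * f t) = K * (t * f t) by ring.
  have : K * (t * f t) <= K * (2 * K * I t) by rewrite ler_pM2l.
  lra.
have h2 : T <= t by lra.
rewrite -!primitiveE//.
apply: (@le_trans _ _ (\int[mu]_(x in `[1%R, t]) (f x)%:E + \int[mu]_(x in `[t, (2 * t)%R]) (f x)%:E)%E); last first.
  by apply: leeD2l; exact: (integral_itv_le mf f0' T1 K0 fK h2 tt).
have -> : `[1, 2 * t]%classic = (`[1, t] `|` `]t, 2 * t])%classic :> set R.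
  apply/seteqP; split => x /=; rewrite !in_itv/=.
    by move=> /andP[ax xc]; have [xb|bx] := leP x t; [left|right]; rewrite ?ax ?xc.
  by move=> [/andP[ax xb]|/andP[bx ->]]; rewrite ?ax ?(le_trans xb)//= (le_trans t1)// ltW.
have meas (A : set R) : measurable A -> A `<=` `[1, +oo[ -> measurable_fun A (fun x => (f x)%:E).
  exact: (measurable_ge1 mf).
have sub : `[t, 2 * t]%classic `<=` (`[1, +oo[%classic : set R).
  by move=> x /= /itvP h; rewrite in_itv/= andbT (le_trans t1)// h.
rewrite ge0_integral_setU//.
- apply: leeD2l; apply: ge0_subset_integral => //.
  + by apply: meas => //; exact: measurable_itv.
  + by move=> x /sub; rewrite /= in_itv/= andbT lee_fin; exact: f0'.
  + by move=> x /= /itvP h; rewrite in_itv/= !h.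
- apply: meas; first exact: measurableU.
  by rewrite subUset; split; [exact: itv1|exact: itv_ge1].
- move=> x [/itv1|/(@itv_ge1 _ _ _ t1)]; rewrite /= in_itv/= andbT lee_fin; exact: f0'.
- apply/disj_setPS => x [/=]; rewrite !in_itv/= => /andP[_ xb] /andP[bx _].
  by move: (le_lt_trans xb bx); rewrite ltxx.
Qed.

Lemma sum_le_primitive (m n : nat) t : T <= m%:R -> (m <= n)%N -> n%:R <= t ->
  \sum_(m.+1 <= j < n.+1) f j%:R <= K * I t.
Proof.
have T1' := T1; have K0' := K0.
move=> Tm mn nt; have mn' : m%:R <= n%:R :> R by rewrite ler_nat.
apply: (@le_trans _ _ (K * I n%:R)).
  apply: (@primitive_ge m%:R) => //; first by lra.
  exact: (sum_le_integral mf f0' T1 K0 fK).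
by rewrite ler_pM2l// primitive_nondecreasing//; lra.
Qed.

Variables (D C : R -> R) (delta gamma : R).
Hypothesis lnf : forall t, 1 <= t -> ln (f t) = - ln (D t) / 2.
Hypothesis Dp : potter D delta.
Hypothesis C0 : forall t, 1 <= t -> 0 < C t.
Hypothesis Cp : potter C gamma.

(** If gamma > 0 the factor C is a positive power. Otherwise delta < 2, and the
    integral is at least t f(t) / (2 K), of exponent 1 - delta / 2. This is
    where (delta, gamma) = (2, 0) has to be excluded. *)
Lemma weighted_primitive_power : 0 <= gamma -> delta <= 2 -> 0 < 2 - delta + 2 * gamma ->
  exists e c T2, [/\ 0 < e, 1 <= T2 & forall t, T2 <= t -> e * ln t <= ln (C t * I t) + c].
Proof.
have T1' := T1; have K0' := K0.
move=> g0 d2 gd.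
have [g1|g1] := ltP 0 gamma.
  have e0 : 0 < gamma / 2 by lra.
  have [T2 T21 hT2] := potter_power Cp e0.
  have I0 := primitive_gt0 (lexx _).
  exists (gamma / 2), (- ln (I (2 * T))), (Num.max T2 (2 * T)); split => //; first by rewrite le_max T21.
  move=> t; rewrite ge_max => /andP[h1 h2].
  have t1 : 1 <= t by lra.
  have := hT2 _ h1; rewrite ler_norml => /andP[h3 _].
  have It := primitive_gt0 h2.
  have : ln (I (2 * T)) <= ln (I t).
    by rewrite ler_ln ?posrE//; apply: primitive_nondecreasing => //; lra.
  by rewrite lnM ?posrE ?C0//; lra.
have ge : gamma = 0 by lra.
have e0 : 0 < (2 - delta) / 8 by lra.
have [T2 T21 hT2] := potter_power Cp e0.
have [T3 T31 hT3] := potter_power Dp e0.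
exists ((2 - delta) / 4), (ln (2 * K)), (Num.max (Num.max T2 T3) (2 * T)).
split => //; [lra|by rewrite !le_max T21|].
move=> t; rewrite !ge_max => /andP[/andP[h1 h2] h3].
have t1 : 1 <= t by lra.
have t0 : 0 < t by lra.
have := hT2 _ h1; rewrite ler_norml => /andP[u1 _].
have := hT3 _ h2; rewrite ler_norml => /andP[_ u2].
have It := primitive_gt0 h3; have ft := f0 t1.
have := primitive_ge_last h3.
have K2 : 0 < 2 * K by lra.
have tf := mulr_gt0 t0 ft; have KI := mulr_gt0 K2 It.
rewrite -ler_ln ?posrE// (lnM (x := t)) ?posrE// (lnM (x := 2 * K)) ?posrE//.
rewrite (lnM (x := C t)) ?posrE ?C0// lnf//.
move: u1 u2; rewrite ge; have lt0 : 0 <= ln t by rewrite ln_ge0.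
nra.
Qed.

Hypothesis Cinf : forall A, exists2 T', 1 <= T' & forall t, T' <= t -> A <= C t.
Variable F : R -> R.
Hypothesis FE : forall t, F t = (C t * I t) ^+ 2.
Let i0 : 0 < I (2 * T) := primitive_gt0 (lexx _).

Let T20 : 1 <= 2 * T.
Proof. by rewrite (le_trans T1)// ler_peMl ?ler1n// (le_trans ler01). Qed.

Lemma primitive_ge_initial t : 2 * T <= t -> I (2 * T) <= I t.
Proof. exact: primitive_nondecreasing. Qed.

Lemma primitive_cut_doubling : exists K', exists2 T', 1 <= T' & forall t, T' <= t -> F (2 * t) <= K' * F t.
Proof.
have [Kc [Tc [Kc1 Tc1] hC]] := potter_doubling C0 Cp.
exists ((Kc * (1 + 2 * K ^+ 2)) ^+ 2); exists (Num.max Tc (2 * T)); first by rewrite le_max Tc1.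
move=> t; rewrite ge_max => /andP[tc td]; rewrite !FE -exprMn.
have t1 : 1 <= t by exact: le_trans tc.
have tt : t <= 2 * t by rewrite ler_peMl ?ler1n// (le_trans ler01).
have [c1 _] := hC t (2 * t) tc tt (lexx _).
have p := mulr_gt0 (C0 (le_trans t1 tt)) (primitive_gt0 (le_trans td tt)).
have q : 0 < C (2 * t) by exact: C0 (le_trans t1 tt).
have h : C (2 * t) * I (2 * t) <= Kc * (1 + 2 * K ^+ 2) * (C t * I t).
  rewrite mulrACA; apply: ler_pM => //; [exact: ltW|exact: ltW (primitive_gt0 (le_trans td tt))|].
  exact: primitive_doubling.
by rewrite ler_pXn2r// ?nnegrE ?(ltW p)// (le_trans (ltW p)).
Qed.

Lemma primitive_cut_infinite A : exists2 T', 1 <= T' & forall t, T' <= t -> A <= F t.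
Proof.
have [T' T'1 hT'] := Cinf (Num.max 1 A / I (2 * T)).
exists (Num.max T' (2 * T)); first by rewrite le_max T'1.
move=> t; rewrite ge_max => /andP[h1 h2].
have M1 : 1 <= Num.max 1 A by rewrite le_max lexx.
have := hT' _ h1; rewrite ler_pdivrMr// => h3.
have h5 : Num.max 1 A <= C t * I t.
  apply: (le_trans h3); rewrite ler_pM2l ?C0 ?(le_trans T20 h2)//.
  exact: primitive_ge_initial.
rewrite FE; apply: (@le_trans _ _ (Num.max 1 A)); first by rewrite le_max lexx orbT.
by apply: (le_trans h5); rewrite expr2 ler_peMr// ?(le_trans M1)// (le_trans ler01)// (le_trans M1).
Qed.

(** sqrt r is comparable to C(N) I(N), so both sides are comparable to C(N)
    I(N)^2. *)
Let sqrt_primitive N r : 2 * T <= N -> 1 <= r -> F N <= 2 * r ->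
  Num.sqrt r * I N <= 2 * (r / C N).
Proof.
move=> TN r1 Fr; have r0 : 0 <= r by exact: le_trans r1.
have CN : 0 < C N by apply: C0; exact: le_trans TN.
have CI0 : 0 < C N * I N by rewrite mulr_gt0// primitive_gt0.
have s0 := sqrtr_ge0 r; have ss := sqr_sqrtr r0.
rewrite mulrA ler_pdivlMr// -{2}ss -mulrA [I N * _]mulrC expr2 [2 * _]mulrCA ler_wpM2l//.
rewrite -(ler_pXn2r (n := 2)) ?nnegrE ?(ltW CI0) ?mulr_ge0// -FE exprMn ss.
by apply: (le_trans Fr); rewrite ler_wpM2r// expr2 ler_peMr ?ler1n.
Qed.

(** log N is O(C I) by [weighted_primitive_power], hence O(sqrt r), and sqrt r
    is O(r / C(N)) because the integral is bounded below. *)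
Lemma primitive_cut_logs : 0 <= gamma -> delta <= 2 -> 0 < 2 - delta + 2 * gamma ->
  exists B T', forall N r, T' <= N -> 1 <= r -> r / 2 <= F N -> F N <= 2 * r ->
     1 + ln r + ln N <= B * (r / C N).
Proof.
move=> g0 d2 gd; have [e [c [T2 [e0 T21 hpow]]]] := weighted_primitive_power g0 d2 gd.
pose w := (2 + `|c|) / e.
exists ((3 + w) * (2 / I (2 * T))), (Num.max T2 (2 * T)) => N r.
rewrite ge_max => /andP[NT2 NT] r1 _ Fr2.
have s1 := sqrtr_ge1 r1; have s0 : 0 < Num.sqrt r by exact: lt_le_trans s1.
have r0 : 0 <= r by exact: le_trans r1.
have sT : Num.sqrt r <= 2 / I (2 * T) * (r / C N).
  rewrite mulrAC ler_pdivlMr//; apply: le_trans (sqrt_primitive NT r1 Fr2).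
  by rewrite ler_pM2l// primitive_ge_initial.
have CI0 : 0 < C N * I N by rewrite mulr_gt0 ?primitive_gt0// C0// (le_trans T20).
have CI2 : C N * I N <= 2 * Num.sqrt r.
  rewrite -(ler_pXn2r (n := 2)) ?nnegrE ?(ltW CI0) ?mulr_ge0 ?(ltW s0)// -FE exprMn sqr_sqrtr//.
  by apply: (le_trans Fr2); rewrite ler_wpM2r// expr2 ler_peMr ?ler1n.
have lnN : ln N <= w * Num.sqrt r.
  rewrite /w mulrAC ler_pdivlMr// mulrC; apply: (le_trans (hpow _ NT2)).
  rewrite mulrDl; apply: lerD; first exact: le_trans (ln_le_self CI0) CI2.
  by apply: (le_trans (ler_norm _)); rewrite ler_peMr.
have w0 : 0 <= 3 + w by rewrite addr_ge0// divr_ge0 ?addr_ge0// ltW.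
rewrite -[leRHS]mulrA; apply: le_trans (ler_wpM2l w0 sT).
have := ln_le_sqrt r1; move: s1 lnN; drop_facts => *; lra.
Qed.

Lemma primitive_cut_head Kb : 1 <= Kb ->
  exists B J2 T', forall J1 n N r, (J2 <= J1)%N -> (J1 <= n)%N ->
     T' <= N -> N / 2 <= n%:R -> n%:R <= N -> 1 <= r -> r / 2 <= F N -> F N <= 2 * r ->
     head_sum f Kb r J1 n <= B * (r / C N).
Proof.
move=> Kb1; exists (Kb * (K * 2)), (Num.truncn T).+2, (2 * T).
move=> [//|m] n N r JJ Jn NT _ nN r1 _ Fr2.
have Kb0 : 0 < Kb by exact: lt_le_trans Kb1.
apply: (le_trans (head_sum_le_sum f0 r n (ltW Kb0) (ltn0Sn m))).
have s0 : 0 < Num.sqrt r by rewrite (lt_le_trans ltr01)// sqrtr_ge1.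
have := sum_le_primitive (natr_ge_truncn JJ) (ltnW Jn) nN.
rewrite -(ler_pM2l s0) [leRHS]mulrCA => h; rewrite -!mulrA ler_pM2l//; apply: (le_trans h).
by rewrite ler_pM2l// sqrt_primitive.
Qed.

Lemma primitive_cut_bound (logM f_inv : R -> R) : cut_bound logM f (fun n => 1 / C n%:R) ->
  0 <= gamma -> delta <= 2 -> 0 < 2 - delta + 2 * gamma -> asymptotic_inverse F f_inv ->
  lesssim_near +oo logM (fun r => r / C (f_inv r)).
Proof.
move=> cb g0 d2 gd Finv; have [K' [T' T'1 Fd]] := primitive_cut_doubling.
apply: (bound_at_inverse C0 Cp cb Finv T'1 Fd primitive_cut_infinite).
- exact: primitive_cut_logs.
- exact: primitive_cut_head.
Qed.

End primitive.

(** * Cutoff functions *)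

Section cutoff.
Context {R : realType}.
Variables (g : R -> R).
Hypothesis gloc : forall t, 1 <= t -> exists B, forall s, 1 <= s -> s <= t -> g s <= B.
Hypothesis ginf : forall A, exists2 T, 1 <= T & forall t, T <= t -> A <= g t.

Definition cutoff_set (r : R) : set R :=
  [set t | 1 <= t /\ sup [set g s / r | s in `[1, t]] <= 1].
(** k(r) and h(r) are the cutoffs of 2 D and of d_phi / d_l. *)
Definition cutoff (r : R) : R := sup (cutoff_set r).

(** The inner supremum is a bound for all s in [1, t] only because g is locally
    bounded: the supremum of an unbounded set is a default value. *)
Lemma cutoff_setP r t : 0 < r -> 1 <= t ->
  (cutoff_set r t <-> forall s, 1 <= s -> s <= t -> g s <= r).
Proof.
move=> r0 t1; have [B hB] := gloc t1.
have hs : has_sup [set g s / r | s in `[1, t]].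
  split; first by exists (g 1 / r); exists 1 => //=; rewrite in_itv/= lexx.
  exists (B / r) => _ [s /= /itvP h <-]; rewrite ler_pM2r ?invr_gt0//.
  by apply: hB; rewrite h.
split=> [[_ h] s s1 st|h].
  rewrite -[leRHS]mul1r -ler_pdivrMr//; apply: le_trans h.
  apply: ub_le_sup; first by case: hs.
  by exists s => //=; rewrite in_itv/= s1.
split => //; apply: ge_sup; first by case: hs.
move=> _ [s /= /itvP hst <-]; rewrite ler_pdivrMr// mul1r; apply: h; by rewrite hst.
Qed.

Lemma cutoff_set_bounded r : 0 < r -> has_ubound (cutoff_set r).
Proof.
move=> r0; have [T T1 hT] := ginf (r + 1); exists T => t ht.
have t1 : 1 <= t by case: ht.
have [//|Tt] := leP t T.
have /(cutoff_setP r0 t1)/(_ T T1 (ltW Tt)) := ht.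
by have := hT _ (lexx _); lra.
Qed.

Lemma cutoff_ge r t : 0 < r -> 1 <= t ->
  (forall s, 1 <= s -> s <= t -> g s <= r) -> t <= cutoff r.
Proof.
move=> r0 t1 h; apply: ub_le_sup; first exact: cutoff_set_bounded.
exact/cutoff_setP.
Qed.

Lemma cutoff_large M : exists2 R0, 1 <= R0 & forall r, R0 <= r -> M <= cutoff r.
Proof.
have t1 : 1 <= Num.max 1 M by rewrite le_max lexx.
have [B hB] := gloc t1.
exists (Num.max 1 B); first by rewrite le_max lexx.
move=> r; rewrite ge_max => /andP[r1 Br].
apply: (@le_trans _ _ (Num.max 1 M)); first by rewrite le_max lexx orbT.
apply: cutoff_ge => //; first by lra.
move=> s s1 st; exact: le_trans (hB _ s1 st) Br.
Qed.

Lemma below_cutoff r s : 0 < r -> 1 <= s -> s < cutoff r -> g s <= r.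
Proof.
move=> r0 s1 sc.
have ne : cutoff_set r !=set0.
  apply/set0P/negP => /eqP e; move: sc; rewrite /cutoff e sup0; lra.
have [t ht st] := sup_gt ne sc.
have t1 : 1 <= t by case: ht.
by have /(cutoff_setP r0 t1) := ht; apply => //; exact: ltW.
Qed.

(** As g may jump, it exceeds r at some point between the cutoff and t, not
    necessarily at t. *)
Lemma above_cutoff r t : 0 < r -> 1 <= t -> cutoff r < t ->
  exists s, [/\ 1 <= s, cutoff r <= s, s <= t & r < g s].
Proof.
move=> r0 t1 ct.
have : ~ (forall s, 1 <= s -> s <= t -> g s <= r).
  by move=> h; have := cutoff_ge r0 t1 h; rewrite leNgt ct.
move=> /existsNP[s /not_implyP[s1 /not_implyP[st /negP]]]; rewrite -ltNge => rg.
exists s; split => //; rewrite leNgt; apply/negP => /(below_cutoff r0 s1).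
by rewrite leNgt rg.
Qed.

End cutoff.

Section ray_cutoff.
Context {R : realType}.
Variables (f D : R -> R) (K T delta : R).
Hypothesis mf : measurable_fun (`[1, +oo[ : set R) f.
Hypothesis f0 : forall t, 1 <= t -> 0 < f t.
Hypothesis T1 : 1 <= T.
Hypothesis K0 : 0 < K.
Hypothesis fK : forall s t, T <= s -> s <= t -> f t <= K * f s.
Local Notation mu := (@lebesgue_measure R).
Hypothesis ffin : (\int[mu]_(x in `[1%R, +oo[) (f x)%:E < +oo)%E.
Hypothesis fE : forall t, 1 <= t -> f t = 1 / Num.sqrt (D t).
Hypothesis lnf : forall t, 1 <= t -> ln (f t) = - ln (D t) / 2.
Hypothesis D0 : forall t, 1 <= t -> 0 < D t.
Hypothesis Dp : potter D delta.
Let f0' t : 1 <= t -> 0 <= f t. Proof. by move=> /f0 /ltW. Qed.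

Lemma integral_ray_finite a : 1 <= a -> (\int[mu]_(x in `[a, +oo[) (f x)%:E < +oo)%E.
Proof.
move=> a1; apply: le_lt_trans ffin; apply: ge0_subset_integral => //.
- by apply: (measurable_ge1 mf) => //; exact: measurable_itv.
- by move=> x; rewrite /= in_itv/= andbT lee_fin; exact: f0'.
- by move=> x; rewrite /= !in_itv/= !andbT; exact: le_trans.
Qed.

Lemma ray_integral_ge (k a b : R) x c : 1 <= k -> k <= a -> 0 < c ->
  (x%:E <= c%:E * \int[mu]_(x in `]a, b]) (f x)%:E)%E ->
  x <= c * \int[mu]_(x in `[k, +oo[) f x.
Proof.
move=> k1 ka c0; apply: (le_Rintegral_of_sub mf f0') => //.
- by move=> y /= /itvP h; rewrite in_itv/= andbT (le_trans ka)// ltW// h.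
- by move=> y /=; rewrite !in_itv/= !andbT; exact: le_trans.
- exact: integral_ray_finite.
Qed.

(** With N = k(r), D(N) is comparable to r up to doubling. The steps up to N
    cost O(N) by [head_sum_log] with y = 1, and the later ones are bounded
    linearly by sqrt r times the integral of f over the ray. The integral over
    [N, 2 N] alone is at least N f(2 N) / K, that is, N / sqrt r up to a
    constant, so N and log r are absorbed. *)
Lemma ray_integral_bound (logM k : R -> R) : 0 <= delta ->
  (forall M, exists2 R0, 1 <= R0 & forall r, R0 <= r -> M <= k r) ->
  (forall r s, 0 < r -> 1 <= s -> s < k r -> 2 * D s <= r) ->
  (forall r t, 0 < r -> 1 <= t -> k r < t ->
     exists s, [/\ 1 <= s, k r <= s, s <= t & r < 2 * D s]) ->
  full_bound logM f ->
  lesssim_near +oo logM (fun r => Num.sqrt r * \int[mu]_(x in `[k r, +oo[) f x).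
Proof.
move=> d0 klarge kbelow kabove [Kb [J [Kb1 H]]].
have T1' := T1; have K0' := K0.
have [Kd [Td [Kd1 Td1] hD]] := potter_doubling D0 Dp.
pose A := 2 * Kd.
have A1 : 1 <= A by rewrite /A; lra_from Kd1.
have [K2 [J2 [K21 J21 hhead]]] := head_sum_log D0 f0 lnf Dp d0 Kb1 A1.
have [K1 [R1 [K11 R11 hR]]] := H (maxn J J2) (leq_maxl _ _).
have [T2 T21 hT2] := potter_power Dp ltr01.
have [R2 R21 hR2] := klarge (Num.max (Num.max (2 * Td) (2 * T)) (Num.max T2 (maxn J J2).+2%:R)).
pose c := ln A + 2 * (delta + 1).
have c0 : 0 <= c by rewrite /c addr_ge0 ?ln_ge0//; lra_from d0.
have KK := mulr_gt0 K0 (lt_le_trans ltr01 Kd1).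
pose Kt := K1 * (1 + c) + 4 * K2.
have Kt0 : 0 < Kt.
  have h := mulr_ge0 (le_trans ler01 K11) (addr_ge0 ler01 c0).
  by rewrite /Kt (ltr_wpDl h)// mulr_gt0// (lt_le_trans ltr01 K21).
exists (Kt * (K * Kd) + 2 * (Kb * K)).
  by apply: addr_gt0; [exact: mulr_gt0|rewrite !mulr_gt0// (lt_le_trans ltr01)].
apply/near_pinftyE; exists (Num.max R1 R2); first by rewrite le_max R11.
move=> r; rewrite ge_max => /andP[r1 r2].
have rr1 : 1 <= r by lra_from r1 R11.
have r0 : 0 < r by lra_from rr1.
have := hR2 _ r2; have kb := kbelow r; have ka := kabove r.
set N := k r in kb ka *; rewrite !ge_max => /andP[/andP[NTd NT] /andP[NT2 NJ]].
have N2 : 2 <= N by lra_from NT Td1 NTd.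
have N1 : 1 <= N by lra_from N2.
set G := \int[mu]_(x in `[N, +oo[) f x.
pose s := Num.sqrt r.
have ss : s ^+ 2 = r by rewrite sqr_sqrtr// ltW.
have s1 : 1 <= s by rewrite -sqrtr1 ler_wsqrtr.
have s0 : 0 < s by lra_from s1.
(* 2 D exceeds r somewhere in [N, 2 N], and doubling compares that value with
   the one at 2 N. *)
have DNr : r <= A * D (2 * N).
  have [u [u1 Nu uN ru]] := ka (2 * N) r0 ltac:(lra_from N2) ltac:(lra_from N2).
  have [_ h] := hD u (2 * N) ltac:(lra_from NTd Nu N2) uN ltac:(lra_from Nu).
  by rewrite /A; lra_from h ru.
have DN2 : 0 < D (2 * N) by apply: D0; lra_from N2.
(* Below the cutoff 2 D is at most r; the point N / 2 is safely below. *)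
have DNle : D (2 * N) <= Kd ^+ 2 * r.
  have h1 := kb (N / 2) r0 ltac:(lra_from N2) ltac:(lra_from N2).
  have [h2 _] := hD (N / 2) N ltac:(lra_from NTd) ltac:(lra_from N2) ltac:(lra_from N2).
  have [h3 _] := hD N (2 * N) ltac:(lra_from NTd N2) ltac:(lra_from N2) ltac:(lra_from N2).
  have D2 : 0 < D (N / 2) by apply: D0; lra_from N2.
  have h4 : D (N / 2) <= r by lra_from h1 D2.
  apply: (le_trans h3); rewrite expr2 -mulrA ler_pM2l; last by lra_from Kd1.
  apply: (le_trans h2); rewrite ler_pM2l//; lra_from Kd1 h4.
have fN2 : 1 <= Kd * s * f (2 * N).
  rewrite fE; last by lra_from N2.
  rewrite mulrA mulr1 ler_pdivlMr ?sqrtr_gt0// mul1r.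
  have Ks : 0 <= Kd * s by rewrite mulr_ge0//; lra_from Kd1 s0.
  by rewrite -[leRHS](ger0_norm Ks) -sqrtr_sqr ler_wsqrtr// exprMn ss.
have NG : N <= K * Kd * (s * G).
  have h1 : N * f (2 * N) <= K * G.
    apply: (@ray_integral_ge N N (2 * N)) => //.
    have := integral_itv_ge mf f0' T1 K0 fK (a := N) (b := 2 * N) ltac:(lra_from NT N2) ltac:(lra_from N2).
    by have -> : 2 * N - N = N by ring.
  have Ks : 0 <= Kd * s by rewrite mulr_ge0//; lra_from Kd1 s0.
  have h2 := ler_wpM2l Ks h1.
  have h3 : N <= N * (Kd * s * f (2 * N)) by rewrite ler_peMr//; lra_from N2 fN2.
  by lra_from h2 h3.
have lr : ln r <= c * N.
  apply: (@le_trans _ _ (ln (A * D (2 * N)))).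
    by rewrite ler_ln ?posrE//; apply: lt_le_trans DNr.
  have A0 : 0 < A by lra_from A1.
  rewrite lnM ?posrE//.
  have := hT2 (2 * N) ltac:(lra_from NT2 N2); rewrite ler_norml => /andP[_ h1].
  have h2 : ln (2 * N) <= 2 * N by apply: ln_le_self; lra_from N2.
  have h3 : (delta + 1) * ln (2 * N) <= (delta + 1) * (2 * N) by rewrite ler_wpM2l//; lra_from d0 h2.
  have h4 : ln A <= ln A * N by rewrite ler_peMr// ln_ge0.
  by rewrite /c; lra_from h1 h2 h3 h4.
(* The head is split at the first integer m beyond N. *)
pose m := (Num.truncn N).+1.
have Nm : N <= m%:R by exact: natr_ge_truncn.
have mN : m%:R <= 2 * N.
  have /andP[h _] : (Num.truncn N)%:R <= N < (Num.truncn N).+1%:R by apply: truncn_itv; lra_from N1.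
  by rewrite /m -natr1; lra_from h N2.
have Jm : (maxn J J2 <= m)%N.
  rewrite -(ler_nat R); apply: le_trans Nm; apply: le_trans NJ; by rewrite ler_nat -addn2 leq_addr.
have Tm : T <= m%:R by lra_from NT Nm N2.
have J10 : (1 <= maxn J J2)%N by exact: leq_trans J21 (leq_maxr _ _).
have hm : head_sum f Kb r (maxn J J2) m <= K2 * (2 * N).
  have := hhead (maxn J J2) m (2 * N) 1 r (leq_maxr _ _) Jm ltac:(lra_from N2 Nm) mN (lexx _) r0.
  rewrite expr1n mulr1 ln1 addr0 mulr1 => /(_ DNr) h; apply: (le_trans h).
  by rewrite ler_pM2l//; lra_from K21.
have Gp : 0 <= s * G.
  have : 0 < K * Kd * (s * G) by lra_from NG N2.
  by rewrite (pmulr_rgt0 _ KK) => /ltW.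
have hn n : (maxn J J2 <= n)%N -> 2 * head_sum f Kb r (maxn J J2) n <= 4 * K2 * N + 2 * (Kb * K) * (s * G).
  move=> Jn; have [nm|mn] := leqP n m.
    have := head_sum_widen f0 r J10 (le_trans ler01 Kb1) nm.
    have : 0 <= (Kb * K) * (s * G) by rewrite mulr_ge0// mulr_ge0 ?(ltW K0)// (le_trans ler01).
    by move: hm; move: (head_sum _ _ _ _ _) (head_sum _ _ _ _ _) => u v; drop_facts; lra.
  have h1 : head_sum f Kb r (maxn J J2) n =
     head_sum f Kb r (maxn J J2) m + head_sum f Kb r m.+1 n.
    by rewrite /head_sum (big_cat_nat (n := m.+1))//=; [exact: leqW|exact: ltnW].
  have h2 := head_sum_le_sum f0 r n (le_trans ler01 Kb1) (ltn0Sn m).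
  have h3 : \sum_(m.+1 <= j < n.+1) f j%:R <= K * G.
    apply: (@ray_integral_ge N m%:R n%:R) => //.
    exact: (sum_le_integral mf f0' T1 K0 fK Tm (ltnW mn)).
  have h4 : Kb * (s * \sum_(m.+1 <= j < n.+1) f j%:R) <= Kb * (s * (K * G)).
    rewrite ler_pM2l; last by lra_from Kb1.
    by rewrite ler_pM2l.
  move: h1 h2 hm h4; rewrite -/s; move: (head_sum _ _ _ _ _) (head_sum _ _ _ _ _) (head_sum _ _ _ _ _) (\sum_(_ <= _ < _) _) => u v w x; drop_facts; lra.
have fin := hR r _ r1 hn.
apply: (le_trans fin); rewrite -/s.
have h1 : K1 * (1 + ln r) <= K1 * (1 + c) * N.
  by rewrite -mulrA ler_pM2l; lra_from K11 lr N1.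
have h2 : Kt * N <= Kt * (K * Kd * (s * G)) by rewrite ler_pM2l.
rewrite /Kt in h2 *; lra_from h1 h2.
Qed.

End ray_cutoff.

(** * The cut at a cutoff, with the lengths beyond it *)

Section head_ray_cutoff.
Context {R : realType}.
Variables (f dl : R -> R) (K T : R).
Hypothesis mf : measurable_fun (`[1, +oo[ : set R) f.
Hypothesis f0 : forall t, 1 <= t -> 0 < f t.
Hypothesis T1 : 1 <= T.
Hypothesis K0 : 0 < K.
Hypothesis fK : forall s t, T <= s -> s <= t -> f t <= K * f s.
Local Notation mu := (@lebesgue_measure R).
Hypothesis floc : forall t, 1 <= t -> (\int[mu]_(x in `[1%R, t]) (f x)%:E < +oo)%E.
Hypothesis mdl : measurable_fun (`[1, +oo[ : set R) dl.
Hypothesis dl0 : forall t, 1 <= t -> 0 < dl t.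
Hypothesis dlK : forall s t, T <= s -> s <= t -> dl t <= K * dl s.
Hypothesis dlfin : (\int[mu]_(x in `[1%R, +oo[) (dl x)%:E < +oo)%E.
Variables (g : R -> R) (e T2 : R) (tail : nat -> R) (c : R) (Jt : nat).
Hypothesis e0 : 0 < e.
Hypothesis g0 : forall t, 1 <= t -> 0 < g t.
Hypothesis gpow : forall t, T2 <= t -> e * ln t <= ln (g t).
Hypothesis c0 : 0 < c.
Hypothesis tail_le : forall n S, (Jt <= n)%N ->
  (forall m, \sum_(n.+1 <= j < m) dl j%:R <= S) -> tail n <= c * S.

(** With N = h(r), the head up to N is bounded linearly by the integral of f,
    and the tail by that of d_l. The hypothesis gpow, a power lower bound for
    the function g defining the cutoff, makes log N = O(log r), and log r is
    O(sqrt r). *)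
Lemma head_ray_integral_bound (logM h : R -> R) :
  (forall M, exists2 R0, 1 <= R0 & forall r, R0 <= r -> M <= h r) ->
  (forall r s, 0 < r -> 1 <= s -> s < h r -> g s <= r) ->
  cut_bound logM f tail ->
  lesssim_near +oo logM (fun r => Num.sqrt r * (\int[mu]_(x in `[1, h r]) f x)
     + r * \int[mu]_(x in `[h r, +oo[) dl x).
Proof.
move=> hlarge hbelow [Kb [J [Kb1 H]]].
have T1' := T1; have K0' := K0; have e0' := e0; have c0' := c0.
pose I t := \int[mu]_(x in `[1, t]) f x.
have i0 : 0 < I (2 * T) by exact: (primitive_gt0 mf f0 T1 K0 fK floc (lexx _)).
set i1 := I (2 * T) in i0.
pose J1 := maxn J (Num.truncn T).+2.
have [K1 [N0 [K11 J1N hN]]] := H J1 (leq_maxl _ _).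
have [R2 R21 hR2] := hlarge (Num.max (Num.max 2 (2 * T)) (Num.max (2 * T2) (maxn Jt N0).+2%:R)).
pose w := 5 + 2 / e.
have w0 : 0 < w by rewrite addr_gt0// divr_gt0.
have K10 : 0 < K1 by exact: lt_le_trans K11.
have Kb0 : 0 < Kb by exact: lt_le_trans Kb1.
have A0 : 0 < K1 * w / i1 by rewrite divr_gt0// mulr_gt0.
have B0 : 0 < Kb * (K * (1 + K)) by rewrite mulr_gt0// mulr_gt0// addr_gt0.
have C0 : 0 < K1 * (c * K) by rewrite !mulr_gt0.
exists (K1 * w / i1 + 2 * (Kb * (K * (1 + K))) + K1 * (c * K)).
  by apply: addr_gt0 => //; apply: addr_gt0 => //; exact: mulr_gt0.
apply/near_pinftyE; exists R2 => // r r2.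
have rr1 : 1 <= r by lra_from R21 r2.
have r0 : 0 < r by lra_from rr1.
have := hR2 _ r2; have hb := hbelow r.
set N := h r in hb *; rewrite !ge_max => /andP[/andP[N2 NT] /andP[NT2 NJ]].
have N1 : 1 <= N by lra_from N2.
rewrite -/(I N); set G := \int[mu]_(x in `[N, +oo[) dl x.
have IN : i1 <= I N.
  by apply: (primitive_nondecreasing mf f0 floc) => //; lra_from T1'.
pose s := Num.sqrt r.
have ss : s ^+ 2 = r by rewrite sqr_sqrtr// ltW.
have s1 : 1 <= s by rewrite -sqrtr1 ler_wsqrtr.
have s0 : 0 < s by lra_from s1.
have lr : ln r <= 2 * s := ln_le_sqrt rr1.
(* The cut is placed at p + 1, the first integer beyond N, so that the tail is
   bounded by an integral over [N, +oo[. *)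
pose p := Num.truncn N.
have [p1 p2] := truncn_half N2; rewrite -/p in p1 p2.
have pN : N < p.+1%:R by exact: truncnS_gt.
have Np : ((maxn Jt N0).+1 <= p)%N.
  rewrite -(ler_nat R); apply: (@le_trans _ _ (N - 1)); last first.
    by move: pN; rewrite -natr1; drop_facts; lra.
  by move: NJ; rewrite -natr1; drop_facts; lra.
have [Jtp N0p] : (Jt <= p)%N /\ (N0 <= p)%N.
  by apply/andP; rewrite -geq_max; exact: ltnW.
have J1p : (J1 <= p)%N by exact: leq_trans J1N N0p.
have pp1 : 1 <= p%:R :> R by lra_from p1 N2.
have J10 : (1 <= J1)%N by rewrite (leq_trans _ (leq_maxr _ _)).
have lnN : ln p.+1%:R <= 2 + 2 / e * s.
  apply: (@le_trans _ _ (ln (4 * (N / 2)))).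
    rewrite ler_ln ?posrE; [|by rewrite ltr0n|lra_from N2].
    by rewrite -natr1; lra_from p2 N2.
  have N20 : 0 < N / 2 by lra_from N2.
  rewrite lnM ?posrE//.
  have h4 : ln 4 <= 2 :> R.
    have -> : 4 = 2 * 2 :> R by ring.
    by rewrite lnM ?posrE//; have := @ln2_le1 R; drop_facts; lra.
  (* N / 2 is strictly below the cutoff, where g is at most r. *)
  have h1 := gpow (t := N / 2) ltac:(lra_from NT2).
  have h2 : ln (g (N / 2)) <= ln r.
    rewrite ler_ln ?posrE ?g0//; [|lra_from N2].
    by apply: hb => //; lra_from N2.
  have h3 : ln (N / 2) <= 2 / e * s.
    by rewrite mulrAC ler_pdivlMr//; lra_from h1 h2 lr.
  lra_from h4 h3.
have fin := hN r p.+1 rr1 (leqW N0p).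
have mE : J1 = J1.-1.+1 by rewrite prednK.
have Tm1 : T <= J1.-1%:R.
  apply: (le_trans (ltW (truncnS_gt T))); rewrite ler_nat -ltnS -mE; exact: leq_maxr.
have mn : (J1.-1 <= p)%N by exact: leq_trans (leq_pred _) J1p.
have Tp : T <= p%:R by apply: (le_trans Tm1); rewrite ler_nat.
have sumf : \sum_(J1 <= j < p.+2) f j%:R <= K * (1 + K) * I N.
  rewrite big_nat_recr/=; last exact: leqW.
  have a1 : \sum_(J1 <= j < p.+1) f j%:R <= K * I N.
    by rewrite mE; exact: (sum_le_primitive mf f0 T1 K0 fK floc Tm1 mn p2).
  have a2 : f p.+1%:R <= K * f p%:R by apply: fK => //; rewrite ler_nat.
  have a3 : f p%:R <= \sum_(J1 <= j < p.+1) f j%:R.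
    rewrite big_nat_recr//= lerDr big_nat sumr_ge0// => j /andP[Jj _].
    by rewrite ltW// f0// ler1n (leq_trans J10).
  have a4 : K * f p%:R <= K * (K * I N) by rewrite ler_pM2l//; exact: le_trans a3 a1.
  lra_from a1 a2 a4.
have hhead : head_sum f Kb r J1 p.+1 <= Kb * (K * (1 + K)) * (s * I N).
  apply: (le_trans (head_sum_le_sum f0 r p.+1 (le_trans ler01 Kb1) J10)).
  rewrite -mulrA ler_pM2l; last by lra_from Kb1.
  by rewrite mulrCA ler_pM2l.
have G0 : 0 <= G.
  apply: Rintegral_ge0 => x; rewrite /= in_itv/= andbT => Nx.
  by rewrite ltW// dl0//; lra_from Nx N1.
have htail : tail p.+1 <= c * (K * G).
  apply: tail_le; first exact: leqW.
  move=> m; have [mp|pm] := leqP m p.+2.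
    by rewrite big_geq// mulr_ge0// ltW.
  case: m pm => // m; rewrite ltnS => pm.
  have Tp1 : T <= p.+1%:R by apply: (le_trans Tp); rewrite ler_nat.
  apply: (ray_integral_ge mdl dl0 dlfin (a := p.+1%:R) (b := m%:R)) => //; first exact: ltW.
  have dl0' t : 1 <= t -> 0 <= dl t by move=> /dl0 /ltW.
  exact: (sum_le_integral mdl dl0' T1 K0 dlK Tp1 (ltnW pm)).
apply: (le_trans fin); rewrite -/s.
have sI : s <= s * I N / i1 by rewrite ler_pdivlMr// ler_pM2l.
have h1 : K1 * (1 + ln r + ln p.+1%:R) <= K1 * w * s.
  rewrite -mulrA ler_pM2l; [|lra_from K11]; rewrite /w; lra_from lr lnN s1.
have h2 : K1 * w * s <= K1 * w / i1 * (s * I N).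
  have -> : K1 * w / i1 * (s * I N) = K1 * w * (s * I N / i1) by ring.
  by rewrite (ler_pM2l (mulr_gt0 K10 w0)).
have h3 : K1 * (r * tail p.+1) <= K1 * (c * K) * (r * G).
  by rewrite -mulrA ler_pM2l// mulrCA -mulrA (ler_pM2l r0).
have rG : 0 <= r * G by rewrite mulr_ge0// ltW.
have sI0 : 0 <= s * I N by rewrite mulr_ge0 ?(ltW s0)// (le_trans (ltW i0)).
have a1 := mulr_ge0 (ltW A0) rG; have a2 := mulr_ge0 (ltW B0) rG; have a3 := mulr_ge0 (ltW C0) sI0.
move: hhead h1 h2 h3 a1 a2 a3; move: (head_sum _ _ _ _ _) (K1 * w / i1) (Kb * _) (K1 * (c * K)) => u va vb vc.
by drop_facts; lra.
Qed.

End head_ray_cutoff.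

(** * Consequences of the hypotheses on the majorants *)

Section hypotheses_consequences.
Context {R : realType}.
Local Notation mu := (@lebesgue_measure R).

Lemma almost_nonincreasing_mul (f : R -> R) : (forall t, 1 <= t -> 0 < f t) ->
  almost_nonincreasing f -> exists K T, [/\ 0 < K, 1 <= T &
  forall s t, T <= s -> s <= t -> f t <= K * f s].
Proof.
move=> f0 [c [T T1 hT]]; exists (expR c), T; split; [exact: expR_gt0|by []|].
move=> s t Ts st; have := hT _ _ Ts st.
have fs : 0 < f s by apply: f0; lra.
have ft : 0 < f t by apply: f0; lra.
by rewrite -{1}[c]expRK addrC -lnM ?posrE ?expR_gt0// ler_ln ?posrE ?mulr_gt0 ?expR_gt0.
Qed.

Section almost_monotone_integrand.
Variables (f : R -> R).
Hypothesis mf : measurable_fun (`[1, +oo[ : set R) f.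
Hypothesis f0 : forall t, 1 <= t -> 0 < f t.
Let f0' t : 1 <= t -> 0 <= f t. Proof. by move=> /f0 /ltW. Qed.

Lemma integral_head_finite t B : 1 <= t -> (forall s, 1 <= s -> s <= t -> f s <= B) ->
  (\int[mu]_(x in `[1%R, t]) (f x)%:E < +oo)%E.
Proof.
move=> t1 hB; have sub : `[1, t]%classic `<=` (`[1, +oo[%classic : set R).
  by move=> x /= /itvP h; rewrite in_itv/= andbT h.
apply: (@le_lt_trans _ _ (\int[mu]_(x in `[1%R, t]) (B)%:E)%E).
  apply: ge0_le_integral => //.
  - by move=> x /sub; rewrite /= in_itv/= andbT lee_fin; exact: f0'.
  - by apply: (measurable_ge1 mf).
  - by move=> x /= /itvP h; rewrite lee_fin hB// h.
by rewrite integral_cst//= lebesgue_measure_itv/=; case: ifP => _; rewrite ?mule0 ?ltry// -EFinB -EFinM ltry.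
Qed.

Variables (K T : R).
Hypothesis T1 : 1 <= T.
Hypothesis K0 : 0 < K.
Hypothesis fK : forall s t, T <= s -> s <= t -> f t <= K * f s.

Lemma sum_finite_of_integral : (\int[mu]_(x in `[1%R, +oo[) (f x)%:E < +oo)%E ->
  exists S J, (1 <= J)%N /\ forall n, \sum_(J <= j < n) f j%:R <= S.
Proof.
move=> fin; pose m := (Num.truncn T).+1.
have Tm : T <= m%:R by apply: ltW; exact: truncnS_gt.
pose G := K * \int[mu]_(x in `[m%:R, +oo[) f x.
exists G, m.+1; split => // n.
have m1 : 1 <= m%:R :> R by exact: le_trans Tm.
have G0 : 0 <= G.
  rewrite mulr_ge0 ?(ltW K0)//; apply: Rintegral_ge0 => x; rewrite /= in_itv/= andbT => mx.
  by apply: f0'; exact: le_trans mx.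
have [nm|] := leqP n m.+1; first by rewrite big_geq.
case: n => // n; rewrite ltnS => mn.
apply: (ray_integral_ge mf f0 fin (a := m%:R) (b := n%:R)) => //.
exact: (sum_le_integral mf f0' T1 K0 fK Tm (ltnW mn)).
Qed.

(** For delta > 2 the function f would be integrable. *)
Lemma divergent_delta_le2 (D : R -> R) delta :
  (forall t, 1 <= t -> exists B, forall s, 1 <= s -> s <= t -> f s <= B) ->
  (forall t, 1 <= t -> ln (f t) = - ln (D t) / 2) -> potter D delta ->
  (\int[mu]_(x in `[1%R, +oo[) (f x)%:E = +oo)%E -> delta <= 2.
Proof.
move=> floc lnf Dp inf; rewrite leNgt; apply/negP => d2.
have e0 : 0 < (delta - 2) / 4 by lra.
have [T2 T21 hT2] := step_cost_power lnf Dp e0.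
have [B B0 hB] := @sum_power R _ e0.
pose m := (Num.truncn (Num.max T T2)).+1.
have : Num.max T T2 <= m%:R by apply: ltW; exact: truncnS_gt.
rewrite ge_max => /andP[Tm T2m].
have m1 : 1 <= m%:R :> R by exact: le_trans Tm.
have hS n : \sum_(m <= j < n) f j%:R <= B.
  apply: (@le_trans _ _ (\sum_(m <= j < n) expR (- (1 + (delta - 2) / 4) * ln j%:R))).
    apply: ler_sum_nat => j /andP[mj _].
    have mj' : m%:R <= j%:R :> R by rewrite ler_nat.
    have j1 : 1 <= j%:R :> R by exact: le_trans mj'.
    rewrite -[leLHS]lnK ?posrE ?f0// ler_expR.
    by have := hT2 j%:R (le_trans T2m mj'); lra.
  by apply: le_trans (hB n); apply: ler_sum_widen.
have fin1 := integral_tail_finite mf f0' T1 K0 fK Tm hS.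
have [B' hB'] := floc _ m1.
have fin2 := integral_head_finite m1 hB'.
have sub1 : `[1, m%:R]%classic `<=` (`[1, +oo[%classic : set R).
  by move=> x /= /itvP h; rewrite in_itv/= andbT h.
have sub2 : `[m%:R, +oo[%classic `<=` (`[1, +oo[%classic : set R).
  by move=> x /=; rewrite !in_itv/= !andbT; exact: le_trans.
have sub3 : `]m%:R, +oo[%classic `<=` (`[m%:R, +oo[%classic : set R).
  by move=> x /=; rewrite !in_itv/= !andbT => /ltW.
have ge1 (x : R) : `[1, +oo[%classic x -> (0 <= (f x)%:E)%E.
  by rewrite /= in_itv/= andbT lee_fin; exact: f0'.
have fin3 : (\int[mu]_(x in `]m%:R, +oo[) (f x)%:E < +oo)%E.
  apply: le_lt_trans fin1; apply: ge0_subset_integral => //.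
  - by apply: (measurable_ge1 mf) => //; exact: measurable_itv.
  - by move=> x /sub2/ge1.
have : (\int[mu]_(x in `[1%R, +oo[) (f x)%:E < +oo)%E.
  have -> : `[1, +oo[%classic = (`[1, m%:R] `|` `]m%:R, +oo[)%classic :> set R.
    apply/seteqP; split => x /=; rewrite !in_itv/= ?andbT.
      by move=> ->; case: (leP x m%:R) => ?; [left|right].
    by move=> [/andP[->]//|/ltW]; exact: le_trans.
  rewrite ge0_integral_setU//.
  - exact: lte_add_pinfty.
  - apply: (measurable_ge1 mf); first exact: measurableU.
    by rewrite subUset; split => // x /sub3/sub2.
  - by move=> x [/sub1/ge1|/sub3/sub2/ge1].
  - apply/disj_setPS => x [/=]; rewrite !in_itv/= ?andbT => /andP[_ xb] bx.
    by move: (le_lt_trans xb bx); rewrite ltxx.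
by rewrite inf.
Qed.

End almost_monotone_integrand.

Lemma tail_sum_le (l : nat -> R) (d : R -> R) : (forall j, (0 < j)%N -> 0 < l j) ->
  summable_seq l -> lesssim_near \oo l (fun j => d j%:R) ->
  exists c Jt, 0 < c /\ forall n S, (Jt <= n)%N ->
    (forall m, \sum_(n.+1 <= j < m) d j%:R <= S) -> tail_sum l n <= c * S.
Proof.
move=> l0 ls [c c0 /near_inftyE[Jt hJ]]; exists c, Jt; split => // n S Jn hS.
apply: (tail_sum_le_partial l0 ls) => [j|m]; first exact: length_dominated.
apply: (@le_trans _ _ (c * \sum_(n.+1 <= j < m) d j%:R)); last by rewrite ler_pM2l.
rewrite mulr_sumr; apply: ler_sum_nat => j /andP[nj _].
by apply: hJ; rewrite (leq_trans Jn)// ltnW.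
Qed.

Lemma inv_sqrt_infinite (u : R -> R) : (forall t, 1 <= t -> 0 < u t) ->
  u t @[t --> +oo] --> (0 : R) ->
  forall A, exists2 T, 1 <= T & forall t, T <= t -> A <= 1 / Num.sqrt (u t).
Proof.
move=> u0 ul A; pose B := Num.max 1 A.
have B1 : 1 <= B by rewrite le_max lexx.
have b0 : 0 < (B ^+ 2)^-1 by rewrite invr_gt0 exprn_gt0//; lra.
move/cvgrPdist_le : ul => /(_ _ b0) /near_pinftyE[T T1 hT]; exists T => // t Tt.
have t1 : 1 <= t by lra.
have ut := u0 _ t1.
apply: (@le_trans _ _ B); first by rewrite le_max lexx orbT.
have := hT _ Tt; rewrite sub0r normrN gtr0_norm// => h.
rewrite ler_pdivlMr ?sqrtr_gt0// -ler_pdivlMl; last by lra.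
rewrite mulr1 -(@ger0_norm _ B^-1) ?invr_ge0; last by lra.
by rewrite -sqrtr_sqr ler_wsqrtr// exprVn.
Qed.

Lemma index_ge0 (C : R -> R) gamma : potter C gamma ->
  (forall A, exists2 T, 1 <= T & forall t, T <= t -> A <= C t) -> 0 <= gamma.
Proof.
move=> Cp Cinf; rewrite leNgt; apply/negP => g0.
have e0 : 0 < - gamma / 2 by lra.
have [T T1 hT] := potter_power Cp e0.
have [T2 T21 hT2] := Cinf 2.
have t1 : 1 <= Num.max T T2 by rewrite le_max T1.
have := hT (Num.max T T2); rewrite le_max lexx => /(_ isT).
have := hT2 (Num.max T T2); rewrite le_max lexx orbT => /(_ isT) c2.
rewrite ler_norml => /andP[_].
have : 0 < ln (C (Num.max T T2)) by rewrite ln_gt0//; lra.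
have : 0 <= ln (Num.max T T2) by rewrite ln_ge0.
nra.
Qed.

(** Both directions of comparison say the same on compact sets, namely that d is
    bounded away from 0 and infinity. *)
Lemma asymp_locally1 (d : R -> R) : (forall t, 1 <= t -> 0 < d t) ->
  asymp_locally d (fun=> 1) \/ asymp_locally (fun=> 1) d ->
  forall t, exists B, 0 < B /\ forall s, 1 <= s -> s <= t -> d s <= B /\ 1 <= B * d s.
Proof.
move=> d0 h t.
have kc : compact `[1, t]%classic by exact: segment_compact.
have sub : `[1, t]%classic `<=` (`[1, +oo[%classic : set R).
  by move=> x /= /itvP hx; rewrite in_itv/= andbT hx.
have : exists c c', [/\ 0 < c, 0 < c' & forall s, 1 <= s -> s <= t -> d s <= c /\ 1 <= c' * d s].
  case: h => /(_ _ kc sub) [[c c0 hc] [c' c'0 hc']].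
    exists c, c'; split => // s s1 st.
    have sI : `[1, t]%classic s by rewrite /= in_itv/= s1.
    by have := hc _ sI; have := hc' _ sI; rewrite mulr1.
  exists c', c; split => // s s1 st.
  have sI : `[1, t]%classic s by rewrite /= in_itv/= s1.
  by have := hc _ sI; have := hc' _ sI; rewrite mulr1.
move=> [c [c' [c0 c'0 hc]]]; exists (c + c'); split; first exact: addr_gt0.
move=> s s1 st; have [h1 h2] := hc _ s1 st; split; first by lra.
by apply: (le_trans h2); rewrite ler_pM2r ?d0//; lra.
Qed.

Lemma potter_infinite (g : R -> R) a : (forall t, 1 <= t -> 0 < g t) -> potter g a -> 0 < a ->
  forall A, exists2 T, 1 <= T & forall t, T <= t -> A <= g t.
Proof.
move=> g0 gp a0 A; have a2 : 0 < a / 2 by lra.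
have [T2 T21 hT2] := potter_power gp a2.
have [T3 T31 hT3] := ln_near_ge (ln (Num.max 1 A) / (a / 2)).
exists (Num.max T2 T3); first by rewrite le_max T21.
move=> t; rewrite ge_max => /andP[t2 t3].
have t1 : 1 <= t by lra.
have := hT2 _ t2; have := hT3 _ t3; rewrite ler_pdivrMr// ler_norml => u1 /andP[u2 _].
have M1 : 1 <= Num.max 1 A by rewrite le_max lexx.
apply: (@le_trans _ _ (Num.max 1 A)); first by rewrite le_max lexx orbT.
have gt := g0 _ t1.
by rewrite -ler_ln ?posrE; lra.
Qed.

End hypotheses_consequences.

(** * The growth of the monodromy matrix *)

Theorem theorem4p6 (R : realType) (l phi : nat -> R) (psi : R)
    (d_l d_phi c_l c_phi : R -> R) (W : R -> R[i] -> 'M[R[i]]_2)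
    (l_gt0 : forall j, (0 < j)%N -> 0 < l j)
    (l_summable : summable_seq l)
    (W_fund : fundamental_solution (hamburger l phi) (total_length l) W)
    (d_l_rv : regularly_varying d_l)
    (d_phi_rv : regularly_varying d_phi)
    (c_l_rv : regularly_varying c_l)
    (c_phi_rv : regularly_varying c_phi)
    (d_l_mono : approx_nonincreasing d_l)
    (d_phi_mono : approx_nonincreasing d_phi)
    (c_l_mono : approx_nonincreasing c_l)
    (c_phi_mono : approx_nonincreasing c_phi)
    (d_l_loc : asymp_locally d_l (fun=> 1))
    (d_phi_loc : asymp_locally (fun=> 1) d_phi)
    (c_phi_c_l : lesssim_near +oo c_phi c_l)
    (ind_lt0 : ind d_l + ind d_phi < 0)
    (c_lim : c_l t * c_phi t @[t --> +oo] --> (0 : R))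
    (l_bound : lesssim_near \oo l (fun j => d_l j%:R))
    (phi_bound : lesssim_near \oo (fun j => `|sin (phi j.+1 - phi j)|)
                                  (fun j => d_phi j%:R))
    (l_tail : lesssim_near \oo (tail_sum l) (fun N => c_l N%:R))
    (phi_tail : lesssim_near \oo
                  (tail_sum (fun j => l j * sin (phi j - psi) ^+ 2))
                  (fun N => c_phi N%:R)) :
  let W_H := W (total_length l) in
  let rho := order W_H in
  let logM (r : R) : R := ln (max_norm W_H r) in
  let delta_l := - ind d_l in
  let delta_phi := - ind d_phi in
  let D (t : R) : R := 1 / (d_l t * d_phi t) in
  let delta := ind D in
  let C (t : R) : R := 1 / Num.sqrt (c_l t * c_phi t) in
  let gamma := ind C in
  let tC (t : R) : R := t * C t in
  let Dm12 (s : R) : R := 1 / Num.sqrt (D s) in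
  let k := kfun d_l d_phi in
  let h := hfun d_l d_phi in
  [/\
      lesssim_on `[1, +oo[ D tC ->
      let alpha := 4 * sup [set D t / tC t | t in `[1, +oo[] in
      let f (t : R) : R := tC t * ln (alpha * (tC t / D t)) in
      (forall f_inv : R -> R, asymptotic_inverse f f_inv ->
         lesssim_near +oo logM (fun r => r / C (f_inv r))) /\
      (rho <= (1 / (1 + gamma))%:E)%E,
      lesssim_on `[1, +oo[ tC D ->
      (\int[lebesgue_measure]_(s in `[1%R, +oo[) (Dm12 s)%:E < +oo)%E ->
      0 < gamma \/ approx_nondecreasing (fun t => d_phi t / d_l t) ->
      lesssim_near +oo logM
        (fun r => Num.sqrt r * \int[lebesgue_measure]_(s in `[k r, +oo[) Dm12 s) /\
      (rho <= (1 / delta)%:E)%E,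
      lesssim_on `[1, +oo[ tC D ->
      (\int[lebesgue_measure]_(s in `[1%R, +oo[) (Dm12 s)%:E = +oo)%E ->
      lesssim_on `[1, +oo[ (fun t => 1 / d_l t) tC ->
      (delta, gamma) <> (2, 0) ->
      let f1 (t : R) : R := (C t * \int[lebesgue_measure]_(s in `[1, t]) Dm12 s) ^+ 2 in
      (forall f1_inv : R -> R, asymptotic_inverse f1 f1_inv ->
         lesssim_near +oo logM (fun r => r / C (f1_inv r))) /\
      (rho <= ((2 - delta + gamma) / (2 - delta + 2 * gamma))%:E)%E
    &
      lesssim_on `[1, +oo[ tC D ->
      (\int[lebesgue_measure]_(s in `[1%R, +oo[) (Dm12 s)%:E = +oo)%E ->
      lesssim_on `[1, +oo[ tC (fun t => 1 / d_l t) ->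
      (\int[lebesgue_measure]_(s in `[1%R, +oo[) (d_l s)%:E < +oo)%E ->
      delta_phi < delta_l ->
      lesssim_near +oo logM
        (fun r => Num.sqrt r * (\int[lebesgue_measure]_(s in `[1, h r]) Dm12 s)
                  + r * \int[lebesgue_measure]_(s in `[h r, +oo[) d_l s) /\
      (rho <= ((1 - delta_phi) / (delta_l - delta_phi))%:E)%E ].
Proof.
move=> W_H rho logM delta_l delta_phi D delta C gamma tC f k h.
have [al dl_rv] := d_l_rv; have [ap dp_rv] := d_phi_rv.
have [bl cl_rv] := c_l_rv; have [bp cp_rv] := c_phi_rv.
have dl0 t : 1 <= t -> 0 < d_l t := rv_gt0 dl_rv.
have dp0 t : 1 <= t -> 0 < d_phi t := rv_gt0 dp_rv.
have cl0 t : 1 <= t -> 0 < c_l t := rv_gt0 cl_rv.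
have cp0 t : 1 <= t -> 0 < c_phi t := rv_gt0 cp_rv.
have dd0 t : 1 <= t -> 0 < d_l t * d_phi t by move=> t1; rewrite mulr_gt0 ?dl0 ?dp0.
have cc0 t : 1 <= t -> 0 < c_l t * c_phi t by move=> t1; rewrite mulr_gt0 ?cl0 ?cp0.
have D0 t : 1 <= t -> 0 < D t by move=> t1; rewrite divr_gt0// dd0.
have C0 t : 1 <= t -> 0 < C t by move=> t1; rewrite divr_gt0// sqrtr_gt0 cc0.
have f0 t : 1 <= t -> 0 < f t by move=> t1; rewrite divr_gt0// sqrtr_gt0 D0.
have dl_al := approx_nonincreasing_almost dl0 d_l_mono.
have dp_al := approx_nonincreasing_almost dp0 d_phi_mono.
have dl_p := rv_potter dl_rv dl_al.
have dp_p := rv_potter dp_rv dp_al.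
have cl_p := rv_potter cl_rv (approx_nonincreasing_almost cl0 c_l_mono).
have cp_p := rv_potter cp_rv (approx_nonincreasing_almost cp0 c_phi_mono).
have D_rv : regularly_varying_index D (-1 * (al + ap)).
  apply: (rv_powR (rv_mul dl_rv dp_rv)) => t t1.
  by rewrite /D div1r powR_inv1// ltW// dd0.
have C_rv : regularly_varying_index C (- 2^-1 * (bl + bp)).
  apply: (rv_powR (rv_mul cl_rv cp_rv)) => t t1.
  by rewrite /C div1r powRN powR12_sqrt// ltW// cc0.
have deltaE : delta = - (al + ap) by rewrite /delta (rv_ind D_rv) mulN1r.
have gammaE : gamma = - 2^-1 * (bl + bp) by rewrite /gamma (rv_ind C_rv).
have dlE : delta_l = - al by rewrite /delta_l (rv_ind dl_rv).
have dpE : delta_phi = - ap by rewrite /delta_phi (rv_ind dp_rv).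
have delta0 : 0 < delta by rewrite deltaE oppr_gt0 -(rv_ind dl_rv) -(rv_ind dp_rv).
have lnD t : 1 <= t -> ln (D t) = -1 * ln (d_l t) + -1 * ln (d_phi t).
  by move=> t1; rewrite /D div1r lnV ?posrE ?dd0// lnM ?posrE ?dl0 ?dp0//; ring.
have lnC t : 1 <= t -> ln (C t) = - 2^-1 * ln (c_l t) + - 2^-1 * ln (c_phi t).
  move=> t1; rewrite /C div1r lnV ?posrE ?sqrtr_gt0 ?cc0// -powR12_sqrt ?(ltW (cc0 _ t1))//.
  by rewrite ln_powR lnM ?posrE ?cl0 ?cp0//; ring.
have Dp : potter D delta.
  by have -> : delta = -1 * al + -1 * ap by [rewrite deltaE; ring]; exact: potter_lin dl_p dp_p lnD.
have Cp : potter C gamma.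
  by have -> : gamma = - 2^-1 * bl + - 2^-1 * bp by [rewrite gammaE; ring]; exact: potter_lin cl_p cp_p lnC.
have lnf t : 1 <= t -> ln (f t) = - ln (D t) / 2.
  move=> t1; have d := D0 _ t1; rewrite /f div1r lnV ?posrE ?sqrtr_gt0//.
  by rewrite ln_sqrt// mulNr.
have fE t : 1 <= t -> f t = 1 / Num.sqrt (D t) by [].
have fsq t : 1 <= t -> f t = Num.sqrt (d_l t * d_phi t).
  move=> t1; have d := dd0 _ t1; rewrite /f /D !div1r sqrtrV ?(ltW d)// invrK//.
have mf : measurable_fun (`[1, +oo[ : set R) f.
  have f_rv : regularly_varying_index f (2^-1 * (al + ap)).
    apply: (rv_powR (rv_mul dl_rv dp_rv)) => t t1.
    by rewrite fsq// powR12_sqrt// ltW// dd0.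
  by case: f_rv.
have mdl : measurable_fun (`[1, +oo[ : set R) d_l by case: dl_rv.
have [Kl [Tl [Kl0 Tl1 hKl]]] := almost_nonincreasing_mul dl0 dl_al.
have [Kp [Tp [Kp0 Tp1 hKp]]] := almost_nonincreasing_mul dp0 dp_al.
pose K := Num.max Kl (Num.sqrt (Kl * Kp)); pose T := Num.max Tl Tp.
have T1 : 1 <= T by rewrite le_max Tl1.
have K0 : 0 < K by rewrite lt_max Kl0.
have dlK s t : T <= s -> s <= t -> d_l t <= K * d_l s.
  rewrite ge_max => /andP[Ts _] st; apply: (le_trans (hKl _ _ Ts st)).
  have s1 := le_trans Tl1 Ts.
  by rewrite ler_wpM2r ?(ltW (dl0 _ s1))// le_max lexx.
have fK s t : T <= s -> s <= t -> f t <= K * f s.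
  rewrite ge_max => /andP[Ts Ts'] st.
  have s1 := le_trans Tl1 Ts; have t1 := le_trans s1 st.
  rewrite !fsq//; apply: (@le_trans _ _ (Num.sqrt (Kl * Kp) * Num.sqrt (d_l s * d_phi s))).
    have p : 0 <= Kl * Kp by rewrite ltW// mulr_gt0.
    rewrite -sqrtrM// ler_wsqrtr// mulrACA.
    by apply: ler_pM; rewrite ?hKl ?hKp// ltW ?dl0 ?dp0.
  by rewrite ler_wpM2r ?sqrtr_ge0// le_max lexx orbT.
have locl := asymp_locally1 dl0 (or_introl d_l_loc).
have locp := asymp_locally1 dp0 (or_intror d_phi_loc).
have fbound t : 1 <= t -> exists B, forall s, 1 <= s -> s <= t -> f s <= B.
  move=> t1; have [B1 [B10 h1]] := locl t; have [B2 [B20 h2]] := locp t.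
  exists (Num.sqrt (B1 * B2)) => s s1 st; rewrite fsq// ler_wsqrtr//.
  have [a1 _] := h1 _ s1 st; have [a2 _] := h2 _ s1 st.
  by apply: ler_pM => //; rewrite ltW ?dl0 ?dp0.
have floc t : 1 <= t -> (\int[lebesgue_measure]_(x in `[1%R, t]) (f x)%:E < +oo)%E.
  by move=> t1; have [B hB] := fbound _ t1; exact: (integral_head_finite mf f0 t1 hB).
have Cinf := inv_sqrt_infinite cc0 c_lim.
have gamma0 := index_ge0 Cp Cinf.
have cutC : cut_bound logM f (fun n => 1 / C n%:R).
  have -> : (fun n => 1 / C n%:R) = (fun n => Num.sqrt (c_l n%:R * c_phi n%:R)).
    by apply/funext => n; rewrite /C !div1r invrK.
  exact: (head_anisotropic_tail_bound l_gt0 d_l_rv d_phi_rv d_l_mono d_phi_mono l_bound phi_bound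
    l_summable W_fund fsq c_l_rv c_phi_rv c_l_mono c_phi_mono c_phi_c_l l_tail phi_tail).
split.
- move=> [c c0 hc] alpha F; split; last first.
    apply: growth_order; first by rewrite divr_ge0// addr_ge0.
    exact: (log_cut_order f0 lnf Dp C0 Cp delta0 gamma0 cutC).
  have tC0 t : 1 <= t -> 0 < tC t by move=> t1; rewrite mulr_gt0 ?C0// (lt_le_trans ltr01 t1).
  have hs t : 1 <= t -> D t / tC t <= sup [set D t / tC t | t in `[1, +oo[].
    move=> t1; apply: ub_le_sup; last by exists t => //=; rewrite in_itv/= andbT.
    exists c => _ [s /itvP hs <-].
    have s1 : 1 <= s by rewrite hs.
    by rewrite ler_pdivrMr ?tC0//; apply: hc; rewrite /= in_itv/= andbT.
  have a4 t : 1 <= t -> 4 <= alpha * (t * C t / D t).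
    move=> t1; have := hs _ t1; rewrite ler_pdivrMr ?tC0// => h1.
    rewrite mulrA ler_pdivlMr ?D0// /alpha -mulrA ler_pM2l//.
  have a0 : 0 < alpha.
    rewrite /alpha mulr_gt0//; apply: lt_le_trans (hs _ (lexx 1)).
    by rewrite divr_gt0 ?D0 ?tC0.
  have C1 : exists2 T, 1 <= T & forall t, T <= t -> 1 <= C t by exact: Cinf.
  move=> f_inv Finv.
  exact: (log_cut_bound f0 lnf D0 Dp C0 Cp C1 cutC (ltW delta0) gamma0 a0 a4 (fun=> erefl) Finv).
- move=> _ fin gd.
  have [S [J0 [J01 hS]]] := sum_finite_of_integral mf f0 T1 K0 fK fin.
  have full : full_bound logM f.
    case: gd => [g1|mono]; first exact: (full_bound_of_cut C0 cutC Cp g1).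
    exact: (nondecreasing_ratio_bound l_gt0 d_l_rv d_phi_rv d_l_mono d_phi_mono l_bound phi_bound
      l_summable W_fund fsq mono).
  split; last first.
    apply: growth_order; first by rewrite divr_ge0// ltW.
    exact: (full_sum_order f0 lnf Dp delta0 J01 hS full).
  pose g t := 2 * D t.
  have g0 t : 1 <= t -> 0 < g t by move=> t1; rewrite mulr_gt0 ?D0.
  have gloc t : 1 <= t -> exists B, forall s, 1 <= s -> s <= t -> g s <= B.
    move=> t1; have [B1 [B10 h1]] := locl t; have [B2 [B20 h2]] := locp t.
    exists (2 * (B1 * B2)) => s s1 st; rewrite ler_pM2l// ler_pdivrMr ?dd0// mulrACA.
    have [_ a1] := h1 _ s1 st; have [_ a2] := h2 _ s1 st.
    by rewrite -[leLHS]mulr1 ler_pM.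
  have ginf A : exists2 T, 1 <= T & forall t, T <= t -> A <= g t.
    have [T2 T21 hT2] := potter_infinite D0 Dp delta0 A; exists T2 => // t Tt.
    apply: (le_trans (hT2 _ Tt)); rewrite /g ler_peMl ?ler1n// ltW// D0//; exact: le_trans Tt.
  have kE r : k r = cutoff g r.
    rewrite /k /kfun /cutoff /cutoff_set; congr sup; apply: eq_set => t; congr (_ /\ (sup _ <= _)).
    apply: eq_imagel => u _; rewrite /g /D !invfM; ring.
  have klarge M : exists2 R0, 1 <= R0 & forall r, R0 <= r -> M <= k r.
    have [R0 R01 hR] := cutoff_large gloc ginf M.
    by exists R0 => // r /hR; rewrite kE.
  apply: (ray_integral_bound mf f0 T1 K0 fK fin fE lnf D0 Dp (ltW delta0) klarge _ _ full).
    move=> r s r0 s1; rewrite kE; exact: (below_cutoff gloc).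
  move=> r t r0 t1; rewrite kE; exact: (above_cutoff gloc ginf).
- move=> _ inf _ ne f1.
  have d2 : delta <= 2 := divergent_delta_le2 mf f0 T1 K0 fK fbound lnf Dp inf.
  have gd : 0 < 2 - delta + 2 * gamma.
    have [g1|g1] := ltP 0 gamma; first by lra_from d2 g1.
    have [d3|d3] := ltP delta 2; first by lra_from d3 gamma0.
    by case: ne; congr pair; apply/eqP; rewrite eq_le ?d2 ?d3 ?g1 ?gamma0.
  split; last first.
    apply: growth_order; first by rewrite divr_ge0 ?(ltW gd)// addr_ge0// subr_ge0.
    exact: (primitive_cut_order f0 lnf Dp C0 Cp d2 gamma0 gd cutC).
  move=> f1_inv Finv.
  exact: (primitive_cut_bound mf f0 T1 K0 fK floc lnf Dp C0 Cp Cinf (fun=> erefl) cutC gamma0 d2 gd Finv).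
- move=> _ inf _ dlfin dlt.
  have d2 : delta <= 2 := divergent_delta_le2 mf f0 T1 K0 fK fbound lnf Dp inf.
  have dE : delta = delta_l + delta_phi by rewrite deltaE dlE dpE; ring.
  have [c [Jt [c0 tail_le]]] := tail_sum_le l_gt0 l_summable l_bound.
  have [S [J0 [J01 hS]]] := sum_finite_of_integral mdl dl0 T1 K0 dlK dlfin.
  have cut := head_isotropic_tail_bound l_gt0 d_l_rv d_phi_rv d_l_mono d_phi_mono l_bound phi_bound
    l_summable W_fund fsq.
  have dl_p' : potter d_l (- delta_l) by rewrite dlE opprK.
  split; last first.
    apply: growth_order.
      by rewrite dE in d2; rewrite divr_ge0//; lra_from d2 dlt.
    exact: (length_tail_order f0 lnf Dp dl0 dl_p' dE c0 tail_le J01 hS dlt d2 cut).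
  pose g t := d_phi t / d_l t.
  have g0 t : 1 <= t -> 0 < g t by move=> t1; rewrite divr_gt0 ?dl0 ?dp0.
  have gloc t : 1 <= t -> exists B, forall s, 1 <= s -> s <= t -> g s <= B.
    move=> t1; have [B1 [B10 h1]] := locl t; have [B2 [B20 h2]] := locp t.
    exists (B1 * B2) => s s1 st.
    have [_ a1] := h1 _ s1 st; have [a2 _] := h2 _ s1 st.
    have p := dl0 _ s1; have q := dp0 _ s1.
    rewrite ler_pdivrMr// mulrAC; apply: (@le_trans _ _ (1 * B2)); first by rewrite mul1r.
    by rewrite ler_wpM2r// ltW.
  have gp : potter g (ap - al).
    have -> : ap - al = 1 * ap + -1 * al by ring.
    apply: (potter_lin dp_p dl_p) => t t1.
    by rewrite /g lnM ?posrE ?invr_gt0 ?dl0 ?dp0// lnV ?posrE ?dl0//; ring.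
  have e0 : 0 < (ap - al) / 2 by move: dlt; rewrite dlE dpE ltrN2 -subr_gt0 => hlt; rewrite divr_gt0.
  have [T2 T21 hT2] := potter_power gp e0.
  have gpow t : T2 <= t -> (ap - al) / 2 * ln t <= ln (g t).
    by move=> /hT2; rewrite ler_norml => /andP[u _]; lra_from u.
  have ginf : forall A, exists2 T, 1 <= T & forall t, T <= t -> A <= g t.
    by apply: (potter_infinite g0 gp); move: dlt; rewrite dlE dpE ltrN2 subr_gt0.
  have hE r : h r = cutoff g r.
    rewrite /h /hfun /cutoff /cutoff_set; congr sup; apply: eq_set => t; congr (_ /\ (sup _ <= _)).
    apply: eq_imagel => u _; rewrite /g invfM; ring.
  have hlarge M : exists2 R0, 1 <= R0 & forall r, R0 <= r -> M <= h r.
    have [R0 R01 hR] := cutoff_large gloc ginf M.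
    by exists R0 => // r /hR; rewrite hE.
  apply: (head_ray_integral_bound mf f0 T1 K0 fK floc mdl dl0 dlK dlfin e0 g0 gpow c0 tail_le hlarge _ cut).
  by move=> r s r0 s1; rewrite hE; exact: (below_cutoff gloc).
Qed.
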